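(* The maximum value of $lpsr(G)$ among all maximal planar graphs $G$ with $n$ vertices converges to $\frac13$ as $n\to\infty$, where $lpsr(G)$ is the labeled plane-saturation ratio of $G$.
   Context: All graphs are finite and simple. A plane graph is a planar graph together with a specific plane embedding: vertices are mapped to distinct points of $\mathbb{R}^2$ and edges to simple topological curves joining their endpoints, where no two curves intersect, overlap or touch except possibly at common endpoints. A maximal planar graph on $n\ge 3$ vertices is a planar graph to which no edge can be added while keeping it simple and planar; it has $3n-6$ edges. Let $e(\cdot)$ denote the number of edges. Labeled plane-saturated subgraph: a plane graph $H=(V',E')$ with labeled vertices is a labeled plane-saturated subgraph of $G=(V,E)$ if $V'=V$, $E'\subseteq E$, and no edge of $E\setminus E'$ can be added to the drawing of $H$ (as a curve joining the two correspondingly labeled vertices) without introducing a crossing. The embedding of $H$ is arbitrary and need not extend to an embedding of $G$. The labeled plane-saturation ratio is $lpsr(G)=\min\{\frac{e(H)}{e(G)} : H \text{ is a labeled plane-saturated subgraph of } G\}$. *)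

(* Defs.v *)
From HB Require Import structures.
From mathcomp Require Import all_boot all_order all_algebra.
From mathcomp Require Import all_classical all_reals all_analysis.

Set Implicit Arguments.
Unset Strict Implicit.
Unset Printing Implicit Defensive.

Import Order.TTheory GRing.Theory Num.Theory.
Import numFieldNormedType.Exports.

Local Open Scope classical_set_scope.
Local Open Scope ring_scope.

Section PlaneGraphs.
Variables (R : realType) (V : finType).

(* A graph with vertex set V is given by its set of edges, an edge being the
   two-element set of its endpoints; thus e(G) is #|G|. *)
Definition simple_graph (G : {set {set V}}) : Prop :=
  forall e, e \in G -> #|e| = 2%N.

(* Only the restriction to [0, 1] of g matters. *)
Definition simple_curve (g : R -> R * R) : Prop :=
  {within `[0, 1], continuous g} /\ {in `[0, 1] &, injective g}.

Definition trace (g : R -> R * R) : set (R * R) := g @` `[0, 1].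

(* The vertex v is drawn at p v and the edge e along c e; the values of c
   outside of G are irrelevant. A curve may meet a vertex only if that vertex is
   one of its endpoints, also when the vertex is isolated. *)
Definition plane_drawing (G : {set {set V}}) (p : V -> R * R)
    (c : {set V} -> R -> R * R) : Prop :=
  [/\ injective p,
      forall e, e \in G ->
        simple_curve (c e) /\ [set c e 0; c e 1] = p @` [set` e],
      forall e v, e \in G -> trace (c e) (p v) -> v \in e
    & forall e f, e \in G -> f \in G -> e != f ->
        trace (c e) `&` trace (c f) `<=` p @` [set` e :&: f]].

Definition plane_graph (G : {set {set V}}) (p : V -> R * R)
    (c : {set V} -> R -> R * R) : Prop :=
  simple_graph G /\ plane_drawing G p c.

Definition planar (G : {set {set V}}) : Prop :=
  exists p c, plane_graph G p c.

Definition maximal_planar (G : {set {set V}}) : Prop :=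
  [/\ (3 <= #|V|)%N, planar G
    & forall e : {set V}, #|e| = 2%N -> e \notin G -> ~ planar (e |: G)].

(* The edge e can be added to the drawing (p, c) of H along the curve g. *)
Definition addable (H : {set {set V}}) (p : V -> R * R)
    (c : {set V} -> R -> R * R) (e : {set V}) : Prop :=
  exists g : R -> R * R,
    plane_graph (e |: H) p (fun f => if f == e then g else c f).

Definition labeled_plane_saturated_subgraph (G H : {set {set V}})
    (p : V -> R * R) (c : {set V} -> R -> R * R) : Prop :=
  [/\ plane_graph H p c, H \subset G
    & forall e, e \in G :\: H -> ~ addable H p c e].

(* For planar G, the default value 1 of the minimum is e(G) / e(G) with G itself
   drawn in the plane: see lpsr_attained and lpsr_le. *)
Definition lpsr (G : {set {set V}}) : R :=
  \big[Num.min/1]_(H : {set {set V}} |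
      `[< exists p c, labeled_plane_saturated_subgraph G H p c >])
    (#|H|%:R / #|G|%:R).

End PlaneGraphs.

(* Up to isomorphism, the vertex set is 'I_n. The default value 0 only matters
   for n < 3: see max_lpsr_attained and lpsr_le_max. *)
Definition max_lpsr (R : realType) (n : nat) : R :=
  \big[Num.max/0]_(G : {set {set 'I_n}} | `[< maximal_planar R G >]) lpsr R G.

Section Extrema.
Variable R : realType.

Lemma lpsr_le (V : finType) (G H : {set {set V}}) p c :
  @labeled_plane_saturated_subgraph R V G H p c ->
  lpsr R G <= #|H|%:R / #|G|%:R.
Proof. by move=> GH; apply: bigmin_le_cond; apply/asboolP; exists p, c. Qed.

Lemma lpsr_attained (V : finType) (G : {set {set V}}) : planar R G ->
  exists H p c, @labeled_plane_saturated_subgraph R V G H p c /\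
    lpsr R G = #|H|%:R / #|G|%:R.
Proof.
move=> [p [c Gpc]].
set P := fun H : {set {set V}} =>
  `[< exists p c, @labeled_plane_saturated_subgraph R V G H p c >].
have PG : P G.
  by apply/asboolP; exists p, c; split=> // e; rewrite finset.setDv inE.
have le1 H : P H -> #|H|%:R / #|G|%:R <= 1 :> R.
  case/asboolP=> q [d [_ HG _]].
  have [G0|G0] := posnP #|G|; first by rewrite G0 invr0 mulr0 ler01.
  by rewrite ler_pdivrMr ?ltr0n// mul1r ler_nat subset_leq_card.
rewrite /lpsr (bigmin_eq_arg _ _ _ _ PG le1).
case: arg_minP => // H /asboolP[q [d Hqd]] _.
by exists H, q, d.
Qed.

Lemma lpsr_ge0 (V : finType) (G : {set {set V}}) : 0 <= lpsr R G.
Proof.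
by rewrite /lpsr; elim/big_ind: _ => [|x y x0 y0|H _];
  rewrite ?ler01 ?le_min ?x0 ?y0 ?divr_ge0 ?ler0n.
Qed.

Lemma lpsr_le_max (n : nat) (G : {set {set 'I_n}}) :
  maximal_planar R G -> lpsr R G <= max_lpsr R n.
Proof. by move=> Gmax; apply: le_bigmax_cond; apply/asboolP. Qed.

Lemma maximal_planar_exists (V : finType) : (3 <= #|V|)%N ->
  exists G : {set {set V}}, maximal_planar R G.
Proof.
move=> V3.
have P0 : `[< planar R (finset.set0 : {set {set V}}) >].
  apply/asboolP; exists (fun v => ((enum_rank v)%:R, 0)), (fun _ _ => (0, 0)).
  split; first by move=> e; rewrite inE.
  split=> [v w [] /eqP| e | e v | e f]; rewrite ?inE //.
  by rewrite eqr_nat => /eqP/val_inj/enum_rank_inj.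
have [G /maxsetP[/asboolP GP Gmax] _] :=
  maxset_exists (P := fun G : {set {set V}} => `[< planar R G >]) P0.
exists G; split=> // e e2 eG eGP.
have := Gmax (e |: G); rewrite finset.subsetUr => /(_ _ isT) GE.
by move: eG; rewrite -GE ?finset.setU11//; apply/asboolP.
Qed.

Lemma max_lpsr_attained (n : nat) : (3 <= n)%N ->
  exists G : {set {set 'I_n}}, maximal_planar R G /\ max_lpsr R n = lpsr R G.
Proof.
move=> n3; have [|G0 G0max] := @maximal_planar_exists 'I_n.
  by rewrite card_ord.
set P := fun G : {set {set 'I_n}} => `[< maximal_planar R G >].
have PG0 : P G0 by apply/asboolP.
rewrite /max_lpsr (bigmax_eq_arg _ _ _ _ PG0); last by move=> G _; exact: lpsr_ge0.
by case: arg_maxP => // G /asboolP GP _; exists G.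
Qed.

End Extrema.

(* Main.v *)
(** Lower bound: let G be the join of an edge (two hubs) and a path. In a drawing
    of a saturated subgraph H of G, the edges avoiding the hubs form a forest,
    which does not separate the plane, so every face touches a hub; by saturation
    every other vertex is adjacent in H to a hub, whence e(H) >= n - 2, while
    e(G) = 3n - 6.

    Upper bound: colour a plane maximal planar graph G properly with six colours
    and choose six triangular faces whose edges have few common neighbours. Draw
    only these triangles and put all remaining vertices of colour i inside the
    i-th face. In a saturated extension of this drawing, such a vertex can only be
    adjacent to vertices of the i-th triangle, and it is adjacent to two of them
    only if it is a common neighbour of an edge, whence e(H) <= (1 + o(1)) n.

    Both bounds rest on Euler's formula and on the fact that a face touching an
    interior point of an edge touches the whole edge. These are derived from a
    mod 2 argument on a fine grid: a path avoiding K1 and one avoiding K2 between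
    the same two points differ by a cycle; if K1 and K2 have at most one common
    point, the parity of the cycle is constant there, and the two paths can be
    merged into one that avoids both sets. *)

Require Import Defs.
From HB Require Import structures.
From mathcomp Require Import all_boot all_order all_algebra.
From mathcomp Require Import all_classical all_reals all_analysis.
From mathcomp Require Import ring lra zify.

Import Order.TTheory GRing.Theory Num.Theory.
Import numFieldNormedType.Exports.

Set Implicit Arguments.
Unset Strict Implicit.
Unset Printing Implicit Defensive.

Local Open Scope classical_set_scope.
Local Open Scope ring_scope.

(** * Grid chains modulo 2 *)

(** Edges are arbitrary continuous arcs and a face may approach a vertex wildly, so knowing the
    components of the complement is not enough: saturation and maximality speak of simple curves,
    and two vertices in the closure of one face must be linked by an arc inside that face. This
    works because only finitely many components of the complement accumulate at a vertex. Following
    one of them through shrinking discs gives a path, and every path contains an arc. In the upper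
    bound, the colouring makes the vertices placed in one face pairwise non-adjacent in G. An edge
    of H at such a vertex cannot cross the triangle and cannot end at another vertex of the same
    face, so it ends at the triangle. The number six comes from the vertex of degree at most 5 that
    every planar graph has; another constant would change only the error term. For each q, at most
    18q edges have more than n/q common neighbours, while there are 2n - 4 faces, so six triangles
    without such edges exist as soon as n is large compared with q. *)

Section Grid.
Implicit Types (B S : int -> int -> bool) (p q : int * int).

(* A 1-chain from [p] to [q] on the dual grid is encoded by the set [B] of cells
   that it encloses once closed by the horizontal rays from [p] and [q] to
   infinity; [vedge] and [hedge] are the grid edges it crosses. *)
Definition ray p (i j : int) : bool := (j == p.2) && (p.1 <= i).

Definition vedge B (i j : int) : bool := B i j (+) B (i - 1) j.

Definition hedge p q B (i j : int) : bool :=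
  B i j (+) B i (j - 1) (+) (ray p i j (+) ray q i j).

Definition bounded_chain p q B := exists N : nat, forall i j : int,
  ((N < `|i|%N) || (N < `|j|%N))%N -> ~~ vedge B i j /\ ~~ hedge p q B i j.

Lemma telescope_addb (g : int -> bool) (a : int) (M : nat) :
  \big[addb/false]_(k < M) (g (a + k%:Z) (+) g (a + k%:Z - 1)) =
  g (a + M%:Z - 1) (+) g (a - 1).
Proof.
elim: M => [|M IH]; first by rewrite big_ord0 addr0 addbb.
rewrite big_ord_recr /= IH.
have -> : a + M.+1%:Z - 1 = a + M%:Z by lia.
by case: (g _) (g _) (g _) => [] [] [].
Qed.

(** Summation by parts: [s] takes equal values at both ends of every edge in [f], so [s] times the
    boundary of [f] is the boundary of [s && f], and the sum telescopes. *)
Lemma sum_closed_edges (s f : int -> bool) (a : int) (M : nat) :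
  (forall l, f l -> s l = s (l + 1)) -> f (a - 1) = false ->
  f (a + M%:Z - 1) = false ->
  \big[addb/false]_(k < M) (s (a + k%:Z) && (f (a + k%:Z) (+) f (a + k%:Z - 1))) = false.
Proof.
move=> sf f0 fM.
rewrite (eq_bigr (fun k : 'I_M => (fun l => s l && f l) (a + k%:Z) (+)
   (fun l => s l && f l) (a + k%:Z - 1))); last first.
  move=> k _ /=; have := sf (a + k%:Z - 1); rewrite subrK.
  case: (f (_ - 1)) => [/(_ isT) ->|_]; last by rewrite andbF !addbF.
  by rewrite andbT; case: (s _); case: (f _).
by rewrite (telescope_addb (fun l => s l && f l)) f0 fM !andbF.
Qed.

Lemma sum_delta (M : nat) (a : int) (F : int -> bool) (x : int) :
  a <= x < a + M%:Z ->
  \big[addb/false]_(k < M) ((a + k%:Z == x) && F (a + k%:Z)) = F x.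
Proof.
move=> xa.
have kM : (`|x - a| < M)%N by lia.
rewrite (bigD1 (Ordinal kM)) //= big1 => [|k kx].
  have -> : a + `|x - a|%N%:Z = x by lia.
  by rewrite eqxx addbF.
have -> // : (a + k%:Z == x) = false.
by apply/eqP => E; move/eqP: kx; apply; apply: val_inj => /=; lia.
Qed.

(** A set [S] closed under the edges of the chain has an even degree sum, while only the ends [p]
    and [q] of the chain can have odd degree. Applied to the set of grid points joined to [p], this
    turns a chain into a path. *)
Lemma handshake S p q B : bounded_chain p q B ->
  (forall i j, vedge B i j -> S i j = S i (j + 1)) ->
  (forall i j, hedge p q B i j -> S i j = S (i + 1) j) ->
  S p.1 p.2 = S q.1 q.2.
Proof.
move=> [N NP] SV SH.
(* The square of side [M] starting at [a] contains [p] and [q], and no edge of the chain leaves it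
   ([V0], [H0]). *)
pose L : nat := (N + `|p.1| + `|p.2| + `|q.1| + `|q.2|).+2%N.
pose a : int := - L%:Z.
pose M : nat := L.*2.
pose V := vedge B; pose H := hedge p q B.
(* The degree of the grid point [(i, j)] in the chain, modulo 2. *)
have delta i j : V i j (+) V i (j - 1) (+) (H i j (+) H (i - 1) j) =
    ((i == p.1) && (j == p.2)) (+) ((i == q.1) && (j == q.2)).
  rewrite /V /H /vedge /hedge /ray.
  have E x : (x <= i) (+) (x <= i - 1) = (i == x) by lia.
  rewrite -2!E.
  move: (B i j) (B (i - 1) j) (B i (j - 1)) (B (i - 1) (j - 1)) => [] [] [] [];
  by move: (j == p.2) (j == q.2) (p.1 <= i) (p.1 <= i - 1) (q.1 <= i) (q.1 <= i - 1)
    => [] [] [] [] [] [].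
have V0 i : V i (a - 1) = false /\ V i (a + M%:Z - 1) = false.
  split; apply/negbTE.
    by have [|//] := NP i (a - 1) _; apply/orP; right; lia.
  by have [|//] := NP i (a + M%:Z - 1) _; apply/orP; right; lia.
have H0 j : H (a - 1) j = false /\ H (a + M%:Z - 1) j = false.
  split; apply/negbTE.
    by have [|//] := NP (a - 1) j _; apply/orP; left; lia.
  by have [|//] := NP (a + M%:Z - 1) j _; apply/orP; left; lia.
have sumV : \big[addb/false]_(k < M) \big[addb/false]_(l < M)
   (S (a + k%:Z) (a + l%:Z) &&
     (V (a + k%:Z) (a + l%:Z) (+) V (a + k%:Z) (a + l%:Z - 1))) = false.
  rewrite big1 // => k _.
  have [V1 V2] := V0 (a + k%:Z).
  exact: (@sum_closed_edges (S (a + k%:Z)) (V (a + k%:Z)) a M (SV _)).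
have sumH : \big[addb/false]_(k < M) \big[addb/false]_(l < M)
   (S (a + k%:Z) (a + l%:Z) &&
     (H (a + k%:Z) (a + l%:Z) (+) H (a + k%:Z - 1) (a + l%:Z))) = false.
  rewrite exchange_big big1 // => l _.
  have [H1 H2] := H0 (a + l%:Z).
  by apply: (@sum_closed_edges (S^~ (a + l%:Z)) (H^~ (a + l%:Z)) a M) => // i; exact: SH.
have sumpt (x : int * int) : a <= x.1 < a + M%:Z -> a <= x.2 < a + M%:Z ->
    \big[addb/false]_(k < M) \big[addb/false]_(l < M)
      (S (a + k%:Z) (a + l%:Z) && ((a + k%:Z == x.1) && (a + l%:Z == x.2))) =
    S x.1 x.2.
  move=> x1 x2.
  rewrite -(sum_delta (S^~ x.2) x1); apply: eq_bigr => k _.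
  rewrite -(sum_delta (fun j => (a + k%:Z == x.1) && S (a + k%:Z) j) x2).
  by apply: eq_bigr => l _; rewrite andbC -andbA andbCA.
have : (S p.1 p.2 (+) S q.1 q.2) = false.
  have ab (z : int) : (`|z| < L)%N -> a <= z < a + M%:Z.
    by rewrite /a /M -addnn; lia.
  rewrite -(sumpt p) -?(sumpt q); try by apply: ab; rewrite /L; lia.
  rewrite -[RHS](congr2 addb sumV sumH).
  rewrite -!big_split /=; apply: eq_bigr => k _.
  rewrite -!big_split /=; apply: eq_bigr => l _.
  by rewrite -!andb_addr; congr (_ && _); rewrite -[LHS]delta.
by move=> /negbT; rewrite negb_add => /eqP.
Qed.

End Grid.

(** * Connected components of the complement of a closed set *)

Section Uniform.
Variables (R : realType) (T : normedModType R).

(** The form in which compactness is used throughout, in the role of a Lebesgue number: a radius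
    that serves a whole neighbourhood of each point yields one radius that serves all of [K]. *)
Lemma compact_uniform (K : set T) (P : T -> R -> Prop) : compact K ->
  (forall z (r r' : R), 0 < r' -> r' <= r -> P z r -> P z r') ->
  (forall z, K z -> exists2 r : R, 0 < r &
     forall z', K z' -> `|z - z'| < r -> P z' r) ->
  exists2 r : R, 0 < r & forall z, K z -> P z r.
Proof.
move=> /compact_near_coveringP cK Pmon Ploc.
have : \forall r \near (0 : R)^'+, K `<=` (fun z => K z -> P z r).
  apply: cK => z /Ploc [r r0 Pr].
  exists (ball z r, [set i : R | 0 < i < r]) => /=.
    split; first exact: nbhsx_ballx.
    by near=> i => /=; apply/andP; split; near: i; [exact: nbhs_right_gt|exact: nbhs_right_lt].
  move=> [z' i] /= [zz' /andP[i0 ir]] Kz'.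
  apply: (Pmon _ r) => //; first exact: ltW.
  by apply: Pr => //; move: zz'; rewrite -ball_normE.
move=> Kr; near (0 : R)^'+ => r.
exists r; first by [].
move=> z Kz; have /(_ z Kz Kz) // : K `<=` (fun z => K z -> P z r).
by near: r.
Unshelve. all: by end_near. Qed.

End Uniform.

Section Joined.
Variable R : realType.
Local Notation pt := (R * R)%type.
Implicit Types (K : set pt) (x y z w : pt).

Lemma norm_ptE z : `|z| = Num.max `|z.1| `|z.2|.
Proof. by []. Qed.

Lemma norm_pt_lt z r : (`|z| < r) = (`|z.1| < r) && (`|z.2| < r).
Proof. by rewrite norm_ptE gt_max. Qed.

Lemma norm_pt_le z r : (`|z| <= r) = (`|z.1| <= r) && (`|z.2| <= r).
Proof. by rewrite norm_ptE ge_max. Qed.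

Definition between (a b c : R) := (a <= c <= b) || (b <= c <= a).

(** Boxes rather than segments: a box contains the axis-parallel paths between its corners that the
    grid imitates, and balls of the max norm are convex with respect to boxes ([box_dist]). *)
Definition box x y : set pt :=
  [set w | between x.1 y.1 w.1 /\ between x.2 y.2 w.2].

Definition boxfree K x y := forall w, K w -> ~ box x y w.

(* The boxes spanned by consecutive points avoid [K]: for a compact [K] this says
   that [x] and [y] lie in the same component of the complement of [K]. *)
Inductive joined K x : pt -> Prop :=
| joined_refl : ~ K x -> joined K x x
| joined_step y z : joined K x y -> boxfree K y z -> joined K x z.

Definition thick K r : set pt := [set z | exists2 w, K w & `|z - w| < r].

Lemma between_l (a b : R) : between a b a.
Proof. by rewrite /between !lexx andbT /=; exact: le_total. Qed.

Lemma betweenC (a b c : R) : between a b c = between b a c.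
Proof. by rewrite /between orbC. Qed.

Lemma boxC x y : box x y = box y x.
Proof. by apply/seteqP; split=> w [? ?]; split; rewrite betweenC. Qed.

Lemma box_l x y : box x y x.
Proof. by split; exact: between_l. Qed.

Lemma boxfreeC K x y : boxfree K x y -> boxfree K y x.
Proof. by rewrite /boxfree boxC. Qed.

Lemma between_dist (a b c d r : R) : `|a - d| < r -> `|b - d| < r ->
  between a b c -> `|c - d| < r.
Proof.
rewrite !ltr_norml /between => /andP[? ?] /andP[? ?] /orP[]/andP[? ?];
by apply/andP; split; lra.
Qed.

Lemma box_dist x y w z r : `|x - z| < r -> `|y - z| < r -> box x y w ->
  `|w - z| < r.
Proof.
rewrite !norm_pt_lt /= => /andP[x1 x2] /andP[y1 y2] [b1 b2].
by rewrite (between_dist x1 y1 b1) (between_dist x2 y2 b2).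
Qed.

Lemma joined_out K x y : joined K x y -> ~ K x /\ ~ K y.
Proof.
elim=> [Kx //|y' z _ [Kx _] free]; split=> // Kz.
by apply: (free z) => //; rewrite boxC; exact: box_l.
Qed.

Lemma joined_trans K y x z : joined K x y -> joined K y z -> joined K x z.
Proof. by move=> xy; elim=> // u v _ xu; exact: joined_step. Qed.

Lemma joined1 K x y : boxfree K x y -> joined K x y.
Proof.
move=> xy; apply: joined_step (xy); apply: joined_refl => Kx.
by apply: (xy x) => //; exact: box_l.
Qed.

Lemma joined_sym K x y : joined K x y -> joined K y x.
Proof.
elim=> [|y' z _ yx /boxfreeC yz]; first exact: joined_refl.
by apply: joined_trans yx; exact: joined1.
Qed.

Lemma joined_sub K K' x y : K `<=` K' -> joined K' x y -> joined K x y.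
Proof.
move=> KK'; elim=> [K'x|u v _ xu uv]; first by apply: joined_refl => /KK'.
by apply: joined_step xu _ => w /KK'; exact: uv.
Qed.

Lemma joined_ball K z r x y : (forall w, K w -> `|w - z| < r -> False) ->
  `|x - z| < r -> `|y - z| < r -> joined K x y.
Proof. by move=> free xr yr; apply: joined1 => w /free + /(box_dist xr yr). Qed.

Lemma thick_sub K r r' : r' <= r -> thick K r' `<=` thick K r.
Proof. by move=> rr' z [w Kw zw]; exists w => //; exact: lt_le_trans rr'. Qed.

Lemma sub_thick K r : 0 < r -> K `<=` thick K r.
Proof. by move=> r0 z Kz; exists z => //; rewrite subrr normr0. Qed.

Lemma thickU K K' r : thick (K `|` K') r = thick K r `|` thick K' r.
Proof.
apply/seteqP; split=> z.
  by move=> [w [Kw|Kw] zw]; [left|right]; exists w.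
by move=> [] [w Kw zw]; exists w => //; [left|right].
Qed.

Lemma compact_far K x : compact K -> ~ K x ->
  exists2 r : R, 0 < r & ~ thick K r x.
Proof.
move=> cK Kx.
have [z r r' r'0 rr' /(le_trans rr') //||r r0 Pr] :=
  @compact_uniform _ _ K (fun w r => r <= `|x - w|) cK.
  move=> w Kw.
  have xw : 0 < `|x - w|.
    by rewrite normr_gt0 subr_eq0; apply: contra_notN Kx => /eqP ->.
  exists (`|x - w| / 2) => [|w' Kw' ww']; first by rewrite divr_gt0.
  have := ler_distD w' x w; rewrite (distrC w' w); lra.
by exists r => // -[w /Pr xw]; rewrite ltNge xw.
Qed.

Lemma boxfree_thick K x y : compact K -> boxfree K x y ->
  exists2 r : R, 0 < r & boxfree (thick K r) x y.
Proof.
move=> cK xy.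
pose P w r := forall w', `|w' - w| < r -> ~ box x y w'.
have [z r r' r'0 rr' Pr w' w'z|w Kw|r r0 Pr] :=
  @compact_uniform _ _ K P cK.
- by apply: Pr; exact: lt_le_trans rr'.
- suff [r r0 Pr] : exists2 r : R, 0 < r & forall w', `|w' - w| < r -> ~ box x y w'.
    exists (r / 2) => [|w' Kw' ww' w'' w''w']; first by rewrite divr_gt0.
    apply: Pr; have := ler_distD w' w'' w; rewrite (distrC w' w); lra.
  have gap (a b c : R) : ~~ between a b c ->
      exists2 r : R, 0 < r & forall c', `|c' - c| < r -> ~~ between a b c'.
    pose m := Num.min a b; pose M := Num.max a b.
    have E c' : between a b c' = (m <= c' <= M).
      rewrite /between /m /M; case: (leP a b) => ab; apply/orP/andP.
      - by case=> /andP[? ?]; split; lra.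
      - by move=> [? ?]; left; apply/andP; split.
      - by case=> /andP[? ?]; split; lra.
      - by move=> [? ?]; right; apply/andP; split.
    rewrite E negb_and -!ltNge => /orP[cm|cM].
      exists (m - c) => [|c']; first by rewrite subr_gt0.
      by rewrite E ltr_norml negb_and -!ltNge => /andP[? ?]; apply/orP; left; lra.
    exists (c - M) => [|c']; first by rewrite subr_gt0.
    by rewrite E ltr_norml negb_and -!ltNge => /andP[? ?]; apply/orP; right; lra.
  have /orP[/gap [r r0 Pr]|/gap [r r0 Pr]] :
      ~~ between x.1 y.1 w.1 || ~~ between x.2 y.2 w.2.
    by rewrite -negb_and; apply/negP => /andP; exact: xy.
  + by exists r => // w'; rewrite norm_pt_lt => /andP[/Pr/negP w'1 _] [].
  + by exists r => // w'; rewrite norm_pt_lt => /andP[_ /Pr/negP w'1] [].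
exists r => // w' [w Kw w'w]; exact: (Pr w).
Qed.

Lemma joined_thick K x y : compact K -> joined K x y ->
  exists2 r : R, 0 < r & joined (thick K r) x y.
Proof.
move=> cK; elim=> [Kx|u v _ [r r0 xu] /(boxfree_thick cK) [s s0 uv]].
  have [r r0 Kxr] := compact_far cK Kx.
  by exists r => //; exact: joined_refl.
exists (Num.min r s); first by rewrite lt_min r0.
apply: (@joined_step _ _ u).
  by apply: joined_sub xu; apply: thick_sub; rewrite ge_min lexx.
by move=> w [z Kz wz]; apply: uv; exists z => //; rewrite lt_min in wz; case/andP: wz.
Qed.

End Joined.

(** * Grid chains that stay away from a set *)

Section Mesh.
Variables (R : realType) (h : R).
Hypothesis h0 : 0 < h.
Local Notation pt := (R * R)%type.
Implicit Types (K : set pt) (x y z w : pt) (B C : int -> int -> bool).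

Definition gridpt (i j : int) : pt := (i%:~R * h, j%:~R * h).

Definition gridx (a : R) : int := Num.floor (a / h).

Definition cell x : int * int := (gridx x.1, gridx x.2).

Lemma gridx_itv a : (gridx a)%:~R * h <= a < (gridx a)%:~R * h + h.
Proof.
have := floor_itv (a / h); rewrite -/(gridx a) intrD.
by rewrite ler_pdivlMr// ltr_pdivrMr// mulrDl mul1r.
Qed.

Lemma gridx_le a i : (gridx a <= i) = (a < i%:~R * h + h).
Proof.
have -> : i%:~R * h + h = (i + 1)%:~R * h by rewrite intrD mulrDl mul1r.
by rewrite -ltr_pdivrMr// -ltzD1 /gridx -real_floor_lt_int// num_real.
Qed.

Lemma dist_cell x : `|gridpt (cell x).1 (cell x).2 - x| <= h.
Proof.
rewrite norm_pt_le /= !ler_norml.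
have /andP[? ?] := gridx_itv x.1; have /andP[? ?] := gridx_itv x.2.
by apply/andP; split; apply/andP; split; lra.
Qed.

Lemma gridx_between a b i : (gridx a <= i) (+) (gridx b <= i) ->
  between a b (i%:~R * h + h).
Proof.
rewrite !gridx_le /between.
have [?|?] := ltP a (i%:~R * h + h); have [?|?] := ltP b (i%:~R * h + h) => // _;
apply/orP.
  by left; apply/andP; split; lra.
by right; apply/andP; split; lra.
Qed.

(** The discrete form of being joined off [thick K rho]. Unlike paths of boxes, these chains can be
    added modulo 2. *)
Definition farchain K rho p q B := [/\ bounded_chain p q B,
  forall i j, vedge B i j -> forall w, K w -> rho <= `|gridpt i j - w|
& forall i j, hedge p q B i j -> forall w, K w -> rho <= `|gridpt i j - w|].

Lemma bounded_chain0 p : bounded_chain p p (fun _ _ => false).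
Proof. by exists 0%N => i j _; rewrite /vedge /hedge /= addbb. Qed.

Lemma vedgeD B B' i j :
  vedge (fun i j => B i j (+) B' i j) i j = vedge B i j (+) vedge B' i j.
Proof. by rewrite /vedge addbACA. Qed.

Lemma hedgeD p q r B B' i j :
  hedge p r (fun i j => B i j (+) B' i j) i j =
  hedge p q B i j (+) hedge q r B' i j.
Proof.
rewrite /hedge /=.
move: (B i j) (B i (j - 1)) (B' i j) (B' i (j - 1)) (ray p _ _) (ray q _ _) (ray r _ _).
by do 7!case.
Qed.

Lemma farchainD K rho p q r B B' : farchain K rho p q B ->
  farchain K rho q r B' -> farchain K rho p r (fun i j => B i j (+) B' i j).
Proof.
move=> [[N NB] BV BH] [[N' NB'] BV' BH']; split.
- exists (maxn N N') => i j ij; rewrite vedgeD (hedgeD p q).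
  have [/negbTE-> /negbTE->] := NB i j ltac:(lia).
  by have [/negbTE-> /negbTE->] := NB' i j ltac:(lia).
- move=> i j; rewrite vedgeD; case: (boolP (vedge B i j)) => [/BV //|_ /=].
  exact: BV'.
- move=> i j; rewrite (hedgeD p q); case: (boolP (hedge p q B i j)) => [/BH //|_ /=].
  exact: BH'.
Qed.

Lemma farchain_sub K K' rho p q B : K `<=` K' ->
  farchain K' rho p q B -> farchain K rho p q B.
Proof.
move=> KK' [? BV BH]; split=> // i j; first by move=> /BV BV' w /KK'; exact: BV'.
by move=> /BH BH' w /KK'; exact: BH'.
Qed.

(** Encodes the L-shaped path along the row of [x] to the column of [y] and then along this column;
    [hedge_step] and [vedge_step] recover its two legs. *)
Definition step_chain x y (i j : int) : bool :=
  (gridx y.1 <= i) && ((gridx x.2 <= j) (+) (gridx y.2 <= j)).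

Lemma vedge_step x y i j : vedge (step_chain x y) i j =
  (i == gridx y.1) && ((gridx x.2 <= j) (+) (gridx y.2 <= j)).
Proof.
rewrite /vedge /step_chain -andb_addl; congr (_ && _).
by have [||->] := ltgtP i (gridx y.1); lia.
Qed.

Lemma hedge_step x y i j : hedge (cell x) (cell y) (step_chain x y) i j =
  (j == gridx x.2) && ((gridx x.1 <= i) (+) (gridx y.1 <= i)).
Proof.
rewrite /hedge /step_chain /ray /=.
have E a : (a <= j - 1) = (a <= j) (+) (j == a) by lia.
rewrite !E.
by move: (gridx y.1 <= i) (gridx x.1 <= i) (gridx x.2 <= j) (gridx y.2 <= j)
  (j == gridx x.2) (j == gridx y.2) => [] [] [] [] [] [].
Qed.

Lemma farchain_step K mu x y : boxfree (thick K mu) x y ->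
  farchain K (mu - h) (cell x) (cell y) (step_chain x y).
Proof.
move=> xy; split.
- exists (maxn (maxn `|gridx x.1| `|gridx x.2|) (maxn `|gridx y.1| `|gridx y.2|)).
  by move=> i j ij; rewrite vedge_step hedge_step; lia.
- move=> i j; rewrite vedge_step => /andP[/eqP -> /gridx_between yj] w Kw.
  (* A point of the box within [h] of the grid point; hence the loss of [h] in the margin. *)
  pose z : pt := (y.1, j%:~R * h + h).
  rewrite leNgt; apply/negP => wi; apply: (xy z).
    exists w => //; have := ler_distD (gridpt (gridx y.1) j) z w.
    suff : `|z - gridpt (gridx y.1) j| <= h by lra.
    rewrite norm_pt_le /= !ler_norml; have /andP[? ?] := gridx_itv y.1.
    by apply/andP; split; apply/andP; split; lra.
  by split=> //=; rewrite betweenC; exact: between_l.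
- move=> i j; rewrite hedge_step => /andP[/eqP -> /gridx_between xi] w Kw.
  pose z : pt := (i%:~R * h + h, x.2).
  rewrite leNgt; apply/negP => wi; apply: (xy z).
    exists w => //; have := ler_distD (gridpt i (gridx x.2)) z w.
    suff : `|z - gridpt i (gridx x.2)| <= h by lra.
    rewrite norm_pt_le /= !ler_norml; have /andP[? ?] := gridx_itv x.2.
    by apply/andP; split; apply/andP; split; lra.
  by split=> //=; exact: between_l.
Qed.

Lemma joined_farchain K mu x y : joined (thick K mu) x y ->
  exists B, farchain K (mu - h) (cell x) (cell y) B.
Proof.
elim=> [_|u v _ [B FB] uv].
  exists (fun _ _ => false); split=> [|i j|i j]; first exact: bounded_chain0.
    by rewrite /vedge.
  by rewrite /hedge /= addbb.
exists (fun i j => B i j (+) step_chain u v i j).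
exact: farchainD FB (farchain_step uv).
Qed.

Lemma int_const (f : int -> bool) (a b : int) : a <= b ->
  (forall i, a < i <= b -> f i = f (i - 1)) -> f a = f b.
Proof.
move=> ab; have [n] : exists n : nat, b = a + n%:Z by exists `|b - a|%N; lia.
elim: n b {ab} => [|n IH] b -> fab; first by rewrite addr0.
rewrite (IH (a + n%:Z) erefl); last by move=> i /andP[? ?]; apply: fab; lia.
have -> : a + n%:Z = a + n.+1%:Z - 1 by lia.
by symmetry; apply: fab; lia.
Qed.

(** A ball of the max norm is a square, so a row followed by a column joins any two of its grid
    points inside it, and [C] changes only across edges outside this ball. *)
Lemma cells_const C w r :
  (forall i j, C i j (+) C (i - 1) j -> r <= `|gridpt i j - w|) ->
  (forall i j, C i j (+) C i (j - 1) -> r <= `|gridpt i j - w|) ->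
  forall i j i' j', `|gridpt i j - w| < r -> `|gridpt i' j' - w| < r ->
  C i j = C i' j'.
Proof.
move=> Cx Cy.
have mid (a b i : int) u : a <= i <= b -> `|a%:~R * h - u| < r ->
    `|b%:~R * h - u| < r -> `|i%:~R * h - u| < r.
  rewrite !ltr_norml => /andP[ai ib] /andP[? ?] /andP[? ?].
  have ? : a%:~R * h <= i%:~R * h by rewrite ler_pM2r// ler_int.
  have ? : i%:~R * h <= b%:~R * h by rewrite ler_pM2r// ler_int.
  by apply/andP; split; lra.
have rowle i i' j : i <= i' -> `|gridpt i j - w| < r ->
    `|gridpt i' j - w| < r -> C i j = C i' j.
  rewrite !norm_pt_lt /= => ii' /andP[ir jr] /andP[i'r _].
  apply: (@int_const (C^~ j)) => // k /andP[/ltW ik ki'] /=.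
  apply/eqP; rewrite -negb_add; apply/negP => /Cx; rewrite leNgt => /negP; apply.
  by rewrite norm_pt_lt /= jr andbT (mid i i') // ik.
have colle i j j' : j <= j' -> `|gridpt i j - w| < r ->
    `|gridpt i j' - w| < r -> C i j = C i j'.
  rewrite !norm_pt_lt /= => jj' /andP[ir jr] /andP[_ j'r].
  apply: (@int_const (C i)) => // k /andP[/ltW jk kj'] /=.
  apply/eqP; rewrite -negb_add; apply/negP => /Cy; rewrite leNgt => /negP; apply.
  by rewrite norm_pt_lt /= ir (mid j j') // jk.
move=> i j i' j' ij ij'.
have ij'' : `|gridpt i j' - w| < r.
  move: ij ij'; rewrite !norm_pt_lt /= => /andP[-> _] /andP[_ ->] //.
transitivity (C i j').
  by case: (leP j j') => [|/ltW] jj; [|symmetry]; exact: colle.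
by case: (leP i i') => [|/ltW] ii; [|symmetry]; exact: rowle.
Qed.

Definition in_cell (i j : int) : set pt :=
  [set w | (i%:~R * h <= w.1 <= i%:~R * h + h) /\ (j%:~R * h <= w.2 <= j%:~R * h + h)].

Lemma in_cell_dist i j w z : in_cell i j w -> in_cell i j z -> `|w - z| <= h.
Proof.
move=> [/andP[? ?] /andP[? ?]] [/andP[? ?] /andP[? ?]].
rewrite norm_pt_le /= !ler_norml.
by apply/andP; split; apply/andP; split; lra.
Qed.

Lemma in_cell_gridpt i j : in_cell i j (gridpt i j).
Proof. by rewrite /in_cell /= !lexx !lerDl ltW. Qed.

Lemma in_cell_vedge i j w : box (gridpt i j) (gridpt i (j + 1)) w ->
  in_cell i j w /\ in_cell (i - 1) j w.
Proof.
have E k : (k + 1)%:~R * h = k%:~R * h + h by rewrite intrD mulrDl mul1r.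
have E' k : (k - 1)%:~R * h = k%:~R * h - h by rewrite intrB mulrBl mul1r.
rewrite /in_cell /box /between /= E E' orbb => -[/andP[? ?]].
have ? := h0; by case/orP => /andP[? ?]; do !split; apply/andP; split; lra.
Qed.

Lemma in_cell_hedge i j w : box (gridpt i j) (gridpt (i + 1) j) w ->
  in_cell i j w /\ in_cell i (j - 1) w.
Proof.
have E k : (k + 1)%:~R * h = k%:~R * h + h by rewrite intrD mulrDl mul1r.
have E' k : (k - 1)%:~R * h = k%:~R * h - h by rewrite intrB mulrBl mul1r.
rewrite /in_cell /box /between /= E E' orbb => -[+ /andP[? ?]].
have ? := h0; by case/orP => /andP[? ?]; do !split; apply/andP; split; lra.
Qed.

End Mesh.

(** * Separation of the plane by compact sets and arcs *)

Section Alexander.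
Variable R : realType.
Local Notation pt := (R * R)%type.
Implicit Types (K : set pt) (x y z w : pt) (B C : int -> int -> bool).

Lemma bounded_cells (h : R) K M : 0 < h -> (forall w, K w -> `|w| <= M) ->
  exists N : nat, forall i j w, K w -> in_cell h i j w ->
    (`|i| <= N)%N /\ (`|j| <= N)%N.
Proof.
move=> h0 KM; exists (Num.bound (M / h)).+1 => i j w /KM.
rewrite norm_pt_le !ler_norml => /andP[/andP[a1 a2] /andP[b1 b2]] [/andP[i1 i2] /andP[j1 j2]].
have M0 : 0 <= M / h by rewrite divr_ge0 ?(ltW h0)//; lra.
have := archi_boundP M0; rewrite ltr_pdivrMr//; move: (Num.bound _) => N MN.
have bnd (k : int) : k%:~R * h <= M -> - M <= k%:~R * h + h -> (`|k| <= N.+1)%N.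
  move=> k1 k2.
  have : k%:~R < N%:Z%:~R :> R by rewrite -(ltr_pM2r h0); apply: le_lt_trans MN.
  have : - N%:Z%:~R < (k + 1)%:~R :> R.
    by rewrite -(ltr_pM2r h0) intrD !mulrDl mul1r mulNr; apply: lt_le_trans k2; rewrite ltrN2.
  rewrite -mulrNz !ltr_int; clear; lia.
by split; apply: bnd; lra.
Qed.

(** The merged chain is [B1] plus the boundary of [D], the part of the enclosed region [C] made of
    the cells that meet [K2]. On cells meeting [K1], [D] vanishes and the chain runs as [B1]; on
    cells meeting [K2], [D] equals [C] and the chain runs as [B2]. It thus avoids both sets, and
    [handshake] extracts a path from it. *)
Lemma alexander_mesh K1 K2 (h rho M : R) p q B1 B2 (c0 : bool) :
  0 < h -> 8 * h <= rho -> (forall w, K2 w -> `|w| <= M) ->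
  farchain h K1 rho p q B1 -> farchain h K2 rho p q B2 ->
  (forall w1 w2, K1 w1 -> K2 w2 -> `|w1 - w2| <= h ->
     exists2 w, K1 w /\ K2 w & `|w2 - w| <= rho / 2) ->
  (forall w, K1 w -> K2 w ->
     let: (i, j) := cell h w in B1 i j (+) B2 i j = c0) ->
  ~ (K1 `|` K2) (gridpt h p.1 p.2) ->
  joined (K1 `|` K2) (gridpt h p.1 p.2) (gridpt h q.1 q.2).
Proof.
move=> h0 hrho KM F1 F2 near12 Cc0 Kp.
pose C i j := B1 i j (+) B2 i j (+) c0.
have vC i j : C i j (+) C (i - 1) j = vedge B1 i j (+) vedge B2 i j.
  by rewrite /C /vedge addbACA addbb addbF addbACA.
have hC i j : C i j (+) C i (j - 1) = hedge p q B1 i j (+) hedge p q B2 i j.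
  by rewrite /C /hedge addbACA addbb addbF [LHS]addbACA [RHS]addbACA addbb addbF.
have [[N1 NB1] V1 H1] := F1; have [_ V2 H2] := F2.
(* A boundary edge of [C] belongs to one of the two chains and stays [rho] away from every common
   point, so [C] is constant around it; the shift by [c0] makes this value false. *)
have C0 i j w : K1 w -> K2 w -> `|gridpt h i j - w| < rho -> C i j = false.
  move=> K1w K2w ijw.
  have -> : C i j = C (cell h w).1 (cell h w).2.
    apply: (@cells_const _ h h0 C w rho) => // [i' j'|i' j'|].
    - rewrite vC; case: (boolP (vedge B1 _ _)) => [/V1 H _|_ /=]; first exact: H.
      by move/V2; exact.
    - rewrite hC; case: (boolP (hedge p q B1 _ _)) => [/H1 H _|_ /=]; first exact: H.
      by move/H2; exact.
    - by have := dist_cell h0 w; lra.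
  by rewrite /C; have /= -> := Cc0 _ K1w K2w; rewrite addbb.
pose meet i j := `[< exists2 w, K2 w & in_cell h i j w >].
pose D i j := C i j && meet i j.
(* A cell that meets both sets is close to a common point, where [C] is false. *)
have D0 i j w1 : K1 w1 -> in_cell h i j w1 -> D i j = false.
  move=> K1w1 w1ij; apply/negbTE/negP => /andP[+ /asboolP[w2 K2w2 w2ij]].
  have w12 := in_cell_dist w1ij w2ij.
  have [w [K1w K2w] w2w] := near12 _ _ K1w1 K2w2 w12.
  rewrite (C0 _ _ w) //.
  have := in_cell_dist (in_cell_gridpt h0 i j) w2ij.
  have := ler_distD w2 (gridpt h i j) w; lra.
pose B i j := B1 i j (+) D i j.
have DC i j w2 : K2 w2 -> in_cell h i j w2 -> D i j = C i j.
  by move=> ? ?; rewrite /D (_ : meet i j) ?andbT//; apply/asboolP; exists w2.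
have vB i j : vedge B i j = vedge B1 i j (+) vedge D i j by exact: vedgeD.
have hB i j : hedge p q B i j = hedge p q B1 i j (+) (D i j (+) D i (j - 1)).
  rewrite /B /hedge; move: (B1 i j) (D i j) (B1 i (j - 1)) (D i (j - 1)).
  by move: (ray p i j) (ray q i j); do 6!case.
have bB : bounded_chain p q B.
  have [N2 NK] := bounded_cells h0 KM.
  have outD i j : ((N2 < `|i|) || (N2 < `|j|))%N -> D i j = false.
    move=> ij; apply/negbTE/negP => /andP[_ /asboolP[w K2w /(NK _ _ _ K2w)]].
    by lia.
  exists (maxn N1 N2.+1) => i j ij; rewrite vB hB /vedge.
  rewrite !outD ?addbF; try lia.
  by apply: NB1; lia.
have edgeV i j : vedge B i j ->
    boxfree (K1 `|` K2) (gridpt h i j) (gridpt h i (j + 1)).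
  move=> Bij w Kw /(in_cell_vedge h0) [w1 w2].
  have ijw := in_cell_dist (in_cell_gridpt h0 i j) w1.
  case: Kw => Kw; move: Bij.
    rewrite vB /vedge !(D0 _ _ _ Kw) // !addbF => /V1 /(_ _ Kw); lra.
  rewrite vB /(vedge D) !(DC _ _ _ Kw) // vC addbA addbb /= => /V2 /(_ _ Kw); lra.
have edgeH i j : hedge p q B i j ->
    boxfree (K1 `|` K2) (gridpt h i j) (gridpt h (i + 1) j).
  move=> Bij w Kw /(in_cell_hedge h0) [w1 w2].
  have ijw := in_cell_dist (in_cell_gridpt h0 i j) w1.
  case: Kw => Kw; move: Bij.
    rewrite hB !(D0 _ _ _ Kw) // !addbF => /H1 /(_ _ Kw); lra.
  rewrite hB !(DC _ _ _ Kw) // hC addbA addbb /= => /H2 /(_ _ Kw); lra.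
pose S i j := `[< joined (K1 `|` K2) (gridpt h p.1 p.2) (gridpt h i j) >].
have SE i j i' j' : boxfree (K1 `|` K2) (gridpt h i j) (gridpt h i' j') ->
    S i j = S i' j'.
  move=> free; apply: asbool_equiv_eq; split=> H; first exact: joined_step H free.
  by apply: joined_step H _; exact: boxfreeC.
have : S q.1 q.2.
  rewrite -(@handshake S p q B bB) => [|i j /edgeV /SE //|i j /edgeH /SE //].
  by apply/asboolP; exact: joined_refl.
by move/asboolP.
Qed.

Lemma near_inter K1 K2 (r : R) : compact K1 -> compact K2 -> 0 < r ->
  exists2 d, 0 < d & forall w1 w2, K1 w1 -> K2 w2 -> `|w1 - w2| < d ->
     exists2 w, K1 w /\ K2 w & `|w2 - w| <= r.
Proof.
move=> c1 c2 r0.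
pose P w2 d := forall w1, K1 w1 -> `|w1 - w2| < d ->
     exists2 w, K1 w /\ K2 w & `|w2 - w| <= r.
have [z d d' d0 dd' Pd w1 K1w1 w1z|z K2z|d d0 Pd] :=
  @compact_uniform _ _ K2 P c2.
- by apply: (Pd w1) => //; exact: lt_le_trans w1z dd'.
- have [K1z|K1z] := pselect (K1 z).
    exists r => // w2 _ zw2 w1 _ _; exists z => //.
    by rewrite distrC ltW.
  have [d d0 zd] := compact_far c1 K1z.
  exists (d / 2) => [|w2 K2w2 zw2 w1 K1w1 w12]; first by rewrite divr_gt0.
  case: zd; exists w1 => //; have := ler_distD w2 z w1.
  by rewrite (distrC w2 w1); lra.
by exists d => // w1 w2 K1w1 K2w2; exact: Pd.
Qed.

Lemma compact_pt_bounded K : compact K -> exists M, forall w, K w -> `|w| <= M.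
Proof.
move/compact_bounded => [M [_ KM]]; exists (M + 1) => w; apply: KM.
by rewrite ltrDl.
Qed.

Lemma joined_cell K (h r : R) x : 0 < h -> h < r -> ~ thick K r x ->
  joined K x (gridpt h (cell h x).1 (cell h x).2).
Proof.
move=> h0 hr Kx; apply: (@joined_ball _ _ x r).
- by move=> w Kw xw; apply: Kx; exists w => //; rewrite distrC.
- by rewrite subrr normr0 (lt_trans h0).
- by have := dist_cell h0 x; lra.
Qed.

(** Alexander's lemma for sets with at most one common point: this point fixes the constant parity
    [c0], and for disjoint sets any value will do. *)
Lemma alexander K1 K2 x y : compact K1 -> compact K2 ->
  (forall w w', K1 w -> K2 w -> K1 w' -> K2 w' -> w = w') ->
  joined K1 x y -> joined K2 x y -> joined (K1 `|` K2) x y.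
Proof.
move=> c1 c2 K12 xy1 xy2.
have [m1 m10 xy1'] := joined_thick c1 xy1.
have [m2 m20 xy2'] := joined_thick c2 xy2.
pose m := Num.min m1 m2.
have m0 : 0 < m by rewrite lt_min m10.
have {}xy1' : joined (thick K1 m) x y.
  by apply: joined_sub xy1'; apply: thick_sub; rewrite ge_min lexx.
have {}xy2' : joined (thick K2 m) x y.
  by apply: joined_sub xy2'; apply: thick_sub; rewrite ge_min lexx orbT.
have [d d0 dP] := @near_inter K1 K2 (m / 4) c1 c2 ltac:(lra).
(* The bound [m / 16] gives [8 * h <= m - h], where [m - h] is the margin left by [joined_farchain];
   the bound [d / 2] brings points of [K1] and [K2] at distance at most [h] under [near_inter]. *)
pose h := Num.min (m / 16) (d / 2).
have hm : h <= m / 16 by rewrite ge_min lexx.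
have hd : h <= d / 2 by rewrite ge_min lexx orbT.
have h0 : 0 < h by rewrite lt_min !divr_gt0.
have [B1 F1] := joined_farchain h0 xy1'.
have [B2 F2] := joined_farchain h0 xy2'.
have [M KM] := compact_pt_bounded c2.
have out z : ~ thick K1 m z -> ~ thick K2 m z -> ~ thick (K1 `|` K2) m z.
  by move=> ? ?; rewrite thickU => -[].
have [x1 y1] := joined_out xy1'; have [x2 y2] := joined_out xy2'.
have xc := @joined_cell _ h m x h0 ltac:(lra) (out _ x1 x2).
have yc := @joined_cell _ h m y h0 ltac:(lra) (out _ y1 y2).
have [_ Kc] := joined_out xc.
apply: joined_trans xc _; apply: joined_trans (joined_sym yc).
have [c0 c0P] : exists c0, forall w, K1 w -> K2 w ->
    let: (i, j) := cell h w in B1 i j (+) B2 i j = c0.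
  have [[w [K1w K2w]]|nw] := pselect (exists w, K1 w /\ K2 w).
    exists (let: (i, j) := cell h w in B1 i j (+) B2 i j) => w' K1w' K2w'.
    by rewrite (K12 w' w).
  by exists false => w K1w K2w; case: nw; exists w.
apply: (@alexander_mesh K1 K2 h (m - h) M _ _ B1 B2 c0) => //; first by lra.
move=> w1 w2 K1w1 K2w2 w12.
by have [|w Kw w2w] := dP w1 w2 K1w1 K2w2; [lra|exists w => //; lra].
Qed.

(* Three closed chains whose sum is zero cannot all have different parities at
   the two points of [K1] and [K2]. *)
Lemma alexander3 K1 K2 (s t : pt) x y z : compact K1 -> compact K2 ->
  (forall w, K1 w -> K2 w -> w = s \/ w = t) ->
  joined K1 x y -> joined K1 y z -> joined K2 x y -> joined K2 y z ->
  [\/ joined (K1 `|` K2) x y, joined (K1 `|` K2) y z | joined (K1 `|` K2) x z].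
Proof.
move=> c1 c2 K12 xy1 yz1 xy2 yz2.
have [m1 m10 xy1'] := joined_thick c1 xy1.
have [m2 m20 xy2'] := joined_thick c2 xy2.
have [m3 m30 yz1'] := joined_thick c1 yz1.
have [m4 m40 yz2'] := joined_thick c2 yz2.
pose m := Num.min (Num.min m1 m2) (Num.min m3 m4).
have m0 : 0 < m by rewrite !lt_min m10 m20 m30.
have {}xy1' : joined (thick K1 m) x y.
  by apply: joined_sub xy1'; apply: thick_sub; rewrite !ge_min lexx.
have {}xy2' : joined (thick K2 m) x y.
  by apply: joined_sub xy2'; apply: thick_sub; rewrite !ge_min lexx orbT.
have {}yz1' : joined (thick K1 m) y z.
  by apply: joined_sub yz1'; apply: thick_sub; rewrite !ge_min lexx !orbT.
have {}yz2' : joined (thick K2 m) y z.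
  by apply: joined_sub yz2'; apply: thick_sub; rewrite !ge_min lexx !orbT.
have [d d0 dP] := @near_inter K1 K2 (m / 4) c1 c2 ltac:(lra).
pose h := Num.min (m / 16) (d / 2).
have hm : h <= m / 16 by rewrite ge_min lexx.
have hd : h <= d / 2 by rewrite ge_min lexx orbT.
have h0 : 0 < h by rewrite lt_min !divr_gt0.
have [B1 F1] := joined_farchain h0 xy1'.
have [B2 F2] := joined_farchain h0 xy2'.
have [B3 F3] := joined_farchain h0 yz1'.
have [B4 F4] := joined_farchain h0 yz2'.
have F13 := farchainD h0 F1 F3; have F24 := farchainD h0 F2 F4.
have [M KM] := compact_pt_bounded c2.
have out u : ~ thick K1 m u -> ~ thick K2 m u -> ~ thick (K1 `|` K2) m u.
  by move=> ? ?; rewrite thickU => -[].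
have [x1 y1] := joined_out xy1'; have [x2 y2] := joined_out xy2'.
have [_ z1] := joined_out yz1'; have [_ z2] := joined_out yz2'.
have xc := @joined_cell _ h m x h0 ltac:(lra) (out _ x1 x2).
have yc := @joined_cell _ h m y h0 ltac:(lra) (out _ y1 y2).
have zc := @joined_cell _ h m z h0 ltac:(lra) (out _ z1 z2).
have [_ Kxc] := joined_out xc; have [_ Kyc] := joined_out yc.
have close w1 w2 : K1 w1 -> K2 w2 -> `|w1 - w2| <= h ->
    exists2 w, K1 w /\ K2 w & `|w2 - w| <= (m - h) / 2.
  move=> K1w1 K2w2 w12.
  by have [|w Kw w2w] := dP w1 w2 K1w1 K2w2; [lra|exists w => //; lra].
have main p q B B' : farchain h K1 (m - h) p q B -> farchain h K2 (m - h) p q B' ->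
    ~ (K1 `|` K2) (gridpt h p.1 p.2) ->
    (let: (i, j) := cell h s in B i j (+) B' i j) =
    (let: (i, j) := cell h t in B i j (+) B' i j) ->
    joined (K1 `|` K2) (gridpt h p.1 p.2) (gridpt h q.1 q.2).
  move=> FB FB' Kp st.
  apply: (@alexander_mesh K1 K2 h (m - h) M _ _ B B'
    (let: (i, j) := cell h s in B i j (+) B' i j)) => //; first by lra.
  by move=> w K1w K2w; case: (K12 w K1w K2w) => ->; rewrite ?st.
have {}main u v B B' : joined (K1 `|` K2) u (gridpt h (cell h u).1 (cell h u).2) ->
    joined (K1 `|` K2) v (gridpt h (cell h v).1 (cell h v).2) ->
    farchain h K1 (m - h) (cell h u) (cell h v) B ->
    farchain h K2 (m - h) (cell h u) (cell h v) B' ->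
    (let: (i, j) := cell h s in B i j (+) B' i j) =
    (let: (i, j) := cell h t in B i j (+) B' i j) ->
    joined (K1 `|` K2) u v.
  move=> uc vc FB FB' st; have [_ Kuc] := joined_out uc.
  by apply: joined_trans uc _; apply: joined_trans (joined_sym vc); exact: main st.
have := main _ _ _ _ xc yc F1 F2; have := main _ _ _ _ yc zc F3 F4.
have := main _ _ _ _ xc zc F13 F24.
case: (cell h s) (cell h t) => [i j] [i' j'] /=.
rewrite (addbACA (B1 i j) (B3 i j)) (addbACA (B1 i' j') (B3 i' j')); case: (B1 i j (+) B2 i j) (B1 i' j' (+) B2 i' j') => [] [];
case: (B3 i j (+) B4 i j) (B3 i' j' (+) B4 i' j') => [] [] //= H1 H2 H3;
by [apply: Or31; exact: H3|apply: Or32; exact: H2|apply: Or33; exact: H1].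
Qed.

End Alexander.

(** * Arcs neither separate the plane nor have interior points *)

Section Arcs.
Variable R : realType.
Local Notation pt := (R * R)%type.
Implicit Types (K : set pt) (x y z w : pt) (c : R -> pt).

Lemma within_continuousP c (A : set R) : {within A, continuous c} <->
  forall t, A t -> forall e, 0 < e ->
  exists2 d, 0 < d & forall s, A s -> `|t - s| < d -> `|c t - c s| < e.
Proof.
rewrite subspace_continuousP; split=> cc t At.
  move=> e e0; have /cvgrPdist_lt /(_ e e0) := cc t At.
  rewrite near_withinE /= => /nbhs_ballP [d /= d0 dP].
  by exists d => // s As ts; apply: (dP s) => //; rewrite -ball_normE.
apply/cvgrPdist_lt => e e0; have [d d0 dP] := cc t At e e0.
rewrite near_withinE; apply/nbhs_ballP; exists d => // s ts As; exact: dP.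
Qed.

Definition subarc c (a b : R) : set pt := c @` `[a, b].

Lemma sub01 (a b : R) : 0 <= a -> b <= 1 -> `[a, b] `<=` `[0, 1]%classic.
Proof.
by move=> a0 b1 t /=; rewrite !in_itv /= => /andP[? ?]; apply/andP; split; lra.
Qed.

Lemma compact_subarc c a b : {within `[0, 1], continuous c} -> 0 <= a -> b <= 1 ->
  compact (subarc c a b).
Proof.
move=> cc a0 b1; apply: continuous_compact; last exact: segment_compact.
exact: continuous_subspaceW (sub01 a0 b1) cc.
Qed.

Lemma subarc_trace c a b : 0 <= a -> b <= 1 -> subarc c a b `<=` trace c.
Proof. by move=> a0 b1; apply: image_subset; exact: sub01. Qed.

Lemma subarc_split c a m b : a <= m -> m <= b ->
  subarc c a b = subarc c a m `|` subarc c m b.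
Proof.
move=> am mb; apply/seteqP; split=> w.
  move=> [t /=]; rewrite in_itv /= => /andP[at_ tb] <-.
  have [tm|mt] := leP t m; [left|right]; exists t => //=; rewrite in_itv /=.
    by rewrite at_.
  by rewrite tb ltW.
case=> -[t /=]; rewrite in_itv /= => /andP[? ?] <-; exists t => //=;
by rewrite in_itv /=; apply/andP; split; lra.
Qed.

Lemma subarc_inter c a m b w : simple_curve c -> 0 <= a -> b <= 1 ->
  a <= m <= b -> subarc c a m w -> subarc c m b w -> w = c m.
Proof.
move=> [_ ci] a0 b1 /andP[am mb] [t /= + <-] [s /= + cst].
rewrite !in_itv /= => /andP[at_ tm] /andP[ms sb].
have st : s = t.
  by apply: ci => //; rewrite in_itv /=; apply/andP; split; lra.
by congr c; apply/eqP; rewrite eq_le tm -st ms.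
Qed.

Lemma joined0 x y : joined set0 x y.
Proof. by apply: joined1 => w []. Qed.

(** Outside the square about [z] every point lies on a vertical or horizontal line that misses the
    square; one move along it and one more lead to the fixed corner [(z.1 + s, z.2 + s)]. *)
Lemma joined_around K z r x y : (forall w, K w -> `|w - z| <= r) ->
  r < `|x - z| -> r < `|y - z| -> joined K x y.
Proof.
move=> Kr.
pose s := `|r| + 1.
have sr : r < s by rewrite /s; have := ler_norm r; lra.
have Kc w : K w -> (z.1 - r <= w.1 <= z.1 + r) /\ (z.2 - r <= w.2 <= z.2 + r).
  by move/Kr; rewrite norm_pt_le !ler_distl => /andP[].
suff corner u : r < `|u - z| -> joined K u (z.1 + s, z.2 + s).
  by move=> /corner xc /corner /joined_sym; exact: joined_trans.
have hor v1 v2 b : (z.2 + r < b) \/ (b < z.2 - r) -> joined K (v1, b) (v2, b).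
  move=> bz; apply: joined1 => w /Kc [_ /andP[? ?]] [_ /=].
  by rewrite /between orbb => /andP[? ?]; case: bz; lra.
have ver v1 v2 b : (z.1 + r < b) \/ (b < z.1 - r) -> joined K (b, v1) (b, v2).
  move=> bz; apply: joined1 => w /Kc [/andP[? ?] _] [/= + _].
  by rewrite /between orbb => /andP[? ?]; case: bz; lra.
case: u => u1 u2 ur.
have [|] : ((z.1 + r < u1) \/ (u1 < z.1 - r)) \/ ((z.2 + r < u2) \/ (u2 < z.2 - r)).
- move: ur; rewrite ltNge norm_pt_le negb_and -!ltNge /= !ltr_normr.
  case/orP=> /orP[?|?].
  + by left; left; lra.
  + by left; right; lra.
  + by right; left; lra.
  + by right; right; lra.
- move=> /(ver u2 (z.2 + s)) H; apply: joined_trans H _; apply: hor; left; lra.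
- move=> /(hor u1 (z.1 + s)) H; apply: joined_trans H _; apply: ver; left; lra.
Qed.

(** A short piece lies in a ball that contains neither [x] nor [y], where [joined_around] applies;
    consecutive pieces share a single point, so [alexander] adds them one after another. *)
Lemma subarc_nonsep c a b x y : simple_curve c -> 0 <= a -> b <= 1 ->
  ~ subarc c a b x -> ~ subarc c a b y -> joined (subarc c a b) x y.
Proof.
move=> sc a0 b1 cx cy; have [cc ci] := sc.
have [ba|ab] := ltP b a.
  rewrite (_ : subarc c a b = set0); first exact: joined0.
  apply/seteqP; split=> // w [t /=]; rewrite in_itv /= => /andP[? ?]; exfalso; lra.
have /within_continuousP cc' := continuous_subspaceW (sub01 a0 b1) cc.
pose P t r := forall s u, t - r < s -> u < t + r -> a <= s -> u <= b ->
  joined (subarc c s u) x y.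
have [r r0 Pr] : exists2 r, 0 < r & forall t, `[a, b]%classic t -> P t r.
  apply: compact_uniform; first exact: segment_compact.
    by move=> t r r' r'0 rr' Pr s u ? ? ? ?; apply: Pr => //; lra.
  move=> t tab.
  have dx : 0 < `|c t - x|.
    by rewrite normr_gt0 subr_eq0; apply: contra_notN cx => /eqP <-; exists t.
  have dy : 0 < `|c t - y|.
    by rewrite normr_gt0 subr_eq0; apply: contra_notN cy => /eqP <-; exists t.
  pose e := Num.min `|c t - x| `|c t - y|.
  have e0 : 0 < e by rewrite lt_min dx.
  have [ex ey] : e <= `|x - c t| /\ e <= `|y - c t|.
    by rewrite !(distrC _ (c t)) !ge_min !lexx orbT.
  have [d d0 dP] := cc' t tab (e / 2) ltac:(lra).
  exists (d / 2) => [|t' t'ab tt' s u s1 u1 as_ ub]; first lra.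
  apply: (@joined_around _ (c t) (e / 2)); try lra.
  move=> w [v /=]; rewrite in_itv /= => /andP[? ?] <-.
  rewrite distrC ltW //; apply: dP.
    by rewrite /= in_itv /=; apply/andP; split; lra.
  by move: tt'; rewrite !ltr_norml => /andP[? ?]; apply/andP; split; lra.
have [N Nr] : exists N : nat, b - a < N.+1%:R * r.
  have := archi_boundP (divr_ge0 (ltac:(lra) : 0 <= b - a) (ltW r0)).
  rewrite ltr_pdivrMr//; move: (Num.bound _) => N NP; exists N.
  by rewrite -natr1 mulrDl mul1r; lra.
have N0 : 0 < N.+1%:R :> R by rewrite ltr0n.
pose p k : R := a + k%:R * ((b - a) / N.+1%:R).
have step0 : 0 <= (b - a) / N.+1%:R by apply: divr_ge0; lra.
have stepr : (b - a) / N.+1%:R < r by rewrite ltr_pdivrMr// mulrC.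
have pS k : p k.+1 = p k + (b - a) / N.+1%:R.
  by rewrite /p -natr1 mulrDl mul1r addrA.
have pN : p N.+1 = b by rewrite /p mulrC divfK ?gt_eqF//; lra.
have pab k : (k <= N.+1)%N -> a <= p k <= b.
  move=> kN; rewrite /p lerDl mulr_ge0 ?ler0n//=.
  rewrite -lerBrDl mulrA ler_pdivrMr// mulrC ler_wpM2l ?ler_nat//; lra.
rewrite -pN; have : (N.+1 <= N.+1)%N by [].
elim: {1 3}N.+1 => [_|k IH kN].
  have -> : p 0%N = a by rewrite /p mul0r addr0.
  by apply: (Pr a); rewrite /= ?in_itv /= ?lexx; lra.
have /andP[? ?] := pab _ kN; have /andP[? ?] := pab _ (ltnW kN).
have pk : p k <= p k.+1 by rewrite pS lerDl.
rewrite (subarc_split _ (m := p k)) //.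
apply: alexander.
- by apply: compact_subarc => //; lra.
- by apply: compact_subarc => //; lra.
- move=> w w' w1 w2 w'1 w'2.
  transitivity (c (p k)).
    by apply: (subarc_inter sc a0 (b := p k.+1)) w1 w2; [lra|apply/andP; split; lra].
  by symmetry; apply: (subarc_inter sc a0 (b := p k.+1)) w'1 w'2; [lra|apply/andP; split; lra].
- exact: IH (ltnW kN).
- apply: (Pr (p k)); rewrite /= ?in_itv /= ?lexx; try lra.
  by rewrite pS ltrD2l.
Qed.

Lemma trace_nonsep c x y : simple_curve c -> ~ trace c x -> ~ trace c y ->
  joined (trace c) x y.
Proof. by move=> sc; apply: subarc_nonsep. Qed.

Definition sphere z r : set pt := [set w | `|w - z| = r].

(** A box with one corner inside the ball and the opposite one outside meets the sphere: the
    coordinate that leaves its interval passes through an end of it ([mid]). *)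
Lemma sphere_sep z r x y : joined (sphere z r) x y -> `|x - z| < r -> `|y - z| < r.
Proof.
move=> xy xr; elim: xy => [//|u v _ ur free].
have mid (a b o : R) : `|a - o| < r -> r <= `|b - o| ->
    exists2 v, between a b v & `|v - o| = r.
  move=> ao bo; have r0 : 0 <= r by apply: ltW; apply: le_lt_trans ao.
  move: ao; rewrite ltr_distl => /andP[a1 a2].
  have [bo'|bo'] := leP 0 (b - o).
    exists (o + r); last by rewrite addrC addKr ger0_norm.
    by rewrite ger0_norm// in bo; rewrite /between; apply/orP; left; apply/andP; split; lra.
  exists (o - r); last by rewrite addrC addKr normrN ger0_norm.
  by rewrite ltr0_norm// in bo; rewrite /between; apply/orP; right; apply/andP; split; lra.
rewrite ltNge; apply/negP => vr.
move: ur; rewrite norm_pt_lt /= => /andP[u1 u2].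
have [v1|v1] := ltP `|v.1 - z.1| r.
  have v2 : r <= `|v.2 - z.2|.
    by move: vr; rewrite leNgt norm_pt_lt /= v1 /= -leNgt.
  have [t tb tr] := mid _ _ _ u2 v2.
  apply: (free (v.1, t)); last by split=> //=; rewrite betweenC; exact: between_l.
  by rewrite /sphere /= norm_ptE /= tr; apply: max_r; exact: ltW.
have [t tb tr] := mid _ _ _ u1 v1.
apply: (free (t, u.2)); last by split=> //=; exact: between_l.
by rewrite /sphere /= norm_ptE /= tr; apply: max_l; exact: ltW.
Qed.

Lemma compact_avoid K : compact K -> exists y, ~ K y.
Proof.
move=> /compact_pt_bounded [M KM]; exists (`|M| + 1, 0) => /KM.
rewrite norm_pt_le /= => /andP[+ _]; rewrite ger0_norm ?addr_ge0//; have := ler_norm M; lra.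
Qed.

(** If a ball about [z] lay in the arc, remove a short piece of the arc around [z]. The two
    remaining pieces are disjoint arcs and do not separate [z] from a point [y] off the arc; yet a
    small sphere about [z] is contained in their union and does separate them. *)
Lemma trace_empty_interior c z r : simple_curve c -> 0 < r ->
  exists2 w, `|w - z| < r & ~ trace c w.
Proof.
move=> sc r0; apply: contrapT => nex.
have zr w : `|w - z| < r -> trace c w.
  by move=> wz; apply: contrapT => cw; apply: nex; exists w.
have [t0 t0I ct0] := zr z ltac:(by rewrite subrr normr0).
have [cc ci] := sc; have /within_continuousP cc' := cc.
have [d d0 dP] := cc' _ t0I (r / 2) ltac:(lra).
move: (t0I); rewrite /= in_itv /= => /andP[t00 t01].
have [y cy] := compact_avoid (compact_subarc cc (lexx 0) (lexx 1)).
have inj s u : c s = c u -> 0 <= s <= 1 -> 0 <= u <= 1 -> s = u.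
  by move=> csu s01 u01; apply: ci; rewrite ?in_itv.
pose K1 := subarc c 0 (t0 - d / 2); pose K2 := subarc c (t0 + d / 2) 1.
have K1t : K1 `<=` trace c by apply: subarc_trace; lra.
have K2t : K2 `<=` trace c by apply: subarc_trace; lra.
have K1z : ~ K1 z.
  move=> [s /=]; rewrite in_itv /= => /andP[? ?]; rewrite -ct0 => /inj; lra.
have K2z : ~ K2 z.
  move=> [s /=]; rewrite in_itv /= => /andP[? ?]; rewrite -ct0 => /inj; lra.
have zy : joined (K1 `|` K2) z y.
  apply: alexander.
  - by apply: compact_subarc => //; lra.
  - by apply: compact_subarc => //; lra.
  - move=> w w' [s /=]; rewrite in_itv /= => /andP[? ?] <- [u /=].
    by rewrite in_itv /= => /andP[? ?] /inj H; exfalso; lra.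
  - by apply: subarc_nonsep => //; try lra; move/K1t.
  - by apply: subarc_nonsep => //; try lra; move/K2t.
suff : joined (sphere z (r / 2)) z y.
  move=> /sphere_sep; rewrite subrr normr0 => yz.
  by apply: cy; apply: zr; have := yz ltac:(lra); lra.
apply: joined_sub zy => w wz.
have [s sI csw] : trace c w by apply: zr; rewrite wz; lra.
move: (sI); rewrite /= in_itv /= => /andP[s0 s1].
have ds : d <= `|t0 - s|.
  rewrite leNgt; apply/negP => /(dP _ sI); rewrite ct0 csw distrC wz; lra.
move: ds; rewrite ler_normr => /orP[?|?]; [left|right]; exists s => //=;
by rewrite in_itv /=; apply/andP; split; lra.
Qed.

End Arcs.

(** * Connectedness by chains and first contact with a set *)

Section Chains.
Variable R : realType.
Local Notation pt := (R * R)%type.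
Implicit Types (K A : set pt) (x y z w : pt) (c : R -> pt).

Inductive dchain A (d : R) x : pt -> Prop :=
| dchain_refl : A x -> dchain A d x x
| dchain_step y z : dchain A d x y -> A z -> `|y - z| < d -> dchain A d x z.

(** For compact [A] this says that [x] and [y] lie in the same component of [A]. *)
Definition chained A x y := forall d, 0 < d -> dchain A d x y.

Lemma dchain_in A d x y : dchain A d x y -> A x /\ A y.
Proof. by elim=> // u v _ []. Qed.

Lemma dchain_trans A d y x z : dchain A d x y -> dchain A d y z -> dchain A d x z.
Proof. by move=> xy; elim=> // u v _ xu; exact: dchain_step. Qed.

Lemma dchain_sym A d x y : dchain A d x y -> dchain A d y x.
Proof.
elim=> [|u v xu ux Av uv]; first exact: dchain_refl.
apply: dchain_trans ux; apply: dchain_step (dchain_refl _ Av) _ _; last by rewrite distrC.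
by have [] := dchain_in xu.
Qed.

Lemma dchain_sub A A' d x y : A `<=` A' -> dchain A d x y -> dchain A' d x y.
Proof.
move=> AA'; elim=> [/AA' ?|u v _ xu /AA' ? ?]; first exact: dchain_refl.
exact: dchain_step xu _ _.
Qed.

Lemma chained_in A x y : chained A x y -> A x /\ A y.
Proof. by move=> xy; exact: dchain_in (xy 1 ltr01). Qed.

Lemma chained_refl A x : A x -> chained A x x.
Proof. by move=> Ax d _; exact: dchain_refl. Qed.

Lemma chained_trans A y x z : chained A x y -> chained A y z -> chained A x z.
Proof. by move=> xy yz d d0; apply: dchain_trans (xy d d0) (yz d d0). Qed.

Lemma chained_sym A x y : chained A x y -> chained A y x.
Proof. by move=> xy d d0; apply: dchain_sym; exact: xy. Qed.

Lemma chained_sub A A' x y : A `<=` A' -> chained A x y -> chained A' x y.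
Proof. by move=> AA' xy d d0; apply: dchain_sub AA' _; exact: xy. Qed.

Lemma joined_dchain K A r x y : 0 < r -> (forall w, A w -> ~ thick K r w) ->
  dchain A r x y -> joined K x y.
Proof.
move=> r0 AK xy; elim: (xy) => [Ax|u v xu ju Av uv].
  by apply: joined_refl => Kx; apply: (AK x) => //; exact: sub_thick.
apply: joined_trans ju _; apply: (@joined_ball _ _ u r); rewrite ?subrr ?normr0 //.
  move=> w Kw wu; have [_ Au] := dchain_in xu; apply: (AK u) => //.
  by exists w => //; rewrite distrC.
by rewrite distrC.
Qed.

Lemma joined_chained K A x y : compact K -> compact A -> (forall w, A w -> ~ K w) ->
  chained A x y -> joined K x y.
Proof.
move=> cK cA AK xy.
have [z r r' r'0 rr' zr zr'|z Az|r r0 Ar] :=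
  @compact_uniform _ _ A (fun z r => ~ thick K r z) cA.
- by apply: zr; exact: thick_sub zr'.
- have [r r0 Kr] := compact_far cK (AK z Az).
  exists (r / 2) => [|z' Az' zz' [w Kw z'w]]; first lra.
  by apply: Kr; exists w => //; have := ler_distD z' z w; lra.
exact: joined_dchain r0 Ar (xy r r0).
Qed.

Lemma subdivision (a b d : R) : a <= b -> 0 < d -> exists N (p : nat -> R),
  [/\ p 0%N = a, p N = b, forall k, p k <= p k.+1 < p k + d
    & forall k, (k <= N)%N -> a <= p k <= b].
Proof.
move=> ab d0.
have [N Nd] : exists N : nat, b - a < N.+1%:R * d.
  have := archi_boundP (divr_ge0 (ltac:(lra) : 0 <= b - a) (ltW d0)).
  rewrite ltr_pdivrMr//; move: (Num.bound _) => N NP; exists N.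
  by rewrite -natr1 mulrDl mul1r; lra.
have N0 : 0 < N.+1%:R :> R by rewrite ltr0n.
pose p k : R := a + k%:R * ((b - a) / N.+1%:R).
have step0 : 0 <= (b - a) / N.+1%:R by apply: divr_ge0; lra.
exists N.+1, p; split.
- by rewrite /p mul0r addr0.
- by rewrite /p mulrC divfK ?gt_eqF//; lra.
- move=> k; have -> : p k.+1 = p k + (b - a) / N.+1%:R.
    by rewrite /p -natr1 mulrDl mul1r addrA.
  by rewrite lerDl step0 ltrD2l ltr_pdivrMr// mulrC.
- move=> k kN; rewrite /p lerDl mulr_ge0 ?ler0n//=.
  rewrite -lerBrDl mulrA ler_pdivrMr// mulrC ler_wpM2l ?ler_nat//; lra.
Qed.

Lemma segment_uniform (P : R -> R -> Prop) (a b : R) :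
  (forall t r r', 0 < r' -> r' <= r -> P t r -> P t r') ->
  (forall t, a <= t <= b -> exists2 r, 0 < r &
    forall s, a <= s <= b -> `|t - s| < r -> P s r) ->
  exists2 r, 0 < r & forall t, a <= t <= b -> P t r.
Proof.
move=> Pmon Ploc.
have [//|t|r r0 Pr] :=
  @compact_uniform R R `[a, b]%classic P (@segment_compact R a b).
  rewrite /= in_itv /= => /Ploc [r r0 Pr]; exists r => //.
by exists r => // t tab; apply: Pr; rewrite /= in_itv.
Qed.

Lemma curve_uniform c e : {within `[0, 1], continuous c} -> 0 < e ->
  exists2 d, 0 < d & forall s t, 0 <= s <= 1 -> 0 <= t <= 1 -> `|s - t| < d ->
  `|c s - c t| < e.
Proof.
move=> /within_continuousP cc e0.
pose P t r := forall s, 0 <= s <= 1 -> `|t - s| < r -> `|c t - c s| < e.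
have [t r r' r'0 rr' Pr s sI ts|t tI|r r0 Pr] := @segment_uniform P 0 1.
- by apply: Pr => //; exact: lt_le_trans ts rr'.
- have [d d0 dP] := cc t ltac:(by rewrite /= in_itv) (e / 2) ltac:(lra).
  exists (d / 2) => [|t' t'I tt' s sI t's]; first lra.
  have := ler_distD (c t) (c t') (c s); rewrite (distrC (c t') (c t)).
  have ? := dP t' ltac:(by rewrite /= in_itv) ltac:(lra).
  have ts : `|t - s| < d by have := ler_distD t' t s; lra.
  have ? := dP s ltac:(by rewrite /= in_itv) ts; lra.
by exists r => // s t sI tI; exact: Pr.
Qed.

Lemma subarc_chained c (a b : R) : {within `[0, 1], continuous c} ->
  0 <= a -> a <= b -> b <= 1 -> chained (subarc c a b) (c a) (c b).
Proof.
move=> cc a0 ab b1 e e0; have [d d0 dP] := curve_uniform cc e0.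
have [N [p [p0 pN pS pab]]] := subdivision ab d0.
have sub k : (k <= N)%N -> subarc c a b (c (p k)).
  by move=> kN; exists (p k) => //=; rewrite in_itv /=; exact: pab.
suff H k : (k <= N)%N -> dchain (subarc c a b) e (c a) (c (p k)).
  by rewrite -[in X in dchain _ _ _ X]pN; exact: H.
elim: k => [_|k IH kN].
  by rewrite p0; apply: dchain_refl; have := sub 0%N (leq0n _); rewrite p0.
apply: dchain_step (IH (ltnW kN)) (sub _ kN) _.
have /andP[? ?] := pab _ kN; have /andP[? ?] := pab _ (ltnW kN).
have /andP[? ?] := pS k.
by apply: dP; rewrite ?ltr_norml; apply/andP; split; lra.
Qed.

(** The point [w] lies in the closure of the component of [x]. *)
Definition touches K x w := forall e, 0 < e -> exists2 y, `|y - w| < e & joined K x y.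

Lemma box_sub x y u v : box x y u -> box x y v -> box u v `<=` box x y.
Proof.
have btw (a b u' v' w : R) : between a b u' -> between a b v' -> between u' v' w ->
    between a b w.
  by rewrite /between => /orP[]/andP[? ?] /orP[]/andP[? ?] /orP[]/andP[? ?];
  apply/orP; first [left; apply/andP; split; lra | right; apply/andP; split; lra].
by move=> [u1 u2] [v1 v2] w [w1 w2]; split; [exact: btw u1 v1 w1|exact: btw u2 v2 w2].
Qed.

(** If no point of [m] off [K] were touched, the component of [x] could be followed along every box
    of the path, in steps shorter than a uniform clearance from [m]. *)
Lemma first_hit K m x y : compact m -> joined K x y -> ~ m x ->
  joined (K `|` m) x y \/ exists w, [/\ m w, ~ K w & touches (K `|` m) x w].
Proof.
move=> cm xy mx; elim: (xy) => [Kx|u v xu [ju|?] uv]; [|rename uv into uv|by right].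
  by left; apply: joined_refl => -[].
have [[w [mw Kw tw]]|none] :=
  pselect (exists w, [/\ m w, ~ K w & touches (K `|` m) x w]); first by right; exists w.
left.
(* A point of [m] on the box is off [K], hence untouched, and has a neighbourhood free of the
   component; a point of [m] off the box has one free of the box. *)
have [w r r' r'0 rr' [H1|H2]|w mw|r r0 mr] := @compact_uniform _ _ m
  (fun w r => (forall z, joined (K `|` m) x z -> `|z - w| < r -> False) \/
     (forall w', `|w' - w| < r -> ~ box u v w')) cm.
- by left=> z xz zw; apply: (H1 z) => //; exact: lt_le_trans zw rr'.
- by right=> z zw; apply: H2; exact: lt_le_trans zw rr'.
- have [bw|bw] := pselect (box u v w).
    have Kw : ~ K w by move=> /uv.
    have /existsNP[e] : ~ touches (K `|` m) x w by move=> tw; apply: none; exists w.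
    move=> /not_implyP[e0 he]; exists (e / 2) => [|w' mw' ww']; first lra.
    left=> z xz zw'; apply: he; exists z => //.
    by have := ler_distD w' z w; rewrite (distrC w' w); lra.
  have [r r0 Hr] : exists2 r, 0 < r & boxfree (thick [set w] r) u v.
    by apply: boxfree_thick (@compact_set1 _ w) _ => _ ->.
  exists (r / 2) => [|w' mw' ww']; first lra.
  right=> w'' w''w'; apply: Hr; exists w => //.
  by have := ler_distD w' w'' w; rewrite (distrC w' w); lra.
have [N [p [p0 pN pS p01]]] := @subdivision 0 1 (r / (`|v - u| + 1)) ler01
  ltac:(by rewrite divr_gt0 // ltr_wpDl).
pose q k : pt := u + p k *: (v - u).
have q0 : q 0%N = u by rewrite /q p0 scale0r addr0.
have qN : q N = v by rewrite /q pN scale1r addrC subrK.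
have qr k : `|q k.+1 - q k| < r.
  have -> : q k.+1 - q k = (p k.+1 - p k) *: (v - u).
    by rewrite /q opprD addrACA subrr add0r -scalerBl.
  rewrite normrZ; have /andP[? ?] := pS k.
  rewrite ger0_norm ?subr_ge0//.
  have vu : 0 <= `|v - u| by [].
  have : p k.+1 - p k < r / (`|v - u| + 1) by lra.
  rewrite ltr_pdivlMr; last lra.
  apply: le_lt_trans; apply: ler_wpM2l; lra.
have qb k : (k <= N)%N -> box u v (q k).
  move=> /p01 /andP[k0 k1].
  have btw (a b t : R) : 0 <= t -> t <= 1 -> between a b (a + t * (b - a)).
    rewrite /between => t0 t1; have [ab|ba] := leP a b; apply/orP; [left|right];
    by apply/andP; split; nra.
  by split; exact: btw.
suff H k : (k <= N)%N -> joined (K `|` m) x (q k) by rewrite -qN; exact: H.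
elim: k => [_|k IH kN]; first by rewrite q0.
have xq := IH (ltnW kN).
apply: (joined_step xq) => w Kmw wb.
have uvw : box u v w by apply: box_sub wb; apply: qb => //; exact: ltnW.
case: Kmw => [/uv //|mw].
case: (mr w mw) => [H|H].
  apply: (H _ xq); rewrite distrC; apply: box_dist wb; last exact: qr.
  by rewrite subrr normr0.
by apply: H uvw; rewrite subrr normr0.
Qed.

End Chains.

(** * An arc with both ends in one component of a set splits the face it crosses *)

Section CycleSeparates.
Variable R : realType.
Local Notation pt := (R * R)%type.
Implicit Types (K A : set pt) (x y z w : pt) (c : R -> pt).

Lemma farchain_sym (h rho : R) K p q B : farchain h K rho p q B -> farchain h K rho q p B.
Proof.
have E i j : hedge q p B i j = hedge p q B i j.
  by rewrite /hedge (addbC (ray q i j)).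
move=> [[N NB] V H]; split=> //; first by exists N => i j /NB; rewrite E.
by move=> i j; rewrite E; exact: H.
Qed.

Lemma farchain_le (h rho rho' : R) K p q B : rho' <= rho ->
  farchain h K rho p q B -> farchain h K rho' p q B.
Proof.
move=> rr' [N V H]; split=> // i j.
  by move=> /V V' w Kw; apply: le_trans rr' _; exact: V'.
by move=> /H H' w Kw; apply: le_trans rr' _; exact: H'.
Qed.

(** Successive points of a chain in [A] with step [h] lie in nearby cells, between which the parity
    of a cycle far from [A] cannot change. *)
Lemma closed_chain_const (h : R) A p B s t : 0 < h -> farchain h A (4 * h) p p B ->
  chained A s t ->
  B (gridx h s.1) (gridx h s.2) = B (gridx h t.1) (gridx h t.2).
Proof.
move=> h0 [_ V H] /(_ h h0); elim=> // u v au -> Av uv.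
have [_ Au] := dchain_in au.
have du := dist_cell h0 u; have dv := dist_cell h0 v.
apply: (@cells_const _ h h0 B u (4 * h)) => [i j /V|i j|/=|/=].
- by move/(_ u Au).
- by have := H i j; rewrite /hedge addbb addbF => H' /H' /(_ u Au).
- by rewrite /= in du; lra.
- have := ler_distD v (gridpt h (gridx h v.1) (gridx h v.2)) u.
  by rewrite (distrC v u); rewrite /= in dv; lra.
Qed.

Section Fix.
Variables (K : set pt) (c : R -> pt).
Hypotheses (cK : compact K) (sc : simple_curve c).
Hypothesis Kc : forall w, K w -> trace c w -> w = c 0 \/ w = c 1.
Hypothesis Kchain : chained K (c 0) (c 1).
Let T := trace c.
Let F z := joined K (c (1 / 2)) z.
Hypothesis nosep : forall x y, F x -> F y -> ~ T x -> ~ T y -> joined (K `|` T) x y.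

Let cT : compact T.
Proof. by case: sc => cc _; exact: (compact_subarc cc (lexx 0) (lexx 1)). Qed.

Let TP t : 0 <= t <= 1 -> T (c t).
Proof. by move=> t01; exists t => //=; rewrite in_itv. Qed.

Let K0 : K (c 0). Proof. by case: (chained_in Kchain). Qed.
Let K1 : K (c 1). Proof. by case: (chained_in Kchain). Qed.

Let cinj s t : c s = c t -> 0 <= s <= 1 -> 0 <= t <= 1 -> s = t.
Proof. by case: sc => _ ci st s01 t01; apply: ci; rewrite ?in_itv. Qed.

Let inner t : 0 < t < 1 -> ~ K (c t).
Proof.
move=> /andP[t0 t1] Kt.
by case: (Kc Kt (TP _)) => [|/cinj|/cinj]; lra.
Qed.

Let innerF t : 0 < t < 1 -> F (c t).
Proof.
move=> /andP[t0 t1]; have [cc _] := sc.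
have half (a b : R) : 0 < a -> a <= b -> b < 1 -> joined K (c a) (c b).
  move=> a0 ab b1; apply: (joined_chained cK (A := subarc c a b)).
  - by apply: compact_subarc => //; lra.
  - move=> w [u /=]; rewrite in_itv /= => /andP[? ?] <-; apply: inner.
    by apply/andP; split; lra.
  - by apply: subarc_chained => //; lra.
by have [th|th] := leP t (1 / 2); [apply: joined_sym|]; apply: half; lra.
Qed.

Let TF z : T z -> z <> c 0 -> z <> c 1 -> F z.
Proof.
move=> [t /=]; rewrite in_itv /= => /andP[t0 t1] <- n0 n1; apply: innerF.
by rewrite !lt_neqAle t0 t1 !andbT; apply/andP; split;
  apply/eqP => E; [case: n0|case: n1]; rewrite E.
Qed.

Let chained_T : chained T (c 0) (c 1).
Proof. by case: sc => cc _; apply: subarc_chained. Qed.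

Variable x0 : pt.
Hypotheses (Fx0 : F x0) (Tx0 : ~ T x0).

(** A point other than the two ends of the arc lies in [F] or off [T] (see [TF]), so at least one
    clause applies. Where both do, a single chain has to meet both demands, and this is where the
    assumption [nosep] is spent. *)
Definition okchain (h : R) z B :=
  (F z -> farchain h K (4 * h) (cell h x0) (cell h z) B) /\
  (~ T z -> farchain h T (4 * h) (cell h x0) (cell h z) B).

Lemma okchain_exists z : z <> c 0 -> z <> c 1 ->
  exists2 mu, 0 < mu & forall h, 0 < h -> h < mu -> exists B, okchain h z B.
Proof.
move=> z0 z1.
have far A : compact A -> joined A x0 z -> exists2 mu, 0 < mu &
    forall h, 0 < h -> h < mu -> exists B, farchain h A (4 * h) (cell h x0) (cell h z) B.
  move=> cA /(joined_thick cA) [m m0 xz]; exists (m / 5) => [|h h0 hm]; first lra.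
  by have [B FB] := joined_farchain h0 xz; exists B; apply: farchain_le FB; lra.
have [Fz|Fz] := pselect (F z); last first.
  have Tz : ~ T z by move=> Tz; apply: Fz; exact: TF.
  have [m m0 mP] := far T cT (trace_nonsep sc Tx0 Tz).
  by exists m => // h h0 /(mP h h0) [B FB]; exists B; split.
have xz : joined K x0 z by apply: joined_trans (joined_sym Fx0) Fz.
have [Tz|Tz] := pselect (T z).
  have [m m0 mP] := far K cK xz.
  by exists m => // h h0 /(mP h h0) [B FB]; exists B; split.
have [m m0 mP] := far _ (compactU cK cT) (nosep Fx0 Fz Tx0 Tz).
exists m => // h h0 /(mP h h0) [B FB]; exists B.
by split=> _; apply: farchain_sub FB => w; [left|right].
Qed.

(* The chain x0 -> z -> z' -> x0 has the same parity at both ends of the arc. *)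
Definition balanced z z' := exists2 mu, 0 < mu & forall h, 0 < h -> h < mu ->
  forall B B', okchain h z B -> okchain h z' B' ->
  let W i j := B i j (+) step_chain h z z' i j (+) B' i j in
  W (gridx h (c 0).1) (gridx h (c 0).2) = W (gridx h (c 1).1) (gridx h (c 1).2).

(** The closed chain can be kept off one of [K] and [T], each of which links the ends of the arc, so
    [closed_chain_const] applies. A box that avoids [K] but lies outside [F] also avoids [T],
    because the inner points of the arc are in [F]. *)
Lemma balanced_free z z' : boxfree K z z' \/ boxfree T z z' -> balanced z z'.
Proof.
have main A : compact A -> chained A (c 0) (c 1) -> boxfree A z z' ->
    (forall h B, okchain h z B -> farchain h A (4 * h) (cell h x0) (cell h z) B) ->
    (forall h B, okchain h z' B -> farchain h A (4 * h) (cell h x0) (cell h z') B) ->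
    balanced z z'.
  move=> cA chA /(boxfree_thick cA) [m m0 mP] zA z'A.
  exists (m / 5) => [|h h0 hm B B' okB okB' W]; first lra.
  apply: (closed_chain_const (p := cell h x0) h0 _ chA).
  apply: (farchainD h0 _ (farchain_sym (z'A _ _ okB'))).
  apply: (farchainD h0 (zA _ _ okB)).
  by apply: farchain_le (farchain_step h0 mP); lra.
have mainT : boxfree T z z' -> balanced z z'.
  move=> free; apply: (main T) => //.
    by move=> h B [_ H]; apply: H => Tz; apply: (free z) => //; exact: box_l.
  by move=> h B [_ H]; apply: H => Tz; apply: (free z') => //; rewrite boxC; exact: box_l.
case=> // free.
have zz' := joined1 free.
have [Fz|Fz] := pselect (F z).
  have Fz' : F z' by apply: joined_trans Fz zz'.
  by apply: (main K) => // h B [H _]; exact: H.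
apply: mainT => w Tw bw.
have Kw : ~ K w by move/free; exact.
have zw : joined K z w.
  apply: joined1 => u /free; apply: contra_not.
  by apply: box_sub => //; exact: box_l.
apply: Fz; apply: joined_trans (joined_sym zw).
by apply: TF => // E; apply: Kw; rewrite E.
Qed.

(** The chains to the intermediate point cancel. Alignment makes the step chains add up exactly,
    without cells enclosed at a corner. *)
Lemma balanced_trans z y z' : y <> c 0 -> y <> c 1 ->
  (z.1 = y.1 /\ y.1 = z'.1) \/ (z.2 = y.2 /\ y.2 = z'.2) ->
  balanced z y -> balanced y z' -> balanced z z'.
Proof.
move=> y0 y1 al [m m0 mP] [m' m'0 mP'].
have [m'' m''0 ok] := okchain_exists y0 y1.
exists (Num.min (Num.min m m') m'') => [|h h0]; first by rewrite !lt_min m0 m'0.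
rewrite !lt_min => /andP[/andP[hm hm'] hm''] B B' okB okB' /=.
have [B'' okB''] := ok h h0 hm''.
have := mP h h0 hm _ _ okB okB''; have := mP' h h0 hm' _ _ okB'' okB' => /=.
have E i j : step_chain h z z' i j = step_chain h z y i j (+) step_chain h y z' i j.
  rewrite /step_chain; case: al => -[<- <-]; last by rewrite !addbb !andbF.
  rewrite -andb_addr; congr (_ && _).
  by case: (_ <= j); case: (_ <= j); case: (_ <= j).
rewrite !E.
set i := gridx h _; set j := gridx h _; set i' := gridx h _; set j' := gridx h _.
move: (B i j) (B' i j) (B'' i j) (B i' j') (B' i' j') (B'' i' j').
move: (step_chain h z y i j) (step_chain h y z' i j).
move: (step_chain h z y i' j') (step_chain h y z' i' j').
by clear; do 10!case.
Qed.

(** [K] and [T] meet only at the ends of the arc, so every point of the side keeps clear of one of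
    them, and short pieces of the side fall under [balanced_free]. *)
Lemma balanced_side z z' : z.1 = z'.1 \/ z.2 = z'.2 ->
  (forall t, 0 <= t <= 1 -> z + t *: (z' - z) <> c 0 /\ z + t *: (z' - z) <> c 1) ->
  balanced z z'.
Proof.
move=> al free.
pose q t : pt := z + t *: (z' - z).
have qD s t : q t - q s = (t - s) *: (z' - z).
  by rewrite /q opprD addrACA subrr add0r -scalerBl.
pose P t r := (forall w, K w -> ~ `|w - q t| < r) \/ (forall w, T w -> ~ `|w - q t| < r).
have [t r r' r'0 rr' Pr|t /free [t0 t1]|r r0 Pr] := @segment_uniform R P 0 1.
- by case: Pr => H; [left|right] => w /H {}H wt; apply: H; exact: lt_le_trans rr'.
- have cont : forall e : R, 0 < e -> exists2 d, 0 < d &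
      forall s, `|t - s| < d -> `|q t - q s| < e.
    move=> e e0; exists (e / (`|z' - z| + 1)) => [|s].
      by rewrite divr_gt0 // ltr_wpDl.
    rewrite ltr_pdivlMr ?ltr_wpDl// qD normrZ.
    by apply: le_lt_trans; rewrite ler_wpM2l // lerDl.
  have main A : compact A -> ~ A (q t) -> exists2 r, 0 < r &
      forall s, `|t - s| < r -> forall w, A w -> ~ `|w - q s| < r.
    move=> cA At; have [r r0 Ar] := compact_far cA At.
    have [d d0 dP] := cont (r / 2) ltac:(lra).
    exists (Num.min d (r / 2)) => [|s]; first by rewrite lt_min d0; lra.
    rewrite lt_min => /andP[/dP ts _] w Aw; rewrite lt_min => /andP[_ ws].
    apply: Ar; exists w => //; have := ler_distD (q s) (q t) w.
    by rewrite (distrC (q s) w); lra.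
  have [Kt|Kt] := pselect (K (q t)).
    have Tt : ~ T (q t) by move=> /(Kc Kt) [].
    by have [r r0 Hr] := main _ cT Tt; exists r => // s _ ts; right; exact: Hr.
  by have [r r0 Hr] := main _ cK Kt; exists r => // s _ ts; left; exact: Hr.
have [N [p [p0 pN pS p01]]] := @subdivision R 0 1 (r / (`|z' - z| + 1)) ler01
  ltac:(by rewrite divr_gt0 // ltr_wpDl).
have qr k : `|q (p k.+1) - q (p k)| < r.
  rewrite qD normrZ; have /andP[? ?] := pS k.
  rewrite ger0_norm ?subr_ge0//.
  have zz : 0 <= `|z' - z| by [].
  have : p k.+1 - p k < r / (`|z' - z| + 1) by lra.
  rewrite ltr_pdivlMr; last lra.
  apply: le_lt_trans; apply: ler_wpM2l; lra.
have q0 : q (p 0%N) = z by rewrite /q p0 scale0r addr0.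
have qN : q (p N) = z' by rewrite /q pN scale1r addrC subrK.
have stepb k : (k < N)%N -> balanced (q (p k)) (q (p k.+1)).
  move=> kN; apply: balanced_free.
  case: (Pr (p k) (p01 _ (ltnW kN))) => H; [left|right] => w Aw bw; apply: (H w) => //;
  by apply: box_dist bw => //; rewrite subrr normr0.
suff H k : (k < N)%N -> balanced z (q (p k.+1)).
  rewrite -qN; case: N {stepb p01 qN} pN H => [pN _|N pN H]; last exact: H.
  by exfalso; move: p0; rewrite pN; lra.
elim: k => [N0|k IH kN]; first by have := stepb _ N0; rewrite q0.
have [y0 y1] := free _ (p01 _ (ltnW kN)).
apply: balanced_trans y0 y1 _ (IH (ltnW kN)) (stepb _ kN).
have q1 u : z.1 = z'.1 -> (q u).1 = z.1.
  by move=> E; rewrite -[LHS]/(z.1 + u * (z'.1 - z.1)) -E subrr mulr0 addr0.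
have q2 u : z.2 = z'.2 -> (q u).2 = z.2.
  by move=> E; rewrite -[LHS]/(z.2 + u * (z'.2 - z.2)) -E subrr mulr0 addr0.
by case: al => E; [left|right]; rewrite ?q1 ?q2.
Qed.

(** Add the balanced cycles over the four sides of a square around [c 0] that leaves [c 1] outside.
    The chains to the corners cancel, and what remains is the square itself, whose parity is odd at
    [c 0] and even at [c 1]. *)
Lemma cycle_separates_false : False.
Proof.
set s := c 0; set t := c 1.
have st : s <> t by move=> /cinj; rewrite !lexx ler01 => /(_ isT isT); lra.
(* Half the distance keeps [t] outside the square even after rounding to cells of size [h < r]. *)
pose r := `|t - s| / 2.
have r0 : 0 < r.
  by rewrite divr_gt0// normr_gt0 subr_eq0; apply/eqP => E; apply: st.
pose A1 : pt := (s.1 + r, s.2 - r); pose A2 : pt := (s.1 + r, s.2 + r).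
pose A3 : pt := (s.1 - r, s.2 + r); pose A4 : pt := (s.1 - r, s.2 - r).
have off z : `|z - s| = r -> z <> s /\ z <> t.
  move=> zr; split=> E; move: zr; rewrite E ?subrr ?normr0 /r;
  have : 0 < `|t - s| / 2 := r0; lra.
have onv (a b : R) : `|a| = r -> `|b| <= r -> forall z, z = s + (a, b) -> `|z - s| = r.
  move=> ar br z ->; rewrite addrC addrA addNr add0r norm_ptE /= ar.
  exact: max_l.
have onh (a b : R) : `|a| <= r -> `|b| = r -> forall z, z = s + (a, b) -> `|z - s| = r.
  move=> ar br z ->; rewrite addrC addrA addNr add0r norm_ptE /= br.
  exact: max_r.
have nr : `|r| = r by rewrite ger0_norm// ltW.
have nNr : `|- r| = r by rewrite normrN.
have mid u : 0 <= u <= 1 -> `|- r + u * (r + r)| <= r /\ `|r - u * (r + r)| <= r.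
  by move=> /andP[u0 u1]; rewrite !ler_norml; split; apply/andP; split; nra.
have affE (z z' : pt) u :
    z + u *: (z' - z) = (z.1 + u * (z'.1 - z.1), z.2 + u * (z'.2 - z.2)) by [].
have sE (a b : R) : s + (a, b) = (s.1 + a, s.2 + b) by [].
have b12 : balanced A1 A2.
  apply: balanced_side => [|u /mid [m1 m2]]; first by left.
  apply: off; apply: (onv r (- r + u * (r + r)) nr m1).
  by rewrite affE sE /=; congr (_, _); ring.
have b23 : balanced A2 A3.
  apply: balanced_side => [|u /mid [m1 m2]]; first by right.
  apply: off; apply: (onh (r - u * (r + r)) r m2 nr).
  by rewrite affE sE /=; congr (_, _); ring.
have b34 : balanced A3 A4.
  apply: balanced_side => [|u /mid [m1 m2]]; first by left.
  apply: off; apply: (onv (- r) (r - u * (r + r)) nNr m2).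
  by rewrite affE sE /=; congr (_, _); ring.
have b41 : balanced A4 A1.
  apply: balanced_side => [|u /mid [m1 m2]]; first by right.
  apply: off; apply: (onh (- r + u * (r + r)) (- r) m1 nNr).
  by rewrite affE sE /=; congr (_, _); ring.
have ok z : `|z - s| = r -> exists2 mu, 0 < mu & forall h, 0 < h -> h < mu ->
    exists B, okchain h z B.
  by move/off => [? ?]; exact: okchain_exists.
have [m1 m10 k1] := ok A1 (onv r (- r) nr ltac:(by rewrite nNr) A1 erefl).
have [m2 m20 k2] := ok A2 (onv r r nr ltac:(by rewrite nr) A2 erefl).
have [m3 m30 k3] := ok A3 (onv (- r) r nNr ltac:(by rewrite nr) A3 erefl).
have [m4 m40 k4] := ok A4 (onv (- r) (- r) nNr ltac:(by rewrite nNr) A4 erefl).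
case: b12 b23 b34 b41 => n1 n10 k12 [n2 n20 k23] [n3 n30 k34] [n4 n40 k41].
have [h h0 [hr hm hn]] : exists2 h, 0 < h & [/\ h < r,
    [/\ h < m1, h < m2, h < m3 & h < m4] & [/\ h < n1, h < n2, h < n3 & h < n4]].
  pose M := Num.min (Num.min (Num.min m1 m2) (Num.min m3 m4))
              (Num.min (Num.min n1 n2) (Num.min n3 n4)).
  have M0 : 0 < Num.min r M by rewrite !lt_min r0 m10 m20 m30 m40 n10 n20 n30.
  exists (Num.min r M / 2); first lra.
  have : Num.min r M / 2 < Num.min r M by lra.
  move: (Num.min r M / 2) => h; rewrite !lt_min.
  by move=> /andP[-> /andP[/andP[/andP[-> ->] /andP[-> ->]] /andP[/andP[-> ->] /andP[-> ->]]]].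
case: hm hn => hm1 hm2 hm3 hm4 [hn1 hn2 hn3 hn4].
have [B1 o1] := k1 h h0 hm1; have [B2 o2] := k2 h h0 hm2.
have [B3 o3] := k3 h h0 hm3; have [B4 o4] := k4 h h0 hm4.
have := k12 h h0 hn1 _ _ o1 o2; have := k23 h h0 hn2 _ _ o2 o3.
have := k34 h h0 hn3 _ _ o3 o4; have := k41 h h0 hn4 _ _ o4 o1.
rewrite -/s -/t /step_chain /=.
have := gridx_itv h0 s.1; have := gridx_itv h0 s.2.
have := gridx_itv h0 t.1; have := gridx_itv h0 t.2.
have tr : `|t - s| = 2 * r by rewrite /r; lra.
set i := gridx h s.1; set j := gridx h s.2.
set i' := gridx h t.1; set j' := gridx h t.2.
move=> /andP[tj tj'] /andP[ti ti'] /andP[sj sj'] /andP[si si'].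
clear hm1 hm2 hm3 hm4 hn1 hn2 hn3 hn4 m10 m20 m30 m40 n10 n20 n30 n40.
rewrite !gridx_le //.
have [-> -> -> ->] : [/\ (s.1 + r < i%:~R * h + h) = false,
    (s.1 - r < i%:~R * h + h) = true, (s.2 + r < j%:~R * h + h) = false
    & (s.2 - r < j%:~R * h + h) = true].
  by split; [apply/negbTE; rewrite -leNgt| |apply/negbTE; rewrite -leNgt|]; lra.
(* In a coordinate where [s] and [t] differ by [2 * r], two opposite sides of the square lie on the
   same side of the cell of [t]. *)
have : ((s.1 + r < i'%:~R * h + h) = (s.1 - r < i'%:~R * h + h)) \/
       ((s.2 + r < j'%:~R * h + h) = (s.2 - r < j'%:~R * h + h)).
  have : (`|t.1 - s.1| = 2 * r) \/ (`|t.2 - s.2| = 2 * r).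
    move: tr; rewrite norm_ptE /=; case: leP => _ ->; [by right|by left].
  have gt (a b o : R) : `|a - o| = 2 * r -> b <= a -> a < b + h ->
      (o + r < b + h) = (o - r < b + h).
    move=> + ba ab; have [ao|ao] := leP 0 (a - o).
      rewrite ger0_norm// => E.
      have -> : (o + r < b + h) = true by lra.
      by have -> : (o - r < b + h) = true by lra.
    rewrite ltr0_norm// => E.
    have -> : (o + r < b + h) = false by apply/negbTE; rewrite -leNgt; lra.
    by have -> : (o - r < b + h) = false by apply/negbTE; rewrite -leNgt; lra.
  by case=> [/gt H|/gt H]; [left|right]; apply: H.
rewrite !addbb !andbF !addbF ?andTb ?addFb ?addTb; move=> HX E1 E2 E3 E4.
have XY : (s.1 - r < i'%:~R * h + h) &&
    ((s.2 + r < j'%:~R * h + h) (+) (s.2 - r < j'%:~R * h + h)) =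
    (s.1 + r < i'%:~R * h + h) &&
    ((s.2 - r < j'%:~R * h + h) (+) (s.2 + r < j'%:~R * h + h)).
  by case: HX => ->; rewrite ?addbb ?andbF // addbC.
move: E1 E2 E3 E4; rewrite XY; move: (_ && _).
move: (B1 i j) (B2 i j) (B3 i j) (B4 i j).
move: (B1 i' j') (B2 i' j') (B3 i' j') (B4 i' j').
move=> b1 b2 b3 b4 b1' b2' b3' b4' b.
move=> /(canRL (addbK _)) -> /(canRL (addbK _))/(canRL (addbK _)) -> /(canRL (addbK _)) ->.
by clear; case: b b1 b2 b3 b4 b1' => [] [] [] [] [] [].
Qed.

End Fix.

(** When [K] is an arc with the same ends, this is the separation half of the Jordan curve theorem.
    The base point [w] of all chains is taken close to the middle of the arc; it can avoid the arc
    because arcs have no interior points. *)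
Lemma cycle_separates K c : compact K -> simple_curve c ->
  (forall w, K w -> trace c w -> w = c 0 \/ w = c 1) -> chained K (c 0) (c 1) ->
  exists x y, [/\ joined K (c (1 / 2)) x, joined K (c (1 / 2)) y, ~ trace c x, ~ trace c y
    & ~ joined (K `|` trace c) x y].
Proof.
move=> cK sc Kc Kchain; apply: contrapT => nex.
have nosep x y : joined K (c (1 / 2)) x -> joined K (c (1 / 2)) y ->
    ~ trace c x -> ~ trace c y -> joined (K `|` trace c) x y.
  by move=> ? ? ? ?; apply: contrapT => ?; apply: nex; exists x, y.
have cK2 : ~ K (c (1 / 2)).
  move=> K2; have I : `[0, 1]%classic (1 / 2 : R) by rewrite /= in_itv /=; lra.
  have [_ ci] := sc.
  have inj t : 0 <= t <= 1 -> c (1 / 2) = c t -> 1 / 2 = t.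
    by move=> t01; apply: ci; rewrite ?in_itv.
  by case: (Kc _ K2 (ex_intro2 _ _ _ I erefl)) => /inj; lra.
have [r r0 Kr] := compact_far cK cK2.
have [w wr Tw] := trace_empty_interior (c (1 / 2)) sc r0.
apply: (@cycle_separates_false K c cK sc Kc Kchain nosep w _ Tw).
apply: (@joined_ball _ _ (c (1 / 2)) r); rewrite ?subrr ?normr0 //.
by move=> u Ku ur; apply: Kr; exists u => //; rewrite distrC.
Qed.

End CycleSeparates.

(** * Arcs inside paths *)

Section PathToArc.
Variable R : realType.
Local Notation pt := (R * R)%type.

Definition ucont (V : normedModType R) (f : R -> V) := forall e, 0 < e ->
  exists2 d, 0 < d & forall s t, 0 <= s <= 1 -> 0 <= t <= 1 -> `|s - t| < d ->
  `|f s - f t| < e.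

Definition openR (U : set R) := forall z, U z ->
  exists2 e : R, 0 < e & forall y, `|y - z| < e -> U y.

Lemma last_outside (U : set R) (s x : R) : openR U -> s <= x -> ~ U s ->
  exists a, [/\ s <= a <= x, ~ U a & forall z, a < z -> z <= x -> U z].
Proof.
move=> oU sx Us; pose S := [set z | s <= z <= x /\ ~ U z].
have Ss : S s by split=> //; rewrite lexx.
have Sub z : S z -> z <= x by case=> /andP[].
have hS : has_sup S by split; [exists s|exists x].
have aub z : S z -> z <= sup S by move=> Sz; apply: sup_upper_bound.
have Sa : ~ U (sup S).
  move=> /oU [e e0 He]; have [z Sz za] := sup_adherent e0 hS.
  by case: (Sz) => _; apply; apply: He; have := aub z Sz; rewrite ltr_norml; lra.
exists (sup S); split=> //.
  by rewrite aub //=; apply: ge_sup => //; exists s.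
move=> z az zx; apply: contrapT => Uz.
suff /aub : S z by lra.
split=> //; rewrite zx andbT; have := aub s Ss; lra.
Qed.

Lemma first_outside (U : set R) (x t : R) : openR U -> x <= t -> ~ U t ->
  exists b, [/\ x <= b <= t, ~ U b & forall z, x <= z -> z < b -> U z].
Proof.
move=> oU xt Ut.
have [|||b [/andP[b1 b2] Ub bU]] := @last_outside [set z | U (- z)] (- t) (- x).
- move=> z /oU [e e0 He]; exists e => // y yz; apply: He.
  by rewrite -normrN opprB opprK addrC.
- by rewrite lerN2.
- by rewrite /= opprK.
exists (- b); split=> //; first by apply/andP; split; lra.
by move=> z z1 z2; rewrite -(opprK z); apply: bU; lra.
Qed.

Section Light.
Variable f : R -> pt.
Hypothesis fc : ucont f.

(* [U] is a union of parameter intervals whose loops are to be cut out of [f]. *)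
Definition loops (U : set R) := [/\ openR U, forall z, U z -> 0 < z < 1
  & forall s t, 0 <= s -> s < t -> t <= 1 -> ~ U s -> ~ U t ->
      (forall z, s < z -> z < t -> U z) -> f s = f t].

(** The middle part of a gap []s, t[] of the union is compact, so a single member [X] covers it, the
    members being nested. The gap of [X] around it has ends close to [s] and [t] at which [f] takes
    the same value, so [f s] and [f t] are arbitrarily close. *)
Lemma loops_chain (F : set (set R)) : F `<=` loops -> total_on F subset ->
  loops (\bigcup_(X in F) X).
Proof.
move=> FL Ftot; split.
- move=> z [X FX Xz]; have [oX _ _] := FL X FX.
  by have [e e0 He] := oX z Xz; exists e => // y /He; exists X.
- by move=> z [X FX Xz]; have [_ X01 _] := FL X FX; exact: X01.
move=> s t s0 st t1 Us Ut gap.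
apply/eqP; rewrite -subr_eq0 -normr_le0; apply/ler_addgt0Pl => e e0; rewrite addr0.
have e2 : 0 < e / 2 by lra.
have [d d0 dP] := fc e2.
pose d' := Num.min (d / 2) ((t - s) / 3).
have d'0 : 0 < d' by rewrite lt_min; apply/andP; split; lra.
have [d'd d'st] : d' <= d / 2 /\ d' <= (t - s) / 3.
  by split; rewrite ge_min lexx // orbT.
have [z r r' r'0 rr' [X FX HX]|z /andP[z1 z2]|r r0 HP] :=
  @segment_uniform R (fun z r => exists2 X, F X & forall y, `|y - z| < r -> X y)
     (s + d') (t - d').
- by exists X => // y yz; apply: HX; exact: lt_le_trans yz rr'.
- have [X FX Xz] : (\bigcup_(X in F) X) z by apply: gap; lra.
  have [oX _ _] := FL X FX; have [e' e'0 He] := oX z Xz.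
  exists (e' / 2) => [|y _ yz]; first lra.
  exists X => // w wy; apply: He; have := ler_distD y w z.
  by rewrite (distrC y z); lra.
have [N [p [p0 pN pS p01]]] := @subdivision R (s + d') (t - d') r ltac:(lra) r0.
have [X FX HX] : exists2 X, F X & forall z, s + d' <= z <= t - d' -> X z.
  suff H k : (k <= N)%N -> exists2 X, F X & forall z, s + d' <= z <= p k -> X z.
    by rewrite -pN; exact: H.
  elim: k => [_|k IH kN].
    have [X FX HX] := HP (s + d') ltac:(apply/andP; split; lra).
    exists X => // z; rewrite p0 => /andP[? ?]; apply: HX.
    have -> : z = s + d' by lra.
    by rewrite subrr normr0.
  have [X FX HX] := IH (ltnW kN).
  have [Y FY HY] := HP (p k) (p01 _ (ltnW kN)).
  have both z : s + d' <= z <= p k.+1 -> X z \/ Y z.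
    move=> /andP[? ?]; have [zk|kz] := leP z (p k).
      by left; apply: HX; apply/andP; split.
    right; apply: HY; have /andP[? ?] := pS k; rewrite ltr_norml.
    by apply/andP; split; lra.
  case: (Ftot X Y FX FY) => XY; [exists Y|exists X] => // z /both [] // ?;
  exact: XY.
have [oX X01 Xgap] := FL X FX.
have out z : ~ (\bigcup_(X in F) X) z -> ~ X z by apply: contra_not; exists X.
have [a [/andP[a1 a2] Xa Ha]] := @last_outside X s (s + d') oX ltac:(lra) (out _ Us).
have [b [/andP[b1 b2] Xb Hb]] := @first_outside X (t - d') t oX ltac:(lra) (out _ Ut).
have fab : f a = f b.
  apply: Xgap => //; try lra.
  move=> z az zb; have [?|?] := leP z (s + d'); first exact: Ha.
  have [?|?] := leP (t - d') z; first exact: Hb.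
  by apply: HX; apply/andP; split; lra.
have sa : `|s - a| < d by rewrite ltr_norml; apply/andP; split; lra.
have bt : `|b - t| < d by rewrite ltr_norml; apply/andP; split; lra.
have := dP s a ltac:(apply/andP; split; lra) ltac:(apply/andP; split; lra) sa.
have := dP b t ltac:(apply/andP; split; lra) ltac:(apply/andP; split; lra) bt.
by have := ler_distD (f a) (f s) (f t); rewrite {2}fab; lra.
Qed.

(** With [U] maximal among the unions of loops, [h] is frozen on each interval of [U] at the value
    of its left end. By maximality, a path that returns to a value has not moved in between. *)
Lemma light_reparametrization : exists h : R -> pt,
  [/\ ucont h, h 0 = f 0, h 1 = f 1, forall x, 0 <= x <= 1 -> trace f (h x)
    & forall x z y, 0 <= x -> x <= z -> z <= y -> y <= 1 -> h x = h y -> h z = h x].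
Proof.
have [U [[oU U01 Ugap] Umax]] := Zorn_bigcup loops_chain.
have U0 : ~ U 0 by move=> /U01; rewrite ltxx.
have U1 : ~ U 1 by move=> /U01; rewrite ltxx andbF.
(* Otherwise the interval []a, b[] could be added to [U]. *)
have cut a b : 0 <= a -> a < b -> b <= 1 -> ~ U a -> ~ U b -> f a = f b ->
    forall z, a < z -> z < b -> U z.
  move=> a0 ab b1 Ua Ub fab z az zb; apply: contrapT => Uz.
  pose V := U `|` [set z | a < z < b].
  apply: (Umax V); first by split=> [x Ux|VU]; [left|apply: Uz; apply: VU; right; rewrite /= az].
  split.
  - move=> x [/oU [e e0 He]|/andP[x1 x2]]; first by exists e => // y /He; left.
    exists (Num.min (x - a) (b - x)); first by rewrite lt_min !subr_gt0 x1.
    move=> y; rewrite lt_min !ltr_norml => /andP[/andP[? ?] /andP[? ?]]; right.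
    by rewrite /=; apply/andP; split; lra.
  - by move=> x [/U01 //|/andP[? ?]]; apply/andP; split; lra.
  move=> s t s0 st t1 Vs Vt gap.
  have Us : ~ U s by move=> ?; apply: Vs; left.
  have Ut : ~ U t by move=> ?; apply: Vt; left.
  have [ta|at_] := leP t a.
    by apply: Ugap => // x ? ?; case: (gap x) => // /andP[? ?]; exfalso; lra.
  have [bs|sb] := leP b s.
    by apply: Ugap => // x ? ?; case: (gap x) => // /andP[? ?]; exfalso; lra.
  have sa : s <= a.
    by rewrite leNgt; apply/negP => as_; apply: Vs; right; rewrite /= as_.
  have bt : b <= t.
    by rewrite leNgt; apply/negP => tb; apply: Vt; right; rewrite /= at_.
  have -> : s = a.
    apply/eqP; rewrite eq_le sa leNgt; apply/negP => sa'.
    by case: (gap a sa' at_) => // /andP[]; rewrite ltxx.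
  have -> // : t = b.
  apply/eqP; rewrite eq_le bt andbT leNgt; apply/negP => tb'.
  by case: (gap b sb tb') => // /andP[]; rewrite ltxx.
have [pi_ piP] : exists p : R -> R, forall x, 0 <= x ->
    [/\ 0 <= p x <= x, ~ U (p x) & forall z, p x < z -> z <= x -> U z].
  suff /choice[p pP] : forall x, exists a, 0 <= x ->
    [/\ 0 <= a <= x, ~ U a & forall z, a < z -> z <= x -> U z] by exists p.
  move=> x.
  have [x0|x0] := leP 0 x; last by exists 0; lra.
  by have [a ?] := last_outside oU x0 U0; exists a.
pose h x := f (pi_ x).
have hA x : 0 <= x -> ~ U x -> h x = f x.
  move=> x0 Ux; rewrite /h; have [/andP[p0 px] _ pU] := piP x x0.
  have [xp|] := leP x (pi_ x); first by congr f; lra.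
  by move=> /pU /(_ (lexx x)) /Ux.
have hgap x y : 0 <= x -> x <= y -> pi_ y < x -> pi_ x = pi_ y.
  move=> x0 xy yx; have [/andP[p0 px] pUx pU] := piP x x0.
  have [/andP[q0 qy] qUy qU] := piP y ltac:(lra).
  have [pq|qp] := ltP (pi_ x) (pi_ y); first by case: qUy; apply: pU => //; lra.
  have [?|pq] := ltP (pi_ y) (pi_ x); last lra.
  by case: pUx; apply: qU => //; lra.
(* Unless they are equal, [h x] and [h y] are values of [f] at parameters between [x] and [y], so
   [h] inherits the modulus of continuity of [f]. *)
have hval x y : 0 <= x -> x <= y -> y <= 1 -> h x = h y \/
    exists u v, [/\ x <= u <= y, x <= v <= y, h x = f u & h y = f v].
  move=> x0 xy y1; have [yx|xy'] := ltP (pi_ y) x; first by left; rewrite /h (hgap x y).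
  have [/andP[q0 qy] qUy qU] := piP y ltac:(lra).
  right; have [u [/andP[u1 u2] Uu Hu]] := first_outside oU xy' qUy.
  exists u, (pi_ y); split=> //; try by apply/andP; split; lra.
  have [/andP[p0 px] pUx pU] := piP x x0.
  have [pu|?] := ltP (pi_ x) u; last by congr f; lra.
  apply: Ugap => //; first lra.
  by move=> z z1 z2; have [?|?] := leP z x; [exact: pU|apply: Hu => //; lra].
exists h; split.
- move=> e /fc [d d0 dP]; exists d => // s t.
  have main x y : 0 <= x -> x <= y -> y <= 1 -> `|x - y| < d -> `|h x - h y| < e.
    move=> x0 xy y1; rewrite ltr_norml => /andP[? ?].
    case: (hval x y) => // [->|[u [v [/andP[? ?] /andP[? ?] -> ->]]]].
      by rewrite subrr normr0; have := dP 0 0; rewrite lexx ler01 !subrr !normr0; apply.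
    by apply: dP; rewrite ?ltr_norml; apply/andP; split; lra.
  move=> /andP[s0 s1] /andP[t0 t1] st; have [|ts] := leP s t; first by move=> ?; exact: main.
  by rewrite distrC; apply: main => //; [lra|rewrite distrC].
- by rewrite hA.
- by rewrite hA.
- move=> x /andP[x0 x1]; have [/andP[? ?] _ _] := piP x x0.
  by exists (pi_ x) => //=; rewrite in_itv /=; apply/andP; split; lra.
move=> x z y x0 xz zy y1 hxy.
have [/andP[p0 px] pUx pU] := piP x x0.
have [/andP[q0 qz] qUz qU] := piP z ltac:(lra).
have [/andP[r0 ry] rUy rU] := piP y ltac:(lra).
have mono a b : 0 <= a -> a <= b -> pi_ a <= pi_ b.
  move=> a0 ab; have [/andP[? ?] ? _] := piP a a0.
  have [/andP[? ?] ? bU] := piP b ltac:(lra).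
  by rewrite leNgt; apply/negP => ?; have : U (pi_ a) by apply: bU => //; lra.
have ? := mono x z x0 xz; have ? := mono z y ltac:(lra) zy.
have [qx|qx] := leP (pi_ z) (pi_ x); first by rewrite /h; congr f; lra.
have [qy|qy] := leP (pi_ y) (pi_ z); first by rewrite hxy /h; congr f; lra.
by exfalso; apply: qUz; apply: (cut (pi_ x) (pi_ y)) => //; lra.
Qed.

End Light.
End PathToArc.

Lemma within_continuousRP (R : realType) (f : R -> R) (A : set R) :
  (forall t, A t -> forall e, 0 < e ->
     exists2 d, 0 < d & forall s, A s -> `|t - s| < d -> `|f t - f s| < e) ->
  {within A, continuous f}.
Proof.
move=> cc; rewrite subspace_continuousP => t At.
apply/cvgrPdist_lt => e e0; have [d d0 dP] := cc t At e e0.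
by rewrite near_withinE; apply/nbhs_ballP; exists d => // s ts As; exact: dP.
Qed.

(** * A path that is constant between equal values runs along an arc *)

Section MonotoneReparam.
Variable R : realType.
Local Notation pt := (R * R)%type.
Variable h : R -> pt.
Hypothesis hc : ucont h.
Hypothesis hM : forall x z y, 0 <= x -> x <= z -> z <= y -> y <= 1 ->
  h x = h y -> h z = h x.
Hypothesis h01 : h 0 <> h 1.

(** Distances are cut off at 1 so that the weighted series of distances converges. *)
Let dvals (r x : R) : set R := [set Num.min 1 `|h s - h r| | s in `[0, x]].

Let dist r x := inf (dvals r x).

Let dvals_inf r x : 0 <= x -> has_inf (dvals r x).
Proof.
move=> x0; split; first by exists (Num.min 1 `|h 0 - h r|), 0; rewrite //= in_itv /= lexx.
by exists 0 => _ [s _ <-]; rewrite le_min ler01 normr_ge0.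
Qed.

Let dist_le r x s : 0 <= s -> s <= x -> dist r x <= Num.min 1 `|h s - h r|.
Proof.
move=> s0 sx; have [_ lb] := @dvals_inf r x ltac:(lra).
by apply: ge_inf => //; exists s; rewrite //= in_itv /= s0.
Qed.

Let dist_ge r x a : 0 <= x ->
  (forall s, 0 <= s -> s <= x -> a <= Num.min 1 `|h s - h r|) -> a <= dist r x.
Proof.
move=> x0 ax; have [ne _] := dvals_inf r x0; apply: lb_le_inf => //.
by move=> y [s /= + <-]; rewrite in_itv /= => /andP[s0 sx]; exact: ax.
Qed.

Let dist01 r x : 0 <= x -> 0 <= dist r x <= 1.
Proof.
move=> x0; apply/andP; split; first by apply: dist_ge => // *; rewrite le_min ler01 normr_ge0.
by apply: le_trans (dist_le r (lexx 0) x0) _; rewrite ge_min lexx.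
Qed.

Let dist_mono r x y : 0 <= x -> x <= y -> dist r y <= dist r x.
Proof.
by move=> x0 xy; apply: dist_ge => // s s0 sx; apply: dist_le => //; lra.
Qed.

Let dist_cont e : 0 < e -> exists2 d, 0 < d & forall r x y, 0 <= x <= 1 -> 0 <= y <= 1 ->
  `|x - y| < d -> `|dist r x - dist r y| <= e.
Proof.
move=> e0; have [d d0 dP] := hc e0; exists d => // r x y.
have main u v : 0 <= u -> u <= v -> v <= 1 -> `|u - v| < d ->
    `|dist r u - dist r v| <= e.
  move=> u0 uv v1; rewrite ltr_norml => /andP[? ?].
  have vu := dist_mono r u0 uv; rewrite ger0_norm ?subr_ge0//.
  suff : dist r u - e <= dist r v by lra.
  apply: dist_ge; first lra.
  move=> s s0 sv; have [su|us] := leP s u; first by have := dist_le r s0 su; lra.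
  have := dist_le r u0 (lexx u); rewrite le_min => /andP[? ?].
  have : `|h u - h s| < e.
    apply: dP; first by apply/andP; split; lra.
      by apply/andP; split; lra.
    by rewrite ltr_norml; apply/andP; split; lra.
  have := ler_distD (h s) (h u) (h r).
  by move=> ? ?; rewrite le_min; apply/andP; split; lra.
move=> /andP[x0 x1] /andP[y0 y1] xyd; have [|yx] := leP x y; first by move=> ?; exact: main.
by rewrite distrC; apply: main => //; [lra|rewrite distrC].
Qed.

(** Enumerates the rationals, with 0 at the indices that code none; the values of [h] at rationals
    of the unit interval are dense in the path. *)
Let q k : R := if @unpickle rat k is Some r then ratr r else 0.

Let partial n x := \sum_(k < n) (1 / 2) ^+ k * dist (q k) x.

Let partialS n x : partial n.+1 x = partial n x + (1 / 2) ^+ n * dist (q n) x.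
Proof. by rewrite /partial big_ord_recr. Qed.

Let half0 n : 0 < (1 / 2 : R) ^+ n. Proof. by apply: exprn_gt0; lra. Qed.

Let partial_tail n m x : 0 <= x -> (n <= m)%N ->
  partial n x <= partial m x <= partial n x + 2 * (1 / 2) ^+ n - 2 * (1 / 2) ^+ m.
Proof.
move=> x0 /subnK <-; elim: (m - n)%N => [|k IH]; first by rewrite add0n; lra.
rewrite addSn partialS exprS; have /andP[H H0] := dist01 (q (k + n)) x0.
have := half0 (k + n); set a := _ ^+ (k + n) in IH * => a0.
case/andP: IH => ? ?; set b := dist _ _ in H H0 *.
by apply/andP; split; nra.
Qed.

(* A weighted sum of the distances from a dense set of points of the path to
   its initial segments: it decreases, strictly so when the path moves. *)
Let weight x := sup [set partial n x | n in [set: nat]].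

Let weightP n x : 0 <= x -> partial n x <= weight x <= partial n x + 2 * (1 / 2) ^+ n.
Proof.
move=> x0.
have ub m : partial m x <= partial n x + 2 * (1 / 2) ^+ n.
  have [nm|mn] := leqP n m.
    by have := partial_tail x0 nm; have := half0 m; lra.
  by have := partial_tail x0 (ltnW mn); have := half0 n; lra.
apply/andP; split.
  by apply: ub_le_sup; [exists (partial n x + 2 * (1 / 2) ^+ n) => _ [m _ <-]|exists n].
by apply: ge_sup => [|_ [m _ <-] //]; exists (partial n x), n.
Qed.

Let small_half e : 0 < e -> exists n, (1 / 2 : R) ^+ n < e.
Proof.
move=> e0; have : 0 <= e^-1 by rewrite invr_ge0 ltW.
move/archi_boundP; move: (Num.bound _) => n nP; exists n.
have n0 : 0 < n%:R :> R by apply: le_lt_trans nP; rewrite invr_ge0 ltW.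
rewrite div1r exprVn -(invrK e) ltf_pV2 ?posrE ?invr_gt0 ?exprn_gt0 //.
by apply: lt_trans nP _; rewrite -natrX ltr_nat ltn_expl.
Qed.

Let weight_cont : ucont (weight : R -> R).
Proof.
move=> e e0; have [n ne] := small_half (e := e / 8) ltac:(lra).
have [d d0 dP] := dist_cont (e := e / 8) ltac:(lra).
exists d => // x y /[dup] x01 /andP[x0 x1] /[dup] y01 /andP[y0 y1] xy.
have pxy : `|partial n x - partial n y| <= e / 4.
  rewrite /partial -sumrB.
  apply: le_trans (ler_norm_sum _ _ _) _.
  apply: (@le_trans _ _ (\sum_(k < n) (1 / 2) ^+ k * (e / 8))).
    apply: ler_sum => k _; rewrite -mulrBr normrM ger0_norm ?(ltW (half0 _))//.
    by rewrite ler_wpM2l ?(ltW (half0 _))//; exact: dP.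
  rewrite -mulr_suml.
  suff E m : \sum_(k < m) (1 / 2 : R) ^+ k = 2 - 2 * (1 / 2) ^+ m.
    by rewrite E; have := half0 n; nra.
  elim: m => [|m IH]; first by rewrite big_ord0 expr0; lra.
  by rewrite big_ord_recr /= IH exprS; lra.
have := weightP n x0; have := weightP n y0.
move: pxy; rewrite ler_norml ltr_norml => /andP[? ?] /andP[? ?] /andP[? ?].
by apply/andP; split; lra.
Qed.

Let weight_mono x y : 0 <= x -> x <= y -> weight y <= weight x.
Proof.
move=> x0 xy; apply/ler_addgt0Pl => e e0.
have [n ne] := small_half (e := e / 2) ltac:(lra).
have := weightP n x0; have := @weightP n y ltac:(lra).
have : partial n y <= partial n x.
  apply: ler_sum => k _; rewrite ler_wpM2l ?(ltW (half0 _))//; exact: dist_mono.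
lra.
Qed.

Let weight_const x y : 0 <= x -> x <= y -> y <= 1 -> h x = h y -> weight x = weight y.
Proof.
move=> x0 xy y1 hxy; apply/eqP; rewrite eq_le (weight_mono x0 xy) andbT.
apply/ler_addgt0Pl => e e0.
have [n ne] := small_half (e := e / 2) ltac:(lra).
have := weightP n x0; have := @weightP n y ltac:(lra).
suff -> : partial n x = partial n y by lra.
apply: eq_bigr => k _; congr (_ * _); apply/eqP; rewrite eq_le (dist_mono _ x0 xy) andbT.
apply: dist_ge; first lra.
move=> s s0 sy; have [sx|xs] := leP s x; first exact: dist_le.
by rewrite (@hM x s y) //; [exact: dist_le|lra].
Qed.

(** The value [h y] is not attained up to [x], or else [h] would be constant from there to [y]. A
    rational [r] just before [y] then gives a point of the path close to [h y] and far from the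
    initial segment ending at [x], and the term of [r] alone makes the weight drop. *)
Let weight_strict x y : 0 <= x -> x <= y -> y <= 1 -> h x <> h y -> weight y < weight x.
Proof.
move=> x0 xy y1 hxy.
have off s : 0 <= s -> s <= x -> h s <> h y.
  by move=> s0 sx hsy; apply: hxy; rewrite (@hM s x y) // hsy.
have [t r r' r'0 rr' ?|t /andP[t0 tx]|m m0 mP] :=
  @segment_uniform R (fun t r => r <= `|h t - h y|) 0 x; first lra.
  have a0 : 0 < `|h t - h y|.
    by rewrite normr_gt0 subr_eq0; apply/eqP; exact: off.
  have [d d0 dP] := hc (e := `|h t - h y| / 2) ltac:(lra).
  exists (Num.min d (`|h t - h y| / 2)) => [|s /andP[s0 sx]].
    by rewrite lt_min d0; lra.
  rewrite lt_min => /andP[/dP ts _]; rewrite ge_min; apply/orP; right.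
  have {ts} := ts ltac:(apply/andP; split; lra) ltac:(apply/andP; split; lra).
  have := ler_distD (h s) (h t) (h y); lra.
have {}mP s : 0 <= s -> s <= x -> m <= `|h s - h y|.
  by move=> s0 sx; apply: mP; apply/andP.
pose m' := Num.min m 1.
have m'0 : 0 < m' by rewrite lt_min m0 ltr01.
have [m'm m'1] : m' <= m /\ m' <= 1 by split; rewrite ge_min lexx // orbT.
have [d d0 dP] := hc (e := m' / 4) ltac:(lra).
have xyl : x < y by rewrite lt_neqAle xy andbT; apply/eqP => E; apply: hxy; rewrite E.
pose a := Num.max x (y - d).
have ay : a < y by rewrite gt_max xyl; lra.
have [xa ya] : x <= a /\ y - d <= a by split; rewrite le_max lexx // orbT.
have [r /andP[ar ry]] : exists r, a < ratr r < y.
  by have [r] := rat_in_itvoo ay; rewrite in_itv /=; exists r.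
have qr : q (pickle r) = ratr r by rewrite /q pickleK.
have hr : `|h y - h (ratr r)| < m' / 4.
  by apply: dP; rewrite ?ltr_norml; apply/andP; split; lra.
pose k := pickle r; pose c := (1 / 2) ^+ k * (m' / 2) : R.
have c0 : 0 < c by rewrite mulr_gt0 //; lra.
(* The distance from [h (ratr r)] drops from at least [3 * m' / 4] to at most [m' / 4]; the cut-off
   at 1 does no harm since [m' <= 1]. *)
have gapk : dist (q k) y + m' / 2 <= dist (q k) x.
  rewrite /k qr; apply: (@le_trans _ _ (m' / 4 + m' / 2)).
    have y0 : 0 <= y by lra.
    rewrite lerD2r; apply: le_trans (dist_le _ y0 (lexx y)) _.
    by rewrite ge_min; apply/orP; right; exact: ltW.
  apply: dist_ge => // s s0 sx; rewrite le_min; apply/andP; split; first lra.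
  have := mP s s0 sx; have := ler_distD (h (ratr r)) (h s) (h y).
  by rewrite (distrC (h (ratr r)) (h y)); lra.
have [n ne] := small_half (e := c / 4) ltac:(lra).
have ne' : (1 / 2) ^+ (n + k.+1) < c / 4.
  apply: le_lt_trans ne; rewrite exprD ler_piMr ?(ltW (half0 _))//.
  by rewrite exprn_ile1//; lra.
have part : partial (n + k.+1) y + c <= partial (n + k.+1) x.
  have kn : (k < n + k.+1)%N by rewrite -[X in (X <= _)%N]add0n leq_add2r.
  rewrite /partial (bigD1 (Ordinal kn)) //= [X in _ <= X](bigD1 (Ordinal kn)) //=.
  have : (1 / 2) ^+ k * dist (q k) y + c <= (1 / 2) ^+ k * dist (q k) x.
    by rewrite /c -mulrDr ler_wpM2l ?(ltW (half0 _)).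
  have : \sum_(i < n + k.+1 | i != Ordinal kn) (1 / 2) ^+ i * dist (q i) y <=
         \sum_(i < n + k.+1 | i != Ordinal kn) (1 / 2) ^+ i * dist (q i) x.
    by apply: ler_sum => i _; rewrite ler_wpM2l ?(ltW (half0 _))//; exact: dist_mono.
  by move: (\sum_(i < _ | _) _) (\sum_(i < _ | _) _) => A B; lra.
have := weightP (n + k.+1) x0; have := @weightP (n + k.+1) y ltac:(lra); lra.
Qed.

(** [N] and [h] identify the same parameters, so [h] factors through [N] by an injective [g]. By
    compactness, a small difference of [N] forces a small difference of [h] ([inv_cont]), which
    makes [g] continuous. *)
Lemma simple_reparametrization : exists g : R -> pt,
  [/\ simple_curve g, g 0 = h 0, g 1 = h 1 & forall x, 0 <= x <= 1 ->
    exists2 y, 0 <= y <= 1 & g x = h y].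
Proof.
pose D := weight 0 - weight 1.
have D0 : 0 < D by rewrite subr_gt0; apply: weight_strict.
pose N x := (weight 0 - weight x) / D.
have N0 : N 0 = 0 by rewrite /N subrr mul0r.
have N1 : N 1 = 1 by rewrite /N divff// gt_eqF.
have Nmono x y : 0 <= x -> x <= y -> N x <= N y.
  move=> x0 xy; rewrite ler_pM2r ?invr_gt0// lerD2l lerN2; exact: weight_mono.
have Neq x y : 0 <= x <= 1 -> 0 <= y <= 1 -> N x = N y <-> h x = h y.
  have main u v : 0 <= u -> u <= v -> v <= 1 -> N u = N v <-> h u = h v.
    move=> u0 uv v1; split=> [|/(weight_const u0 uv v1) E]; last by rewrite /N E.
    move=> /(mulIf (lt0r_neq0 _)); rewrite invr_gt0 => /(_ D0) E.
    by apply: contrapT => /(weight_strict u0 uv v1); lra.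
  move=> /andP[x0 x1] /andP[y0 y1]; have [xy|yx] := leP x y; first exact: main.
  by have [H1 H2] := main y x y0 (ltW yx) x1; split=> E; symmetry; [apply: H1|apply: H2].
have Ncont : ucont (N : R -> R).
  move=> e e0; have [d d0 dP] := weight_cont (e := e * D) (mulr_gt0 e0 D0).
  exists d => // s t s01 t01 st; rewrite /N -mulrBl normrM (gtr0_norm (x := D^-1)) ?invr_gt0//.
  rewrite ltr_pdivrMr//.
  have -> : weight 0 - weight s - (weight 0 - weight t) = weight t - weight s by ring.
  by rewrite distrC; exact: dP.
have Nonto u : 0 <= u <= 1 -> exists x, 0 <= x <= 1 /\ N x = u.
  move=> u01; have [||x] := @IVT R N 0 1 u ler01.
  - apply: within_continuousRP => t; rewrite /= in_itv /= => t01 e e0.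
    have [d d0 dP] := Ncont e e0; exists d => // s; rewrite /= in_itv /= => s01.
    exact: dP.
  - by rewrite N0 N1 min_l ?ler01// max_r ?ler01.
  by rewrite in_itv /= => x01 Nx; exists x.
have /choice[p pP] : forall u, exists x, 0 <= u <= 1 -> 0 <= x <= 1 /\ N x = u.
  move=> u; have [/Nonto [x ?]|?] := pselect (0 <= u <= 1); last by exists 0.
  by exists x.
have inv_cont e : 0 < e -> exists2 d, 0 < d & forall x y, 0 <= x <= 1 -> 0 <= y <= 1 ->
    `|N x - N y| < d -> `|h x - h y| < e.
  move=> e0.
  have [x r r' r'0 rr' Pr y y01 xy|t t01|d d0 dP] := @segment_uniform R (fun x r =>
    forall y, 0 <= y <= 1 -> `|N x - N y| < r -> `|h x - h y| < e) 0 1.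
  - by apply: Pr => //; exact: lt_le_trans xy rr'.
  - have [d1 d10 dP1] := hc (e := e / 4) ltac:(lra).
    have [y r r' r'0 rr' Pr /Pr|y y01|m m0 mP] := @segment_uniform R (fun y r =>
      e / 2 <= `|h t - h y| -> r <= `|N t - N y|) 0 1; first lra.
      have [hty|hty] := pselect (h t = h y).
        exists d1 => // y' y'01 /(dP1 _ _ y01 y'01); rewrite hty; lra.
      have n0 : 0 < `|N t - N y|.
        by rewrite normr_gt0 subr_eq0; apply/eqP => E; apply: hty; apply/(Neq _ _ t01 y01).
      have [d2 d20 dP2] := Ncont (`|N t - N y| / 2) ltac:(lra).
      exists (Num.min d2 (`|N t - N y| / 2)) => [|y' y'01]; first by rewrite lt_min d20; lra.
      rewrite lt_min => /andP[/(dP2 _ _ y01 y'01) yy' _] _.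
      rewrite ge_min; apply/orP; right.
      have := ler_distD (N y') (N t) (N y); rewrite (distrC (N y')); lra.
    have [d2 d20 dP2] := Ncont (m / 2) ltac:(lra).
    exists (Num.min (Num.min d1 d2) (m / 2)) => [|t' t'01].
      by rewrite !lt_min d10 d20; lra.
    rewrite !lt_min => /andP[/andP[/(dP1 _ _ t01 t'01) htt' /(dP2 _ _ t01 t'01) Ntt'] _].
    move=> y y01; rewrite !lt_min => /andP[_ Nty].
    have hty : `|h t - h y| < e / 2.
      rewrite ltNge; apply/negP => /(mP y y01).
      have := ler_distD (N t') (N t) (N y); lra.
    have := ler_distD (h t) (h t') (h y); rewrite (distrC (h t') (h t)); lra.
  by exists d => // x y x01 y01; exact: dP.
have I0 : 0 <= (0 : R) <= 1 by rewrite lexx ler01.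
have I1 : 0 <= (1 : R) <= 1 by rewrite lexx ler01.
have [p0 Np0] := pP 0 I0; have [p1 Np1] := pP 1 I1.
exists (h \o p); split.
- split.
    apply/within_continuousP => t; rewrite /= in_itv /= => t01 e e0.
    have [d d0 dP] := inv_cont e e0; exists d => // s; rewrite /= in_itv /= => s01 ts.
    have [pt01 Npt] := pP t t01; have [ps01 Nps] := pP s s01.
    by apply: dP => //; rewrite Npt Nps.
  move=> x y; rewrite !in_itv /= => x01 y01.
  have [px Npx] := pP x x01; have [py Npy] := pP y y01.
  by move=> /(Neq _ _ px py); rewrite Npx Npy.
- by apply/(Neq _ _ p0 I0); rewrite Np0 N0.
- by apply/(Neq _ _ p1 I1); rewrite Np1 N1.
- by move=> x /pP [px _]; exists (p x).
Qed.

End MonotoneReparam.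

Section ArcOfPath.
Variable R : realType.

(** Access to a vertex from a face only yields a path, while an edge has to be drawn as a simple
    curve. *)
Lemma arc_of_path (f : R -> R * R) : ucont f -> f 0 <> f 1 ->
  exists g, [/\ simple_curve g, g 0 = f 0, g 1 = f 1 & trace g `<=` trace f].
Proof.
move=> fc f01; have [h [hc h0 h1 hf hM]] := light_reparametrization fc.
have [|g [sg g0 g1 gh]] := simple_reparametrization hc hM; first by rewrite h0 h1.
exists g; split; rewrite ?g0 ?g1 // => w [x /=]; rewrite in_itv /= => /gh [y y01 gy] <-.
by rewrite gy; exact: hf.
Qed.

End ArcOfPath.

(** * Accessibility of boundary points *)

Section Access.
Variable R : realType.
Local Notation pt := (R * R)%type.
Implicit Types (K : set pt) (x y z w p : pt).

Definition clamp (t : R) := Num.max 0 (Num.min 1 t).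

Lemma clamp01 t : 0 <= clamp t <= 1.
Proof.
by rewrite /clamp; case: (leP 1 t) => ?; rewrite ?(max_r ler01) ?lexx ?ler01//;
   case: (leP 0 t) => ?; rewrite ?lexx ?ler01 //; apply/andP; split; lra.
Qed.

Lemma clamp_le0 t : t <= 0 -> clamp t = 0.
Proof. by move=> t0; rewrite /clamp min_r ?max_l//; lra. Qed.

Lemma clamp_ge1 t : 1 <= t -> clamp t = 1.
Proof. by move=> t1; rewrite /clamp min_l// max_r. Qed.

Lemma clamp_id t : 0 <= t <= 1 -> clamp t = t.
Proof. by move=> /andP[t0 t1]; rewrite /clamp min_r// max_r. Qed.

Lemma clamp_lip s t : `|clamp s - clamp t| <= `|s - t|.
Proof.
have main u v : u <= v -> `|clamp u - clamp v| <= `|u - v|.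
  move=> uv; rewrite (ler0_norm (x := u - v)); last lra.
  have [u0|u0] := leP u 0; have [v1|v1] := leP 1 v.
  - rewrite clamp_le0// clamp_ge1// ler_norml; apply/andP; split; lra.
  - rewrite (clamp_le0 u0); have [v0|v0] := leP v 0.
      by rewrite clamp_le0// ler_norml; apply/andP; split; lra.
    by rewrite clamp_id ?ler_norml; apply/andP; split; lra.
  - rewrite (clamp_ge1 v1); have [u1|u1] := leP 1 u.
      by rewrite clamp_ge1// ler_norml; apply/andP; split; lra.
    by rewrite clamp_id ?ler_norml; apply/andP; split; lra.
  - by rewrite !clamp_id ?ler_norml; apply/andP; split; lra.
have [|ts] := leP s t; first exact: main.
by rewrite distrC (distrC s); exact: main (ltW ts).
Qed.

Definition ucontR (g : R -> pt) := forall e, 0 < e ->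
  exists2 d, 0 < d & forall s t, `|s - t| < d -> `|g s - g t| < e.

Lemma ucontR_cst x : ucontR (fun=> x).
Proof. by move=> e e0; exists 1 => // s t _; rewrite subrr normr0. Qed.

Lemma ucontR_add g1 g2 : ucontR g1 -> ucontR g2 -> ucontR (fun t => g1 t + g2 t).
Proof.
move=> c1 c2 e e0; have e2 : 0 < e / 2 by lra.
have [d1 d10 H1] := c1 _ e2; have [d2 d20 H2] := c2 _ e2.
exists (Num.min d1 d2) => [|s t]; first by rewrite lt_min d10.
rewrite lt_min => /andP[/H1 ? /H2 ?].
rewrite opprD addrACA; apply: le_lt_trans (ler_normD _ _) _; lra.
Qed.

Lemma ucontR_lip g (th : R -> R) (M : R) : ucontR g ->
  (forall s t, `|th s - th t| <= M * `|s - t|) -> ucontR (g \o th).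
Proof.
move=> gc th_lip e e0; have [d d0 dP] := gc e e0.
exists (d / (`|M| + 1)) => [|s t]; first by rewrite divr_gt0// ltr_wpDl.
rewrite ltr_pdivlMr ?ltr_wpDl// => st; apply: dP; apply: le_lt_trans st.
apply: le_trans (th_lip s t) _; rewrite mulrC ler_wpM2l//.
by have := ler_norm M; lra.
Qed.

Lemma ucontR_line (z : pt) : ucontR (fun t => clamp t *: z).
Proof.
move=> e e0; exists (e / (`|z| + 1)) => [|s t]; first by rewrite divr_gt0// ltr_wpDl.
rewrite ltr_pdivlMr ?ltr_wpDl// -scalerBl normrZ => st.
apply: le_lt_trans st; apply: ler_pM => //; first exact: clamp_lip.
by rewrite lerDl.
Qed.

Lemma between_line (a b t : R) : 0 <= t <= 1 -> between a b (a + t * (b - a)).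
Proof.
move=> /andP[t0 t1]; rewrite /between; have [ab|ba] := leP a b; apply/orP; [left|right];
by apply/andP; split; nra.
Qed.

(** The path is constant on either side of the unit interval, so that concatenation becomes addition
    of displacements on the whole line. *)
Lemma joined_path K x y : joined K x y -> exists g : R -> pt,
  [/\ ucontR g, forall t, t <= 0 -> g t = x, forall t, 1 <= t -> g t = y
    & forall t, joined K x (g t)].
Proof.
elim=> [Kx|u v xu [g [gc g0 g1 gK]] uv].
  by exists (fun=> x); split=> //; [exact: ucontR_cst|move=> _; exact: joined_refl].
exists (fun t => (g \o (fun t => 2 * t)) t + ((fun t => clamp t *: (v - u)) \o (fun t => 2 * t - 1)) t).
split.
- apply: ucontR_add; apply: (@ucontR_lip _ _ 2) => //; [|exact: ucontR_line|].
    by move=> s t; rewrite -mulrBr normrM ger0_norm.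
  move=> s t; have -> : 2 * s - 1 - (2 * t - 1) = 2 * (s - t) by ring.
  by rewrite normrM ger0_norm.
- move=> t t0 /=; rewrite g0; last lra.
  by rewrite clamp_le0 ?scale0r ?addr0//; lra.
- move=> t t1 /=; rewrite g1; last lra.
  by rewrite clamp_ge1 ?scale1r ?(addrC u) ?subrK//; lra.
move=> t /=; have [th|th] := leP t (1 / 2).
  by rewrite (clamp_le0 (t := _ - 1)) ?scale0r ?addr0//; lra.
rewrite g1; last lra.
apply: (joined_step xu) => w Kw uw; apply: (uv w Kw).
apply: box_sub uw; first exact: box_l.
by split=> /=; apply: between_line; exact: clamp01.
Qed.

(* Only finitely many components of a small punctured disc around [p] come
   close to [p]. *)
Definition locally_finite K p := forall r, 0 < r -> exists2 r', 0 < r' &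
  exists s : seq pt, forall y, `|y - p| < r' -> ~ K y ->
  exists2 z, z \in s & joined (K `|` sphere p r) z y.

(** The component of [x] off [K] accumulates at [p] within a single component off [K'], that of
    [z]. *)
Definition near_class K K' p x z := forall e, 0 < e -> exists w,
  [/\ `|w - p| < e, joined K x w & joined K' z w].

(** Pigeonhole: finitely many classes cover the points of the component near [p], so one of them
    comes arbitrarily close. *)
Lemma near_class_exists K K' p x r' (s : seq pt) : 0 < r' ->
  (forall y, `|y - p| < r' -> joined K x y -> exists2 z, z \in s & joined K' z y) ->
  touches K x p -> exists z, near_class K K' p x z.
Proof.
move=> r'0 sP tx; apply: contrapT => none.
have bad z : exists2 e, 0 < e & forall w, `|w - p| < e -> joined K x w -> ~ joined K' z w.
  have /existsNP[e /not_implyP[e0 H]] : ~ near_class K K' p x z.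
    by move=> H; apply: none; exists z.
  by exists e => // w we xw zw; apply: H; exists w.
have [e e0 He] : exists2 e, 0 < e & forall z, z \in s -> forall w, `|w - p| < e ->
    joined K x w -> ~ joined K' z w.
  elim: s {sP} => [|z s [e e0 He]]; first by exists 1.
  have [e' e'0 He'] := bad z; exists (Num.min e e'); first by rewrite lt_min e0.
  move=> z'; rewrite inE => /orP[/eqP ->|zs] w; rewrite lt_min => /andP[? ?].
    exact: He'.
  exact: He.
have [|y] := tx (Num.min e r'); first by rewrite lt_min e0.
rewrite lt_min => /andP[ye yr] xy.
have [z zs zy] := sP y yr xy.
exact: (He z zs y ye xy zy).
Qed.

Lemma near_class_touches K K' p x z : near_class K K' p x z -> touches K' z p.
Proof. by move=> H e /H [w [? _ ?]]; exists w. Qed.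

Lemma touches_class K p x y : joined K y x -> touches K x p -> touches K y p.
Proof. by move=> yx tx e /tx [w ? xw]; exists w => //; exact: joined_trans xw. Qed.

Lemma joined_sphere_ball K p r x y : joined (K `|` sphere p r) x y -> `|x - p| < r ->
  `|y - p| < r.
Proof. by move=> xy; apply: sphere_sep; apply: joined_sub xy => w; right. Qed.

Section Ray.
Variables (K : set pt) (p x : pt).
Hypothesis lfK : locally_finite K p.

(** At scale [r], one of the finitely many components off [K] and the sphere of radius [r]
    accumulates at [p]. The next point is taken in a part of it that accumulates at [p] at half the
    scale, so consecutive points are joined inside shrinking balls. *)
Lemma ray_sequence : touches K x p -> exists (y : nat -> pt) (r : nat -> R),
  [/\ y 0%N = x, joined K (y 0%N) (y 1%N), forall n, 0 < r n,
      forall n, r n.+1 <= r n / 2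
    & forall n, `|y n.+1 - p| < r n.+1 /\ joined (K `|` sphere p (r n.+1)) (y n.+1) (y n.+2)].
Proof.
move=> tx.
have nextP (K1 : set pt) u (r : R) : K `<=` K1 -> 0 < r -> touches K1 u p -> exists2 v,
    joined K1 u v /\ `|v - p| < r & touches (K `|` sphere p r) v p.
  move=> KK1 r0 tu; have [r' r'0 [s sP]] := lfK r0.
  have [|z nz] := @near_class_exists K1 (K `|` sphere p r) p u r' s r'0 _ tu.
    by move=> y yr uy; apply: sP => //; have [_ K1y] := joined_out uy; move/KK1.
  have [v [vr uv zv]] := nz _ r0; exists v => //.
  by apply: touches_class (near_class_touches nz); exact: joined_sym.
have [v [xv vp] tv] := nextP K x 1 (fun _ => id) ltr01 tx.
have [next nP] : exists next : pt * R -> pt, forall st, 0 < st.2 ->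
    touches (K `|` sphere p st.2) st.1 p ->
    [/\ joined (K `|` sphere p st.2) st.1 (next st), `|next st - p| < st.2 / 2
      & touches (K `|` sphere p (st.2 / 2)) (next st) p].
  suff /choice[next nP] : forall st : pt * R, exists w, 0 < st.2 ->
    touches (K `|` sphere p st.2) st.1 p ->
    [/\ joined (K `|` sphere p st.2) st.1 w, `|w - p| < st.2 / 2
      & touches (K `|` sphere p (st.2 / 2)) w p] by exists next.
  move=> [u r] /=.
  have [r0|r0] := ltP 0 r; last by exists u; lra.
  have [tu|tu] := pselect (touches (K `|` sphere p r) u p); last by exists u.
  have [w [uw wr] tw] := nextP (K `|` sphere p r) u (r / 2) (fun _ => @or_introl _ _)
    ltac:(lra) tu.
  by exists w.
pose st n := iter n (fun st => (next st, st.2 / 2)) (v, 1).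
have stI n : [/\ 0 < (st n).2, `|(st n).1 - p| < (st n).2
    & touches (K `|` sphere p (st n).2) (st n).1 p].
  elim: n => [|n [r0 _ tn]]; first by split.
  have [_ ? ?] := nP _ r0 tn.
  by split => //=; lra.
(* The start [x] need not be near [p]: hence the shift by one, and the radius 2 at index 0 to
   precede the first radius 1. *)
exists (fun n => if n is m.+1 then (st m).1 else x), (fun n => if n is m.+1 then (st m).2 else 2).
split=> //.
- by move=> [|n] //; have [] := stI n.
- by move=> [|n] /=; lra.
by move=> n; have [r0 H tn] := stI n; split=> //; have [] := nP _ r0 tn.
Qed.

Hypothesis tx : touches K x p.

(** The paths between consecutive points are run on the intervals [[T n, T n.+1]]. From index 1 on,
    the n-th one stays within [r n] of [p], which gives continuity at 1. *)
Lemma access_ray : exists f : R -> pt,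
  [/\ ucont f, f 0 = x, f 1 = p & forall t, 0 <= t < 1 -> joined K x (f t)].
Proof.
have [y [r [y0 y01 r0 rS yS]]] := ray_sequence tx.
have gex n : exists g : R -> pt, [/\ ucontR g, forall t, t <= 0 -> g t = y n,
    forall t, 1 <= t -> g t = y n.+1, forall t, joined K (y n) (g t)
    & (0 < n)%N -> forall t, `|g t - p| < r n].
  case: n => [|n].
    by have [g [gc g0 g1 gK]] := joined_path y01; exists g; split.
  have [yp yj] := yS n; have [g [gc g0 g1 gK]] := joined_path yj; exists g; split=> //.
    by move=> t; apply: joined_sub (gK t); left.
  by move=> _ t; exact: joined_sphere_ball (gK t) yp.
have [g gP] : exists g : nat -> R -> pt, forall n, [/\ ucontR (g n),
    forall t, t <= 0 -> g n t = y n, forall t, 1 <= t -> g n t = y n.+1,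
    forall t, joined K (y n) (g n t) & (0 < n)%N -> forall t, `|g n t - p| < r n].
  by have [g gP] := choice gex; exists g.
pose T n : R := 1 - (1 / 2) ^+ n.
have half0 n : 0 < (1 / 2 : R) ^+ n by apply: exprn_gt0; lra.
have TS n : T n.+1 = T n + (1 / 2) ^+ n.+1 by rewrite /T exprS; lra.
have Tmono m n : (m <= n)%N -> T m <= T n.
  move=> /subnK <-; elim: (n - m)%N => [|k IH]; first by rewrite add0n.
  by rewrite addSn TS; have := half0 (k + m).+1; lra.
pose th n t : R := (t - T n) * 2 ^+ n.+1.
have half2 n : (1 / 2 : R) ^+ n * 2 ^+ n = 1 by rewrite -exprMn mul1r mulVf ?expr1n// gt_eqF.
have pow2 n : 0 < 2 ^+ n :> R by apply: exprn_gt0.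
have th0 n t : t <= T n -> th n t <= 0 by move=> tn; rewrite /th pmulr_lle0//; lra.
have th1 n t : T n.+1 <= t -> 1 <= th n t.
  by move=> tn; rewrite -(half2 n.+1) ler_pM2r//; rewrite TS in tn; lra.
(* Each [g n] is constant before and after its own interval, so this telescoping sum is the
   concatenation of the first [N] paths, and it is continuous as a sum. *)
pose P N t := x + \sum_(n < N) (g n (th n t) - y n).
have Pc N : ucontR (P N).
  rewrite /P; elim: N => [|N IH].
    have -> : (fun t : R => x + \sum_(n < 0) (g n (th n t) - y n)) = fun=> x.
      by apply/funext => t; rewrite big_ord0 addr0.
    exact: ucontR_cst.
  have -> : (fun t : R => x + \sum_(n < N.+1) (g n (th n t) - y n)) =
    fun t => (x + \sum_(n < N) (g n (th n t) - y n)) + ((g N \o th N) t + - y N).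
    by apply/funext => t; rewrite big_ord_recr addrA.
  apply: (ucontR_add IH); apply: ucontR_add; last exact: ucontR_cst.
  have [gc _ _ _ _] := gP N.
  apply: (@ucontR_lip _ _ (2 ^+ N.+1) gc) => s t.
  rewrite /th -mulrBl; have -> : s - T N - (t - T N) = s - t by ring.
  rewrite normrM mulrC ler_wpM2r//.
  by rewrite ger0_norm// ltW.
have PS N t : P N.+1 t = P N t + (g N (th N t) - y N) by rewrite /P big_ord_recr addrA.
have Pst N M t : t <= T N -> (N <= M)%N -> P M t = P N t.
  move=> tN /subnK <-; elim: (M - N)%N => [|k IH]; first by rewrite add0n.
  rewrite addSn PS IH; have [_ g0 _ _ _] := gP (k + N)%N; rewrite g0 ?subrr ?addr0//.
  by apply: th0; apply: le_trans tN _; apply: Tmono; rewrite leq_addl.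
have Pend N t : T N <= t -> P N t = y N.
  elim: N => [|N IH] tN; first by rewrite /P big_ord0 addr0 y0.
  rewrite PS IH; last by apply: le_trans tN; exact: Tmono.
  have [_ _ g1 _ _] := gP N; rewrite g1 1?addrC ?subrK//.
  exact: th1.
have Pval N t : T N <= t -> P N.+1 t = g N (th N t) by move=> tN; rewrite PS Pend// addrC subrK.
have findN t : t < 1 -> exists N, t < T N.
  move=> t1; have : 0 <= (1 - t)^-1 by rewrite invr_ge0; lra.
  move/archi_boundP; move: (Num.bound _) => n nP; exists n.
  have t0 : 0 < 1 - t by lra.
  have n0 : 0 < n%:R :> R by apply: le_lt_trans nP; rewrite invr_ge0 ltW.
  suff : (1 / 2 : R) ^+ n < 1 - t by rewrite /T; lra.
  rewrite div1r exprVn -(invrK (1 - t)) ltf_pV2 ?posrE ?invr_gt0 ?exprn_gt0 //.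
  by apply: lt_trans nP _; rewrite -natrX ltr_nat ltn_expl.
have [Nt NtP] : exists Nt : R -> nat, forall t, t < 1 -> t < T (Nt t).
  suff /choice[Nt NtP] : forall t, exists N, t < 1 -> t < T N by exists Nt.
  move=> t; have [/findN [N ?]|?] := ltP t 1; first by exists N.
  by exists 0%N; lra.
pose f t := if t < 1 then P (Nt t) t else p.
have T1 N : T N < 1 by have := half0 N; rewrite /T; lra.
have fP N t : t <= T N -> f t = P N t.
  move=> tN; have t1 : t < 1 by apply: le_lt_trans tN (T1 N).
  rewrite /f t1; have [NN|NN] := leqP N (Nt t); first exact: Pst.
  by symmetry; apply: Pst (ltW (NtP t t1)) (ltnW NN).
have between_T N t : T N <= t -> t < 1 -> exists2 n, (N <= n)%N & T n <= t <= T n.+1.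
  move=> Nt_ /findN [M tM].
  have : (N <= M)%N by rewrite leqNgt; apply/negP => /ltnW /Tmono; lra.
  move=> /subnK E; move: tM; rewrite -E; elim: (M - N)%N => [|k IH]; first by rewrite add0n; lra.
  rewrite addSn; have [tk _|tk tk'] := ltP t (T (k + N)%N); first exact: IH.
  by exists (k + N)%N; rewrite ?leq_addl// tk ltW.
have fval N t : T N <= t -> t < 1 -> exists2 n, (N <= n)%N & exists u, f t = g n u.
  move=> tN t1; have [n Nn /andP[n1 n2]] := between_T N t tN t1.
  by exists n => //; exists (th n t); rewrite (fP n.+1)// Pval.
have xy n : joined K x (y n).
  elim: n => [|n IH]; first by rewrite y0; apply: joined_refl; have [] := joined_out y01; rewrite y0.
  by apply: joined_trans IH _; have [_ _ g1 gK _] := gP n; rewrite -(g1 1 (lexx _)).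
have T0 : T 0%N = 0 by rewrite /T expr0 subrr.
exists f; split.
- suff /curve_uniform H : {within `[0, 1], continuous f} by move=> e /H.
  apply/within_continuousP => t; rewrite /= in_itv /= => /andP[t0 t1] e e0.
  have [t1'|t1'] := ltP t 1.
    have [N tN] := findN t t1'; have [d d0 dP] := Pc N e e0.
    exists (Num.min d (T N - t)) => [|s _]; first by rewrite lt_min d0 subr_gt0.
    rewrite lt_min => /andP[ts]; rewrite ltr_norml => /andP[? ?].
    by rewrite !(fP N) ?(ltW tN)//; [exact: dP|lra].
  have -> : t = 1 by lra.
  have f1 : f 1 = p by rewrite /f ltxx.
  have rn n : r n <= r 0%N * (1 / 2) ^+ n.
    elim: n => [|n IH]; first by rewrite expr0 mulr1.
    by rewrite exprS; have := rS n; nra.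
  have [N NP] : exists N, r 0%N * (1 / 2) ^+ N < e.
    have [N NP] := findN (1 - e / r 0%N) ltac:(by rewrite ltrBlDr ltrDl divr_gt0).
    exists N; have : (1 / 2) ^+ N < e / r 0%N by rewrite /T in NP; lra.
    by rewrite ltr_pdivlMr// mulrC.
  have rmono m n : (m <= n)%N -> r n <= r m.
    move=> /subnK <-; elim: (n - m)%N => [|k IH]; first by rewrite add0n.
    by rewrite addSn; have := rS (k + m)%N; have := r0 (k + m)%N; lra.
  exists (1 - T N.+1) => [|s]; first by rewrite subr_gt0.
  rewrite /= in_itv /= => /andP[s0 s1]; rewrite ltr_norml => /andP[? ?].
  have [s1'|s1'] := ltP s 1; last by rewrite (_ : s = 1) ?subrr ?normr0//; lra.
  have [n Nn [u ->]] := fval N.+1 s ltac:(lra) s1'.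
  have [_ _ _ _ gp] := gP n; rewrite f1 distrC.
  apply: lt_trans (gp (leq_ltn_trans (leq0n _) Nn) u) _.
  by apply: le_lt_trans NP; apply: le_trans (rn N); apply: rmono; exact: ltnW.
- by rewrite (fP 0%N) ?T0// Pend ?T0.
- by rewrite /f ltxx.
move=> t /andP[t0 t1]; have [n _ [u ->]] := fval 0%N t ltac:(by rewrite T0) t1.
by apply: joined_trans (xy n) _; have [_ _ _ gK _] := gP n.
Qed.

End Ray.

Lemma access_arc K p q x : p <> q -> locally_finite K p -> locally_finite K q ->
  touches K x p -> touches K x q -> exists g,
  [/\ simple_curve g, g 0 = p, g 1 = q & forall t, 0 <= t <= 1 ->
      [\/ joined K x (g t), g t = p | g t = q]].
Proof.
move=> pq lp lq tp tq.
have [f1 [c1 f10 f11 f1K]] := access_ray lp tp.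
have [f2 [c2 f20 f21 f2K]] := access_ray lq tq.
(* Each of the two rays rests at [x] while the other one moves. *)
pose f t := f1 (clamp (1 - 2 * t)) + f2 (clamp (2 * t - 1)) - x.
have f0 : f 0 = p.
  have a1 : clamp (1 - 2 * 0) = 1 by apply: clamp_ge1; lra.
  have a0 : clamp (2 * 0 - 1) = 0 by apply: clamp_le0; lra.
  by rewrite /f a1 a0 f11 f20 addrK.
have f1' : f 1 = q.
  have a0 : clamp (1 - 2 * 1) = 0 by apply: clamp_le0; lra.
  have a1 : clamp (2 * 1 - 1) = 1 by apply: clamp_ge1; lra.
  by rewrite /f a1 a0 f10 f21 addrC addrA addNr add0r.
have fc : ucont f.
  move=> e e0; have e2 : 0 < e / 2 by lra.
  have [d1 d10 H1] := c1 _ e2; have [d2 d20 H2] := c2 _ e2.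
  exists (Num.min d1 d2 / 2) => [|s t _ _ st]; first by rewrite divr_gt0// lt_min d10.
  have st2 : `|2 * (s - t)| < Num.min d1 d2.
    by rewrite normrM ger0_norm//; lra.
  move: st2; rewrite lt_min => /andP[st1 st2].
  have h1 : `|f1 (clamp (1 - 2 * s)) - f1 (clamp (1 - 2 * t))| < e / 2.
    apply: H1; rewrite ?clamp01//; apply: le_lt_trans (clamp_lip _ _) _.
    have -> : 1 - 2 * s - (1 - 2 * t) = - (2 * (s - t)) by ring.
    by rewrite normrN.
  have h2 : `|f2 (clamp (2 * s - 1)) - f2 (clamp (2 * t - 1))| < e / 2.
    apply: H2; rewrite ?clamp01//; apply: le_lt_trans (clamp_lip _ _) _.
    by have -> : 2 * s - 1 - (2 * t - 1) = 2 * (s - t) by ring.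
  rewrite /f opprB addrA subrK opprD addrACA.
  by apply: le_lt_trans (ler_normD _ _) _; lra.
have [|g [sg g0 g1 gf]] := arc_of_path fc; first by rewrite f0 f1'.
exists g; split; rewrite ?g0 ?g1 // => t t01.
have [s /=] : trace f (g t) by apply: gf; exists t; rewrite //= in_itv.
rewrite in_itv /= => /andP[s0 s1] <-.
have [sh|sh] := leP s (1 / 2).
  have -> : f s = f1 (clamp (1 - 2 * s)).
    by rewrite /f (clamp_le0 (t := 2 * s - 1)) ?f20 ?addrK//; lra.
  rewrite clamp_id; last by apply/andP; split; lra.
  have [?|?] := ltP 0 s; first by apply: Or31; apply: f1K; apply/andP; split; lra.
  by apply: Or32; rewrite -f11; congr f1; lra.
have -> : f s = f2 (clamp (2 * s - 1)).
  by rewrite /f (clamp_le0 (t := 1 - 2 * s)) ?f10; [rewrite addrC addrA addNr add0r|lra].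
rewrite clamp_id; last by apply/andP; split; lra.
have [?|?] := ltP s 1; first by apply: Or31; apply: f2K; apply/andP; split; lra.
by apply: Or33; rewrite -f21; congr f2; lra.
Qed.

End Access.

(** * Faces along an arc and around the centre of a star of arcs *)

Section ArcFaces.
Variable R : realType.
Local Notation pt := (R * R)%type.
Implicit Types (K : set pt) (x y z w p : pt) (c : R -> pt).

Definition rev_curve c (t : R) := c (1 - t).

Lemma simple_rev c : simple_curve c -> simple_curve (rev_curve c).
Proof.
move=> [/within_continuousP cc ci]; split.
  apply/within_continuousP => t; rewrite /= in_itv /= => /andP[t0 t1] e e0.
  have [|d d0 dP] := cc (1 - t) _ e e0; first by rewrite /= in_itv /=; apply/andP; split; lra.
  exists d => // s; rewrite /= in_itv /= => /andP[s0 s1] ts; apply: dP.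
    by rewrite /= in_itv /=; apply/andP; split; lra.
  have -> : 1 - t - (1 - s) = - (t - s) by ring.
  by rewrite normrN.
move=> s t; rewrite !in_itv /= => /andP[? ?] /andP[? ?] /ci; rewrite !in_itv /= => H.
have : 1 - s = 1 - t by apply: H; apply/andP; split; lra.
by lra.
Qed.

Lemma trace_rev c : trace (rev_curve c) = trace c.
Proof.
apply/seteqP; split=> w [t /=]; rewrite in_itv /= => /andP[? ?] <-;
exists (1 - t); rewrite /= ?in_itv /=; try by apply/andP; split; lra.
  by [].
by rewrite /rev_curve opprB addrC subrK.
Qed.

Lemma touches_closed K x w : (forall e, 0 < e ->
  exists2 w', `|w' - w| < e & touches K x w') -> touches K x w.
Proof.
move=> tw e e0; have [w' w'w tw'] := tw (e / 2) ltac:(lra).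
have [y yw' xy] := tw' (e / 2) ltac:(lra).
by exists y => //; have := ler_distD w' y w; lra.
Qed.

Section TouchArc.
Variables (K : set pt) (x : pt).
Hypothesis cK : compact K.

(** Cut out a short piece [m] of the arc just before [c t1]. A point [y] of the face near [c t0] can
    follow the arc to a point [z] near [m] while avoiding [K] and the last piece, and by [alexander]
    it can also avoid the first piece [e1]. Either it avoids [m] as well or it hits [m] first: in
    both cases the face comes close to [c t1]. *)
Let touch_right c t0 t1 : simple_curve c ->
  (forall w, K w -> trace c w -> w = c 0 \/ w = c 1) ->
  0 < t0 -> t0 <= t1 -> t1 < 1 ->
  touches (K `|` trace c) x (c t0) -> touches (K `|` trace c) x (c t1).
Proof.
move=> sc Kc t00 t01 t11 tx; apply: contrapT => /existsNP[e /not_implyP[e0 nt]].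
have [cc ci] := sc.
have cinj s t : c s = c t -> 0 <= s <= 1 -> 0 <= t <= 1 -> s = t.
  by move=> st s01 t01'; apply: ci; rewrite ?in_itv.
have inT t : 0 <= t <= 1 -> trace c (c t) by move=> ?; exists t; rewrite //= in_itv.
have inner t : 0 < t < 1 -> ~ K (c t).
  by move=> /andP[? ?] Kt; case: (Kc _ Kt (inT _ _)) => [|/cinj|/cinj]; lra.
have {}t01 : t0 < t1.
  by rewrite lt_neqAle t01 andbT; apply/eqP => E; apply: nt; rewrite -E; exact: tx.
have [d d0 dP] := curve_uniform cc (ltac:(lra) : 0 < e / 2).
pose a := Num.max t0 (t1 - d / 2).
have [a0 ad] : t0 <= a /\ t1 - d / 2 <= a by split; rewrite le_max lexx // orbT.
have at1 : a < t1 by rewrite gt_max t01; lra.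
pose m := subarc c a t1.
have mB w : m w -> `|w - c t1| < e / 2.
  move=> [s /=]; rewrite in_itv /= => /andP[? ?] <-; apply: dP.
  - by apply/andP; split; lra.
  - by apply/andP; split; lra.
  - by rewrite ltr_norml; apply/andP; split; lra.
pose K2 := K `|` subarc c t1 1.
have cK2 : compact K2.
  by apply: compactU => //; apply: compact_subarc => //; lra.
have K2c s : 0 < s -> s < t1 -> ~ K2 (c s).
  move=> s0 st [/inner|[u /=]]; first by apply; apply/andP; split; lra.
  by rewrite in_itv /= => /andP[? ?] /cinj H; exfalso; lra.
pose e1 := subarc c 0 a.
have TE : K `|` trace c = (K2 `|` e1) `|` m.
  have -> : trace c = (e1 `|` m) `|` subarc c t1 1.
    by rewrite -subarc_split ?(ltW at1)//; [rewrite -subarc_split//; lra|lra].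
  rewrite /K2 -!setUA; congr (_ `|` _).
  by rewrite [RHS]setUC -!setUA; congr (_ `|` _).
have [r r0 K2r] := compact_far cK2 (K2c t0 ltac:(lra) t01).
have [y yt0 xy] := tx r r0.
have [_ Ky] := joined_out xy.
have y0 : joined K2 y (c t0).
  apply: (@joined_ball _ _ (c t0) r) => //; last by rewrite subrr normr0.
  by move=> w K2w wt; apply: K2r; exists w => //; rewrite distrC.
have [r1 r10 K2r1] := compact_far cK2 (K2c a ltac:(lra) at1).
have [z zr Tz] := trace_empty_interior (c a) sc (ltac:(by rewrite lt_min r10; lra) : 0 < Num.min r1 (e / 2)).
move: zr; rewrite lt_min => /andP[zr1 ze].
have az : joined K2 (c a) z.
  apply: (@joined_ball _ _ (c a) r1) => //; last by rewrite subrr normr0.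
  by move=> w K2w wt; apply: K2r1; exists w => //; rewrite distrC.
have yz : joined K2 y z.
  apply: joined_trans y0 _; apply: joined_trans az.
  apply: (joined_chained cK2 (A := subarc c t0 a)).
  - by apply: compact_subarc => //; lra.
  - move=> w [s /=]; rewrite in_itv /= => /andP[? ?] <-; apply: K2c; lra.
  - by apply: subarc_chained => //; lra.
have zt1 : `|z - c t1| < e.
  have := mB (c a); have := ler_distD (c a) z (c t1).
  have ma : m (c a) by exists a; rewrite //= in_itv /= lexx; lra.
  by move=> ? /(_ ma); lra.
have sub1 : e1 `<=` trace c by apply: subarc_trace; lra.
(* [K2] and [e1] meet at most in [c 0], and the arc [e1] does not separate. *)
have yz1 : joined (K2 `|` e1) y z.
  apply: alexander => //.
  - by apply: compact_subarc => //; lra.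
  - have main w : K2 w -> e1 w -> w = c 0.
      move=> K2w [s /=]; rewrite in_itv /= => /andP[s0 sa] E; move: K2w; rewrite -E.
      have [s0'|s0'] := ltP 0 s; first by move/(K2c _ s0' (le_lt_trans sa at1)).
      by move=> _; congr c; lra.
    by move=> w w' w1 w2 w'1 w'2; rewrite (main w) // (main w').
  - apply: subarc_nonsep => //; try lra.
      by move=> /sub1 ?; apply: Ky; right.
    by move=> /sub1.
have cm : compact m by apply: compact_subarc => //; lra.
have my : ~ m y by move=> my; apply: Ky; rewrite TE; right.
have [|[w [mw _ tw]]] := first_hit cm yz1 my; rewrite -?TE.
  by move=> yz'; apply: nt; exists z => //; exact: joined_trans yz'.
rewrite -TE in tw; have [y' y'w yy'] := tw (e / 2) ltac:(lra).
apply: nt; exists y'; last exact: joined_trans yy'.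
by have := mB w mw; have := ler_distD w y' (c t1); lra.
Qed.

Lemma touch_arc c t0 w : simple_curve c ->
  (forall w, K w -> trace c w -> w = c 0 \/ w = c 1) -> 0 < t0 < 1 ->
  touches (K `|` trace c) x (c t0) -> trace c w -> touches (K `|` trace c) x w.
Proof.
move=> sc Kc /andP[t00 t01] tx.
have inner t : 0 < t < 1 -> touches (K `|` trace c) x (c t).
  move=> /andP[t0' t1]; have [?|tt0] := leP t0 t; first exact: touch_right tx.
  have -> : c t = rev_curve c (1 - t) by rewrite /rev_curve opprB addrC subrK.
  rewrite -(trace_rev c).
  apply: (@touch_right (rev_curve c) (1 - t0)); try lra.
  - exact: simple_rev.
  - move=> w'; rewrite trace_rev /rev_curve subr0 subrr => K1 K2.
    by case: (Kc _ K1 K2); [right|left].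
  - by rewrite trace_rev /rev_curve opprB addrC subrK.
move=> [t /=]; rewrite in_itv /= => /andP[t0' t1'] <-.
apply: touches_closed => e e0; have [cc _] := sc.
have [d d0 dP] := curve_uniform cc e0.
pose d' := Num.min d (1 / 2).
have [d'd d'h] : d' <= d /\ d' <= 1 / 2 by split; rewrite ge_min lexx // orbT.
have d'0 : 0 < d' by rewrite lt_min d0; lra.
have [th|th] := leP t (1 / 2).
  exists (c (t + d' / 2)); last by apply: inner; apply/andP; split; lra.
  by apply: dP; rewrite ?ltr_norml; apply/andP; split; lra.
exists (c (t - d' / 2)); last by apply: inner; apply/andP; split; lra.
by apply: dP; rewrite ?ltr_norml; apply/andP; split; lra.
Qed.

End TouchArc.

Section Star.
Variables (E : eqType) (sigma : E -> R -> pt) (tau : E -> R) (K : set pt) (p : pt).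
Hypotheses (cK : compact K) (Kp : ~ K p).

Definition star (es : seq E) : set pt :=
  [set w | exists2 e, e \in es & subarc (sigma e) 0 (tau e) w].

Lemma star_cons e es : star (e :: es) = star es `|` subarc (sigma e) 0 (tau e).
Proof.
apply/seteqP; split=> w.
  move=> [f]; rewrite inE => /orP[/eqP ->|fes] fw; first by right.
  by left; exists f.
move=> [[f fes fw]|ew]; last by exists e; rewrite // inE eqxx.
by exists f; rewrite // inE fes orbT.
Qed.

Lemma star_nil : star [::] = set0.
Proof. by apply/seteqP; split=> // w []. Qed.

Lemma star_compact es :
  (forall e, e \in es -> simple_curve (sigma e) /\ 0 <= tau e <= 1) -> compact (star es).
Proof.
elim: es => [_|e es IH scs]; first by rewrite star_nil; exact: compact0.
have [[cc _] /andP[t0 t1]] := scs e (mem_head _ _).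
rewrite star_cons; apply: compactU; last exact: compact_subarc.
by apply: IH => f fes; apply: scs; rewrite inE fes orbT.
Qed.

(** By [alexander3], a non-separating [A] that meets [K1] in at most two points cuts each class into
    at most two, so finitely many representatives still suffice. *)
Lemma class_split K1 A (P : pt -> Prop) (L : seq pt) : compact K1 -> compact A ->
  (forall x y, ~ A x -> ~ A y -> joined A x y) ->
  (exists s t, forall w, K1 w -> A w -> w = s \/ w = t) ->
  (forall y, P y -> ~ K1 y -> exists2 z, z \in L & joined K1 z y) ->
  exists L' : seq pt, forall y, P y -> ~ (K1 `|` A) y ->
     exists2 z, z \in L' & joined (K1 `|` A) z y.
Proof.
move=> c1 cA nA [s [t st]] HL.
have split_class z : exists L' : seq pt, forall y, P y -> joined K1 z y -> ~ (K1 `|` A) y ->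
    exists2 z', z' \in L' & joined (K1 `|` A) z' y.
  have [[x [Px zx Ax]]|none] :=
      pselect (exists x, [/\ P x, joined K1 z x & ~ (K1 `|` A) x]); last first.
    by exists [::] => y Py zy Ay; case: none; exists y.
  have [[x' [Px' zx' Ax' xx']]|none] := pselect (exists x', [/\ P x', joined K1 z x',
      ~ (K1 `|` A) x' & ~ joined (K1 `|` A) x x']); last first.
    exists [:: x] => y Py zy Ay; exists x; first by rewrite inE.
    by apply: contrapT => xy; apply: none; exists y.
  exists [:: x; x'] => y Py zy Ay.
  have outA u : ~ (K1 `|` A) u -> ~ A u by apply: contra_not; right.
  have [] := @alexander3 _ K1 A s t x x' y c1 cA st.
  - by apply: joined_trans (joined_sym zx) zx'.
  - by apply: joined_trans (joined_sym zx') zy.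
  - by apply: nA; exact: outA.
  - by apply: nA; exact: outA.
  - by [].
  - by exists x' => //; rewrite !inE eqxx orbT.
  - by exists x => //; rewrite !inE eqxx.
have [L' HL'] : exists L' : seq pt, forall z, z \in L -> forall y, P y -> joined K1 z y ->
    ~ (K1 `|` A) y -> exists2 z', z' \in L' & joined (K1 `|` A) z' y.
  elim: L {HL} => [|z L [L1 H1]]; first by exists [::].
  have [L2 H2] := split_class z; exists (L2 ++ L1) => z'.
  rewrite inE => /orP[/eqP ->|z'L] y Py zy Ay.
    by have [u uL uy] := H2 y Py zy Ay; exists u; rewrite // mem_cat uL.
  by have [u uL uy] := H1 z' z'L y Py zy Ay; exists u; rewrite // mem_cat uL orbT.
exists L' => y Py Ay; have K1y : ~ K1 y by apply: contra_not Ay; left.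
by have [z zL zy] := HL y Py K1y; exact: HL' zL y Py zy Ay.
Qed.

(** The arcs are added one at a time: each meets what is already there at most in the centre [p] and
    in its far end, so [class_split] applies. *)
Lemma star_cover (es : seq E) : uniq es ->
  (forall e, e \in es -> simple_curve (sigma e) /\ 0 <= tau e <= 1) ->
  (forall e w, e \in es -> K w -> subarc (sigma e) 0 (tau e) w -> w = sigma e (tau e)) ->
  (forall e f w, e \in es -> f \in es -> e != f -> subarc (sigma e) 0 (tau e) w ->
     subarc (sigma f) 0 (tau f) w -> w = p) ->
  exists2 r, 0 < r & exists L : seq pt, forall y, `|y - p| < r ->
    ~ ((K `|` [set p]) `|` star es) y ->
    exists2 z, z \in L & joined ((K `|` [set p]) `|` star es) z y.
Proof.
move=> ues scs Ks ss; have [r r0 Kr] := compact_far cK Kp; exists r => //.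
have cKp : compact (K `|` [set p]) by apply: compactU => //; exact: compact_set1.
elim: es ues scs Ks ss => [_ _ _ _|e es IH]; last rewrite cons_uniq => /andP[ees ues] scs Ks ss.
  exists [:: (p.1 + r / 2, p.2)] => y yp Ky.
  exists (p.1 + r / 2, p.2); first by rewrite inE.
  have -> : (K `|` [set p]) `|` star [::] = K `|` [set p].
    by rewrite star_nil setU0.
  have yp' : y <> p by move=> E'; apply: Ky; left; right.
  have d0 : `|(p.1 + r / 2, p.2) - p| = r / 2.
    rewrite norm_ptE /= subrr normr0 addrC addKr ger0_norm; last lra.
    by rewrite max_l //; lra.
  apply: alexander => //.
  - exact: compact_set1.
  - by move=> w w' Kw wp; exfalso; apply: Kp; rewrite -wp.
  - apply: (@joined_ball _ _ p r) => //; last by rewrite d0; lra.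
    by move=> w Kw wp; apply: Kr; exists w => //; rewrite distrC.
  - apply: (@joined_around _ _ p 0); last by rewrite normr_gt0 subr_eq0; apply/eqP.
      by move=> w ->; rewrite subrr normr0.
    by rewrite d0; lra.
have inC f : f \in es -> f \in e :: es by rewrite inE orbC => ->.
have [L HL] : exists L : seq pt, forall y, `|y - p| < r ->
    ~ ((K `|` [set p]) `|` star es) y ->
    exists2 z, z \in L & joined ((K `|` [set p]) `|` star es) z y.
  apply: IH => //.
  - by move=> f /inC /scs.
  - by move=> f w /inC; exact: Ks.
  - by move=> f g w /inC fe /inC; exact: ss.
have ee : e \in e :: es by rewrite inE eqxx.
have [se /andP[t0 t1]] := scs e ee.
rewrite star_cons setUA; apply: (@class_split _ _ (fun y => `|y - p| < r) L _ _ _ _ HL).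
- apply: compactU => //.
  by apply: star_compact => f /inC /scs.
- by case: se => cc _; apply: compact_subarc.
- by move=> x y; exact: subarc_nonsep.
exists p, (sigma e (tau e)) => w [[Kw|->]|[f fes fw]] ew.
- by right; exact: Ks.
- by left.
- left; apply: (ss e f) => //; first exact: inC.
  by apply: contraNneq ees => ->.
Qed.

End Star.
End ArcFaces.

(** * Plane drawings, faces and Euler's formula *)

Section Drawing.
Variables (R : realType) (V : finType).
Local Notation pt := (R * R)%type.
Implicit Types (G E : {set {set V}}) (p : V -> pt) (c : {set V} -> R -> pt).

(** Vertices and edges are selected separately, so that the drawing of a component, or of the graph
    with a vertex deleted, is also available. *)
Definition drawing p c (S : {set V}) E : set pt :=
  (p @` [set` S]) `|` \bigcup_(e in [set` E]) trace (c e).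

Lemma drawing_sub p c (S S' : {set V}) E E' : S \subset S' -> E \subset E' ->
  drawing p c S E `<=` drawing p c S' E'.
Proof.
move=> /fintype.subsetP SS /fintype.subsetP EE w [[v vS <-]|[e eE ew]].
  by left; exists v => //; exact: SS.
by right; exists e => //; exact: EE.
Qed.

Lemma plane_sub G E p c : E \subset G -> plane_graph G p c -> plane_graph E p c.
Proof.
move=> /fintype.subsetP EG [sG [pinj ends vtx edg]]; split; first by move=> e /EG /sG.
split=> //.
- by move=> e /EG /ends.
- by move=> e v /EG; exact: vtx.
- by move=> e f /EG eG /EG fG; exact: edg.
Qed.

Section Fixed.
Variables (G : {set {set V}}) (p : V -> pt) (c : {set V} -> R -> pt).
Hypothesis Gpc : plane_graph G p c.

Local Notation full E := (drawing p c finset.setT E).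

Lemma p_inj : injective p. Proof. by case: Gpc => _ []. Qed.

Lemma edge_curve e : e \in G -> simple_curve (c e).
Proof. by case: Gpc => _ [_ ends _ _] /ends []. Qed.

Lemma edge_ends e : e \in G -> exists u v,
  [/\ e = [set u; v]%SET, u != v, c e 0 = p u & c e 1 = p v].
Proof.
case: Gpc => sG [pinj ends _ _] eG; have [_ E] := ends e eG.
have /eqP/cards2P[a [b [ab eab]]] := sG e eG.
have c01 : c e 0 <> c e 1.
  have [_ ci] := edge_curve eG; move/ci; rewrite !in_itv /= !lexx !ler01 => /(_ isT isT).
  lra.
have [u uab pu] : (p @` [set` e]) (c e 0) by rewrite -E; left.
have [v vab pv] : (p @` [set` e]) (c e 1) by rewrite -E; right.
have uv : u != v by apply/eqP => uv; apply: c01; rewrite -pu -pv uv.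
exists u, v; split=> //.
move: uab vab uv => /=; rewrite eab !inE => /orP[]/eqP -> /orP[]/eqP ->;
by rewrite ?eqxx // finset.setUC.
Qed.

Lemma vertex_on e v : e \in G -> trace (c e) (p v) <-> v \in e.
Proof.
move=> eG; split; first by case: Gpc => _ [_ _ vtx _]; exact: vtx.
have [a [b [-> ab c0 c1]]] := edge_ends eG.
rewrite !inE => /orP[]/eqP ->; [exists 0 => //|exists 1 => //];
by rewrite /= in_itv /= lexx ler01.
Qed.

Lemma edges_meet e f w : e \in G -> f \in G -> e != f -> trace (c e) w -> trace (c f) w ->
  exists v, [/\ v \in e, v \in f & w = p v].
Proof.
case: Gpc => _ [_ _ _ edg] eG fG ef ew fw.
have [v /= ] := edg e f eG fG ef w (conj ew fw).
by rewrite inE => /andP[? ?] <-; exists v.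
Qed.

Lemma edge_endP e v : e \in G -> v \in e -> p v = c e 0 \/ p v = c e 1.
Proof.
move=> eG; have [a [b [-> _ -> ->]]] := edge_ends eG.
by rewrite !inE => /orP[]/eqP ->; [left|right].
Qed.

Lemma edge_end0 e : e \in G -> exists2 v, v \in e & c e 0 = p v.
Proof. by move=> /edge_ends [u [v [-> _ ? _]]]; exists u; rewrite // !inE eqxx. Qed.

Lemma edge_end1 e : e \in G -> exists2 v, v \in e & c e 1 = p v.
Proof. by move=> /edge_ends [u [v [-> _ _ ?]]]; exists v; rewrite // !inE eqxx orbT. Qed.

Lemma compact_trace e : e \in G -> compact (trace (c e)).
Proof. by move/edge_curve => [cc _]; exact: (compact_subarc cc (lexx 0) (lexx 1)). Qed.

Lemma drawing_compact S E : E \subset G -> compact (drawing p c S E).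
Proof.
move=> /fintype.subsetP EG; apply: compactU.
  apply: finite_compact; apply: finite_image; exact: finite_finset.
have -> : \bigcup_(e in [set` E]) trace (c e) = \bigcup_(e in [set` enum E]) trace (c e).
  by apply: eq_bigcupl; split=> e /=; rewrite mem_enum.
rewrite bigcup_seq big_seq_cond; apply: bigsetU_compact => e /andP[+ _].
by rewrite mem_enum => /EG; exact: compact_trace.
Qed.

Lemma drawing_edge S E e w : E \subset G -> e \in G -> e \notin E ->
  drawing p c S E w -> trace (c e) w ->
  exists2 v, w = p v & v \in e /\ (v \in S \/ exists2 f, f \in E & v \in f).
Proof.
move=> /fintype.subsetP EG eG eE [[v vS <-]|[f fE fw]] ew.
  by exists v => //; split; [apply/(vertex_on _ eG)|left].
have [|v [ve vf ->]] := edges_meet eG (EG f fE) _ ew fw.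
  by apply: contraNneq eE => ->.
by exists v => //; split=> //; right; exists f.
Qed.

Lemma full_edge E e w : E \subset G -> e \in G -> e \notin E ->
  full E w -> trace (c e) w -> w = c e 0 \/ w = c e 1.
Proof.
move=> EG eG eE Ew ew; have [v -> [ve _]] := drawing_edge EG eG eE Ew ew.
exact: edge_endP.
Qed.

Lemma drawingU1 S E e : drawing p c S (e |: E) = drawing p c S E `|` trace (c e).
Proof.
apply/seteqP; split=> w.
  move=> [?|[f /= ]]; first by left; left.
  by rewrite !inE => /orP[/eqP ->|fE] fw; [right|left; right; exists f].
move=> [[?|[f fE fw]]|ew]; first by left.
  by right; exists f => //=; rewrite !inE; apply/orP; right.
by right; exists e => //=; rewrite !inE eqxx.
Qed.

Lemma full_vertex E v : full E (p v).
Proof. by left; exists v => //=; rewrite inE. Qed.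

Lemma full_trace E e : e \in E -> trace (c e) `<=` full E.
Proof. by move=> eE w ew; right; exists e. Qed.

Lemma fullP E w : full E w -> (exists v, w = p v) \/ exists2 e, e \in E & trace (c e) w.
Proof. by move=> [[v _ <-]|[e ? ?]]; [left; exists v|right; exists e]. Qed.

Definition adj E : rel V := fun u v => [set u; v]%SET \in E.

Lemma adj_sym E : symmetric (adj E).
Proof. by move=> u v; rewrite /adj finset.setUC. Qed.

Lemma edge_chained e u v : e \in G -> u \in e -> v \in e -> chained (trace (c e)) (p u) (p v).
Proof.
move=> eG; have [a [b [eE _ c0 c1]]] := edge_ends eG.
have [cc _] := edge_curve eG.
have ab : chained (trace (c e)) (p a) (p b).
  by rewrite -c0 -c1; exact: (subarc_chained cc (lexx 0) ler01 (lexx 1)).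
have [aT bT] := chained_in ab.
have ends w : w \in e -> w = a \/ w = b.
  by rewrite eE !inE => /orP[]/eqP; [left|right].
by move=> /ends [] -> /ends [] -> //; [exact: chained_refl|exact: chained_sym|exact: chained_refl].
Qed.

Lemma connect_chained E u v : E \subset G -> connect (adj E) u v ->
  chained (full E) (p u) (p v).
Proof.
move=> /fintype.subsetP EG /connectP[s + ->].
elim: s u => [|w s IH] u /=; first by move=> _; apply: chained_refl; exact: full_vertex.
move=> /andP[uw /IH]; apply: chained_trans.
apply: chained_sub (full_trace uw) _.
by apply: edge_chained; rewrite ?inE ?eqxx ?orbT //; exact: EG.
Qed.

Lemma edge_mid e : e \in G -> trace (c e) (c e (1 / 2)).
Proof. by move=> eG; exists (1 / 2) => //; rewrite /= in_itv /=; lra. Qed.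

Lemma edge_inner e t : e \in G -> 0 < t < 1 -> ~ exists v, c e t = p v.
Proof.
move=> eG t01 [v E].
have tI : t \in `[0, 1]%R by rewrite in_itv /=; case/andP: t01 => ? ?; apply/andP; split; lra.
have ve : v \in e by apply/(vertex_on _ eG); rewrite -E; exists t.
have [_ ci] := edge_curve eG.
case: (edge_endP eG ve); rewrite -E => /ci; rewrite tI in_itv /= lexx ler01 => /(_ isT isT);
by move=> tE; move: t01; rewrite tE; lra.
Qed.

Section OneEdge.
Variable e : {set V}.
Hypothesis eG : e \in G.
Let G' := G :\ e.

Let G'G : G' \subset G. Proof. exact: subD1set. Qed.
Let eG' : e \notin G'. Proof. by rewrite !inE eqxx. Qed.
Let GE : full G = full G' `|` trace (c e).
Proof. by rewrite -drawingU1 finset.setD1K. Qed.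

(** An edge meets the rest of the drawing only in its two ends, so it cuts a face into at most
    two. *)
Lemma face_split3 x y z : ~ full G x -> ~ full G y -> ~ full G z ->
  joined (full G') x y -> joined (full G') y z ->
  [\/ joined (full G) x y, joined (full G) y z | joined (full G) x z].
Proof.
move=> Gx Gy Gz xy yz; rewrite GE; have sc := edge_curve eG.
have out w : ~ full G w -> ~ trace (c e) w.
  by apply: contra_not => ew; exact: full_trace eG _ ew.
apply: (@alexander3 _ _ _ (c e 0) (c e 1)) => //.
- exact: drawing_compact.
- exact: compact_trace.
- by move=> w; exact: full_edge.
- by apply: trace_nonsep => //; exact: out.
- by apply: trace_nonsep => //; exact: out.
Qed.

(** The rest of the drawing already links the two ends of [e], so [cycle_separates] applies. *)
Lemma cycle_edge u v : e = [set u; v]%SET -> connect (adj G') u v ->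
  exists x y, [/\ joined (full G') (c e (1 / 2)) x, joined (full G') (c e (1 / 2)) y,
    ~ full G x, ~ full G y & ~ joined (full G) x y].
Proof.
move=> euv uv.
have uvc : chained (full G') (c e 0) (c e 1).
  have [a [b [eab ab -> ->]]] := edge_ends eG.
  apply: connect_chained => //.
  have : connect (adj G') v u by rewrite (sym_connect_sym (@adj_sym G')).
  move: ab; have : a \in e by rewrite eab !inE eqxx.
  have : b \in e by rewrite eab !inE eqxx orbT.
  by rewrite euv !inE => /orP[]/eqP -> /orP[]/eqP -> //; rewrite eqxx.
have [x [y [mx my ex ey xy]]] := cycle_separates (@drawing_compact finset.setT _ G'G)
  (edge_curve eG) (fun w => full_edge G'G eG eG') uvc.
exists x, y; split; rewrite ?GE //.
  by move=> [|//]; have [_] := joined_out mx.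
by move=> [|//]; have [_] := joined_out my.
Qed.

(** Without the bridge the drawing is the disjoint union of the part [K1] of [u] and the rest [K2].
    The edge meets each part in one point, so [alexander] adds the edge to [K1], and then [K2] to
    both. *)
Lemma bridge_edge u v x y : e = [set u; v]%SET -> ~~ connect (adj G') u v ->
  joined (full G') x y -> ~ trace (c e) x -> ~ trace (c e) y -> joined (full G) x y.
Proof.
move=> euv uv xy ex ey.
pose S := [set w | connect (adj G') u w]%SET.
pose E1 := [set f in G' | f \subset S]%SET.
pose E2 := [set f in G' | ~~ (f \subset S)]%SET.
have E1G : E1 \subset G by apply: fintype.subset_trans G'G; apply/fintype.subsetP => f; rewrite inE => /andP[].
have E2G : E2 \subset G by apply: fintype.subset_trans G'G; apply/fintype.subsetP => f; rewrite inE => /andP[].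
have e1 : e \notin E1 by rewrite inE (negbTE eG').
have e2 : e \notin E2 by rewrite inE (negbTE eG').
have disjS f w : f \in G' -> ~~ (f \subset S) -> w \in f -> w \notin S.
  move=> fG' fS wf; apply: contra fS; rewrite inE => uw.
  have [a [b [fab _ _ _]]] := edge_ends (fintype.subsetP G'G f fG').
  have wz z : z \in f -> connect (adj G') w z.
    move: wf; rewrite fab !inE => /orP[]/eqP -> /orP[]/eqP -> //; apply: connect1.
      by rewrite /adj -fab.
    by rewrite adj_sym /adj -fab.
  by apply/fintype.subsetP => z zf; rewrite inE; exact: connect_trans uw (wz z zf).
pose K1 := drawing p c S E1; pose K2 := drawing p c (~: S) E2.
have sub1 : K1 `<=` full G'.
  apply: drawing_sub; first exact: finset.subsetT.
  by apply/fintype.subsetP => f; rewrite inE => /andP[].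
have sub2 : K2 `<=` full G'.
  apply: drawing_sub; first exact: finset.subsetT.
  by apply/fintype.subsetP => f; rewrite inE => /andP[].
have K1e w : K1 w -> trace (c e) w -> w = p u.
  move=> K1w ew; have [z -> [ze zS]] := drawing_edge E1G eG e1 K1w ew.
  have {}zS : z \in S.
    by case: zS => // -[f]; rewrite inE => /andP[_ /fintype.subsetP fS] /fS.
  move: ze zS; rewrite euv !inE => /orP[]/eqP -> //.
  by rewrite (negbTE uv).
have K2e w : K2 w -> trace (c e) w -> w = p v.
  move=> K2w ew; have [z -> [ze zS]] := drawing_edge E2G eG e2 K2w ew.
  have {}zS : z \notin S.
    case: zS => [|[f]]; first by rewrite inE.
    by rewrite inE => /andP[fG' fS]; exact: disjS.
  move: ze zS; rewrite euv !inE => /orP[]/eqP -> //.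
  by rewrite connect0.
have K12 w : K1 w -> K2 w -> False.
  move=> [[z zS <-]|[f + fw]] [[z' z'S]|[f' + f'w]].
  - by move/p_inj => E; move: z'S; rewrite /= inE E => /negP; exact.
  - rewrite /= inE => /andP[f'G' f'S].
    have zf' : z \in f' by apply/(vertex_on _ (fintype.subsetP G'G _ f'G')).
    by have := disjS f' z f'G' f'S zf'; rewrite /= in zS; rewrite zS.
  - rewrite /= inE => /andP[fG' /fintype.subsetP fS] E; move: fw; rewrite -E.
    move/(vertex_on _ (fintype.subsetP G'G _ fG')) => /fS.
    by move: z'S; rewrite /= inE => /negP.
  - rewrite /= inE => /andP[fG' /fintype.subsetP fS]; rewrite inE => /andP[f'G' f'S].
    have ff' : f != f' by apply: contraNneq f'S => <-; exact/fintype.subsetP.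
    have [z [zf zf' _]] := edges_meet (fintype.subsetP G'G f fG')
      (fintype.subsetP G'G f' f'G') ff' fw f'w.
    by have := disjS f' z f'G' f'S zf'; rewrite fS.
have c1 : compact K1 by apply: drawing_compact.
have c2 : compact K2 by apply: drawing_compact.
have ct := compact_trace eG.
have xyT : joined (K1 `|` trace (c e)) x y.
  apply: alexander => //.
  - by move=> w w' w1 w2 w'1 w'2; rewrite (K1e w) // (K1e w').
  - exact: joined_sub sub1 xy.
  - exact: trace_nonsep (edge_curve eG) _ _.
have xyA : joined ((K1 `|` trace (c e)) `|` K2) x y.
  apply: alexander => //; first exact: compactU.
  - have main w : (K1 `|` trace (c e)) w -> K2 w -> w = p v.
      by move=> [K1w|ew] K2w; [case: (K12 w)|exact: K2e].
    by move=> w w' w1 w2 w'1 w'2; rewrite (main w) // (main w').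
  - exact: joined_sub sub2 xy.
apply: joined_sub xyA; rewrite GE => w [[[z _ <-]|[f /= fG' fw]]|ew]; last by left; right.
  have [zS|zS] := boolP (z \in S); first by left; left; left; exists z.
  by right; left; exists z => //=; rewrite inE.
have [fS|fS] := boolP (f \subset S).
  by left; left; right; exists f => //=; rewrite inE fG'.
by right; right; exists f => //=; rewrite inE fG'.
Qed.

End OneEdge.
End Fixed.
End Drawing.

Lemma compact_sphere (R : realType) (z : R * R) r : compact (sphere z r).
Proof.
pose B : set (R * R) := `[z.1 - r, z.1 + r] `*` `[z.2 - r, z.2 + r].
apply: (@subclosed_compact _ _ B).
- have -> : sphere z r = (fun w => `|w - z|) @^-1` [set r] by [].
  apply: preimage_closed; last exact: closed_eq.
  move=> w _; apply: cvg_norm; apply: cvgB; [exact: cvg_id|exact: cvg_cst].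
- by apply: compact_setX; exact: segment_compact.
move=> w wr; have : `|w - z| <= r by rewrite wr.
by rewrite norm_pt_le !ler_distl /B /= !in_itv /= => /andP[].
Qed.

(** * Faces near vertices and along edges *)

Section Faces.
Variables (R : realType) (V : finType).
Local Notation pt := (R * R)%type.
Variables (G : {set {set V}}) (p : V -> pt) (c : {set V} -> R -> pt).
Hypothesis Gpc : plane_graph G p c.

Local Notation full E := (drawing p c finset.setT E).

Lemma subarc_rev (s : R -> pt) (t : R) : subarc (rev_curve s) 0 (1 - t) = subarc s t 1.
Proof.
apply/seteqP; split=> w [u /=]; rewrite in_itv /= => /andP[? ?] <-.
  by exists (1 - u) => //=; rewrite in_itv /=; apply/andP; split; lra.
exists (1 - u); first by rewrite /= in_itv /=; apply/andP; split; lra.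
by rewrite /rev_curve opprB addrC subrK.
Qed.

Lemma edge2 e u v : e \in G -> u \in e -> v \in e -> u != v -> e = [set u; v]%SET.
Proof.
move=> eG ue ve uv; case: Gpc => sG _; apply/eqP; rewrite eq_sym eqEcard.
rewrite (sG e eG) cards2 uv leqnn andbT.
by apply/fintype.subsetP => z; rewrite !inE => /orP[]/eqP ->.
Qed.

Lemma edge_common e f u v : e \in G -> f \in G -> e != f ->
  u \in e -> u \in f -> v \in e -> v \in f -> u = v.
Proof.
move=> eG fG ef ue uf ve vf; apply/eqP; apply: contraNT ef => uv.
by rewrite (edge2 eG ue ve uv) (edge2 fG uf vf uv).
Qed.

(** The initial parts of the edges at [v] form a star inside the disc. The sphere, the other
    vertices and edges, and the remaining parts of the edges at [v] form a compact set that misses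
    [p v], so [star_cover] applies. *)
Lemma locally_finite_full v : locally_finite (full G) (p v).
Proof.
move=> r r0.
pose es := enum [set e in G | v \in e]%SET.
have esP e : e \in es -> e \in G /\ v \in e.
  by rewrite mem_enum inE => /andP[].
(* Each edge at [v] is oriented away from [v]. *)
pose sigma e := if c e 0 == p v then c e else rev_curve (c e).
have sT e : trace (sigma e) = trace (c e).
  by rewrite /sigma; case: ifP => // _; rewrite trace_rev.
have s0 e : e \in es -> sigma e 0 = p v.
  move=> /esP[eG ve]; rewrite /sigma; case: eqP => // ne.
  by rewrite /rev_curve subr0; case: (edge_endP Gpc eG ve) => E //; rewrite E in ne.
have ssimple e : e \in es -> simple_curve (sigma e).
  move=> /esP[eG _]; have := edge_curve Gpc eG; rewrite /sigma; case: ifP => // _.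
  exact: simple_rev.
have sinj e s t : e \in es -> sigma e s = sigma e t -> 0 <= s <= 1 -> 0 <= t <= 1 -> s = t.
  move=> ees E s01 t01; have [_ ci] := ssimple e ees.
  by apply: ci; rewrite ?in_itv.
have [tau tauP] : exists tau : {set V} -> R, forall e, e \in es -> 0 < tau e < 1 /\
    forall w, subarc (sigma e) 0 (tau e) w -> `|w - p v| < r.
  suff /choice[tau tauP] : forall e, exists t, e \in es -> 0 < t < 1 /\
    forall w, subarc (sigma e) 0 t w -> `|w - p v| < r by exists tau.
  move=> e; have [ees|?] := boolP (e \in es); last by exists 0.
  have [cc _] := ssimple e ees; have [d d0 dP] := curve_uniform cc r0.
  pose t := Num.min (d / 2) (1 / 2).
  have [td th] : t <= d / 2 /\ t <= 1 / 2 by split; rewrite ge_min lexx // orbT.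
  have t0 : 0 < t by rewrite lt_min; apply/andP; split; lra.
  exists t => _; split; first by apply/andP; split; lra.
  move=> w [u /=]; rewrite in_itv /= => /andP[? ?] <-; rewrite -(s0 e ees).
  apply: dP; first by apply/andP; split; lra.
    by rewrite lexx ler01.
  by rewrite subr0 ger0_norm; lra.
pose E1 := [set e in G | v \notin e]%SET.
have E1G : E1 \subset G by apply/fintype.subsetP => e; rewrite inE => /andP[].
(* The outer parts of these edges, written as a star of reversed arcs so that [star_compact] covers
   them. *)
pose rest := star (fun e => rev_curve (sigma e)) (fun e => 1 - tau e) es.
pose K1 := sphere (p v) r `|` drawing p c (~: [set v]%SET) E1 `|` rest.
have restP w : rest w -> exists2 e, e \in es & exists2 s, tau e <= s <= 1 & sigma e s = w.
  move=> [e ees]; rewrite subarc_rev => -[s /=]; rewrite in_itv /= => s1 E.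
  by exists e => //; exists s.
have csphere := @compact_sphere _ (p v) r.
have cK1 : compact K1.
  apply: compactU; first apply: compactU => //; first exact: (drawing_compact Gpc).
  apply: star_compact => e ees; split; first exact: simple_rev (ssimple e ees).
  by have [/andP[? ?] _] := tauP e ees; apply/andP; split; lra.
have K1p : ~ K1 (p v).
  move=> [[|[[z /= zv]|[f /=]]]|/restP[e ees [s /andP[s1 s2] E]]].
  - by rewrite /sphere /= subrr normr0 => E; move: r0; rewrite E ltxx.
  - by move/(p_inj Gpc) => E; move: zv; rewrite E !inE eqxx.
  - by rewrite inE => /andP[fG vf] /(vertex_on Gpc v fG); rewrite (negbTE vf).
  - have [/andP[? ?] _] := tauP e ees; rewrite -(s0 e ees) in E.
    by have := sinj e s 0 ees E; lra.
have meetv e f w : e \in es -> f \in es -> e != f -> trace (sigma e) w ->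
    trace (sigma f) w -> w = p v.
  move=> /esP[eG ve] /esP[fG vf] ef; rewrite !sT => ew fw.
  have [z [ze zf ->]] := edges_meet Gpc eG fG ef ew fw.
  by rewrite (edge_common eG fG ef ze zf ve vf).
have subT e w : e \in es -> subarc (sigma e) 0 (tau e) w -> trace (sigma e) w.
  by move=> ees; apply: subarc_trace => //; have [/andP[_ /ltW]] := tauP e ees.
have [|e w ees|e f w ees fes ef /(subT _ _ ees) ? /(subT _ _ fes) ?|r1 r10 [L HL]] :=
  @star_cover R {set V} sigma tau K1 (p v) cK1 K1p es (enum_uniq _).
- move=> e ees; split; first exact: ssimple.
  by have [/andP[? ?] _] := tauP e ees; apply/andP; split; lra.
- have [/andP[t0 t1] tr] := tauP e ees; have [eG ve] := esP e ees.
  move=> K1w sw; have ew := subT e w ees sw.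
  case: K1w => [[wr|Dw]|/restP[f fes [s /andP[s1 s2] E]]].
  + by have := tr w sw; rewrite wr ltxx.
  + exfalso; rewrite sT in ew.
    have e1 : e \notin E1 by rewrite inE ve andbF.
    have [z wz [ze zS]] := drawing_edge Gpc E1G eG e1 Dw ew.
    have zv : z != v.
      case: zS => [|[f]]; first by rewrite !inE.
      by rewrite inE => /andP[fG vf] zf; apply: contraNneq vf => <-.
    have E1' : sigma e 1 = p z.
      have := s0 e ees; rewrite /sigma; case: (edge_endP Gpc eG ze) => Ez.
        case: eqP => [E0 _|_]; last by rewrite /rev_curve subrr.
        by case/eqP: zv; apply: (p_inj Gpc); rewrite Ez E0.
      case: eqP => [//|_]; rewrite /rev_curve subr0 -Ez => /(p_inj Gpc) E0.
      by rewrite E0 eqxx in zv.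
    move: sw => [s /=]; rewrite in_itv /= => /andP[s1 s2].
    by rewrite wz -E1' => /(sinj e s 1 ees); lra.
  + have [/andP[f0 f1] _] := tauP f fes.
    have fw : subarc (sigma f) (tau f) 1 w by exists s; rewrite //= in_itv /= s1.
    have [ef|ef] := eqVneq e f.
      by apply: (subarc_inter (ssimple e ees) (lexx 0) (lexx 1)) sw _; rewrite ?ef //; apply/andP; split; lra.
    have fT : trace (sigma f) w by apply: subarc_trace fw; lra.
    have wv := meetv e f w ees fes ef ew fT.
    by exfalso; rewrite wv -(s0 f fes) in E; have := sinj f s 0 fes E; lra.
- exact: (meetv e f).
have [r2 r20 K1r2] := compact_far cK1 K1p.
exists (Num.min r1 r2); first by rewrite lt_min r10.
exists L => y; rewrite lt_min => /andP[yr1 yr2] Gy.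
have [|z zL zy] := HL y yr1.
  move=> [[K1y|yv]|[e ees ey]].
  - by apply: K1r2; exists y => //; rewrite distrC.
  - by apply: Gy; rewrite yv; exact: full_vertex.
  - have [eG _] := esP e ees; apply: Gy; apply: (full_trace p eG).
    by rewrite -sT; exact: subT ey.
exists z => //; apply: joined_sub zy => w [[[u _ <-]|[e /= eG ew]]|wr]; last by left; left; left; left.
  have [->|uv] := eqVneq u v; first by left; right.
  by left; left; left; right; left; exists u => //=; rewrite !inE.
have [ve|ve] := boolP (v \in e); last first.
  by left; left; left; right; right; exists e => //=; rewrite inE eG.
have ees : e \in es by rewrite mem_enum inE eG.
have [/andP[t0 t1] _] := tauP e ees.
move: ew; rewrite -sT /trace -/(subarc (sigma e) 0 1) (subarc_split _ (ltW t0) (ltW t1)).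
by case=> ew; [right; exists e|left; left; right; exists e; rewrite ?subarc_rev].
Qed.

Lemma touch_edge e x w w' : e \in G -> trace (c e) w -> ~ (exists v, w = p v) ->
  touches (full G) x w -> trace (c e) w' -> touches (full G) x w'.
Proof.
move=> eG [t /=]; rewrite in_itv /= => /andP[t0 t1] <- nv.
have eG' : e \notin G :\ e by rewrite !inE eqxx.
have G'G : G :\ e \subset G by exact: subD1set.
have -> : full G = full (G :\ e) `|` trace (c e).
  by rewrite -drawingU1 finset.setD1K.
have cG' := @drawing_compact _ _ _ _ _ Gpc finset.setT _ G'G.
apply: (touch_arc cG' (edge_curve Gpc eG)); first by move=> u; exact: (full_edge Gpc).
have [u [v [_ _ c0 c1]]] := edge_ends Gpc eG.
rewrite !lt_neqAle t0 t1 !andbT; apply/andP; split; apply/eqP => E; apply: nv.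
  by exists u; rewrite -E.
by exists v; rewrite E.
Qed.

(** The midpoint stands for the whole edge, by [touch_edge]. *)
Definition touches_edge x e := touches (full G) x (c e (1 / 2)).

Lemma touches_edge_vertex x e v : e \in G -> v \in e -> touches_edge x e ->
  touches (full G) x (p v).
Proof.
move=> eG ve te; apply: (touch_edge eG (edge_mid c eG) _ te).
  by apply: (edge_inner Gpc eG); apply/andP; split; lra.
exact/(vertex_on Gpc v eG).
Qed.

(** A path leaving the face would make its first contact at a touched vertex or edge, and all of
    these belong to the smaller drawing. So the face of [x] is also a face of the smaller
    drawing. *)
Lemma face_boundary (S : {set V}) (E : {set {set V}}) x y : E \subset G ->
  ~ full G x -> (forall e, e \in G -> e \notin E -> ~ touches_edge x e) ->
  (forall v, v \notin S -> ~ touches (full G) x (p v)) ->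
  joined (drawing p c S E) x y -> joined (full G) x y.
Proof.
move=> EG Gx nE nS xy.
have sub : drawing p c S E `<=` full G.
  by apply: drawing_sub => //; exact: finset.subsetT.
have EU : drawing p c S E `|` full G = full G by apply/setUidPr.
have [|[w [Gw Ew tw]]] := first_hit (drawing_compact Gpc (S := finset.setT) (fintype.subxx G)) xy Gx.
  by rewrite EU.
rewrite EU in tw; exfalso.
have nv : ~ exists v, w = p v.
  move=> [v wv]; rewrite wv in Ew tw.
  have [vS|/nS//] := boolP (v \in S); by apply: Ew; left; exists v.
case: (fullP Gw) => // -[e eG ew].
have [eE|eE] := boolP (e \in E); first by apply: Ew; right; exists e.
by apply: (nE e eG eE); apply: (touch_edge eG ew nv tw); exact: edge_mid.
Qed.

(** Both the saturation of a subgraph and the maximality of a planar graph are exploited through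
    this lemma. *)
Lemma touched_addable x u v : touches (full G) x (p u) -> touches (full G) x (p v) ->
  u != v -> [set u; v]%SET \notin G -> addable G p c [set u; v]%SET.
Proof.
move=> tu tv uv uvG.
have puv : p u <> p v by move/(p_inj Gpc)/eqP; apply/negP.
have [g [sg g0 g1 gK]] := access_arc puv (@locally_finite_full u) (@locally_finite_full v) tu tv.
exists g; set e := [set u; v]%SET in uvG *.
have gT w : trace g w -> ~ full G w \/ exists2 z, z \in e & w = p z.
  move=> [t /=]; rewrite in_itv /= => /gK [xt|->|->] <-; first by left; have [] := joined_out xt.
    by right; exists u => //; rewrite !inE eqxx.
  by right; exists v => //; rewrite !inE eqxx orbT.
have [sG [pinj ends vtx edg]] := Gpc.
have gf f w : f \in G -> trace g w -> trace (c f) w -> exists z, [/\ z \in e, z \in f & w = p z].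
  move=> fG /gT [nw fw|[z ze ->] fz]; first by case: nw; exact: (full_trace p fG).
  by exists z; split=> //; apply/(vertex_on Gpc z fG).
split; first by move=> f; rewrite !inE => /orP[/eqP ->|/sG //]; rewrite cards2 uv.
split=> //.
- move=> f; rewrite !inE => /orP[/eqP ->|fG].
    rewrite eqxx; split=> //; rewrite g0 g1.
    apply/seteqP; split=> w.
      by move=> [->|->]; [exists u|exists v]; rewrite //= !inE eqxx ?orbT.
    by move=> [z /= + <-]; rewrite !inE => /orP[]/eqP ->; [left|right].
  have -> : (f == e) = false by apply: contraNF uvG => /eqP <-.
  exact: ends.
- move=> f z; rewrite !inE => /orP[/eqP ->|fG].
    rewrite eqxx => /gT [nz|[z' z'e /pinj ->] //].
    by case: nz; exact: full_vertex.
  have -> : (f == e) = false by apply: contraNF uvG => /eqP <-.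
  exact: vtx.
move=> f f'; rewrite !inE => /orP[/eqP ->|fG] /orP[/eqP ->|f'G]; first by rewrite eqxx.
- have -> : (f' == e) = false by apply: contraNF uvG => /eqP <-.
  rewrite eqxx => _ w [gw fw]; have [z [ze zf ->]] := gf f' w f'G gw fw.
  by exists z; rewrite //= inE ze.
- have -> : (f == e) = false by apply: contraNF uvG => /eqP <-.
  rewrite eqxx => _ w [fw gw]; have [z [ze zf ->]] := gf f w fG gw fw.
  by exists z; rewrite //= inE ze zf.
have -> : (f == e) = false by apply: contraNF uvG => /eqP <-.
have -> : (f' == e) = false by apply: contraNF uvG => /eqP <-.
exact: edg.
Qed.

End Faces.

(** * Components of a graph when an edge is removed *)

Section Components.
Variable V : finType.
Implicit Types E : {set {set V}}.

Definition comp_of E (u : V) : {set V} := [set w | connect (adj E) u w]%SET.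

Definition ncomp E : nat := #|(comp_of E @: finset.setT)%SET|.

Lemma adj_connect_sym E : connect_sym (adj E).
Proof. exact: sym_connect_sym (@adj_sym _ E). Qed.

Lemma comp_ofP E u v : (comp_of E u == comp_of E v) = connect (adj E) u v.
Proof.
apply/eqP/idP => [uv|uv].
  have : v \in comp_of E u by rewrite uv inE connect0.
  by rewrite inE.
by apply/setP => w; rewrite !inE; apply: same_connect => //; exact: adj_connect_sym.
Qed.

Lemma ncomp0 : ncomp finset.set0 = #|V|.
Proof.
rewrite /ncomp card_imset ?cardsT// => u v /eqP; rewrite comp_ofP => /connectP[[|w s] /=].
  by move=> _ ->.
by rewrite /adj inE.
Qed.

Lemma connect_D1 E u v (e : {set V}) : e = [set u; v]%SET -> forall a b,
  connect (adj E) a b -> connect (adj (E :\ e)) a b \/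
  (connect (adj (E :\ e)) a u \/ connect (adj (E :\ e)) a v) /\
  (connect (adj (E :\ e)) u b \/ connect (adj (E :\ e)) v b).
Proof.
move=> -> a b /connectP[s + ->]; elim: s a => [|w s IH] a /=; first by left.
set E' := E :\ _ in IH *.
move=> /andP[aw /IH {}IH]; have [awE|awE] := eqVneq [set a; w]%SET [set u; v]%SET.
  have : a \in [set u; v]%SET by rewrite -awE !inE eqxx.
  have : w \in [set u; v]%SET by rewrite -awE !inE eqxx orbT.
  rewrite !inE => wuv auv; right; split.
    by case/orP: auv => /eqP ->; [left|right].
  case: IH => [|[_ ?]] //.
  by case/orP: wuv => /eqP ->; [left|right].
have aw' : connect (adj E') a w by apply: connect1; rewrite /adj !inE awE.
case: IH => [wb|[wuv uvb]]; first by left; exact: connect_trans wb.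
right; split=> //.
by case: wuv => ?; [left|right]; exact: connect_trans aw' _.
Qed.

Lemma connect_sub_graph E E' a b : E \subset E' ->
  connect (adj E) a b -> connect (adj E') a b.
Proof.
move=> /fintype.subsetP EE'; apply: connect_sub => x y xy; apply: connect1.
exact: EE'.
Qed.

Lemma ncomp_cycle E (e : {set V}) u v : e = [set u; v]%SET ->
  connect (adj (E :\ e)) u v -> ncomp E = ncomp (E :\ e).
Proof.
move=> euv uv; rewrite /ncomp; congr #|(_ : {set {set V}})|.
apply: eq_imset => w; apply/setP => z; rewrite !inE; apply/idP/idP; last first.
  by apply: connect_sub_graph; exact: subD1set.
case/(connect_D1 euv) => [//|[wuv uvz]].
have vu : connect (adj (E :\ e)) v u by rewrite adj_connect_sym.
have wu : connect (adj (E :\ e)) w u by case: wuv => // wv; exact: connect_trans wv vu.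
apply: connect_trans wu _; case: uvz => // vz; exact: connect_trans uv vz.
Qed.

(** The bridge merges the components [Cu] and [Cv] into one and leaves the others alone ([PE]). *)
Lemma ncomp_bridge E (e : {set V}) u v : e \in E -> e = [set u; v]%SET ->
  ~~ connect (adj (E :\ e)) u v -> (ncomp E).+1 = ncomp (E :\ e).
Proof.
move=> eE euv uv; set E' := E :\ e in uv *.
pose Cu := comp_of E' u; pose Cv := comp_of E' v.
pose P' := (comp_of E' @: finset.setT)%SET.
have inP' w : comp_of E' w \in P' by apply: imset_f; rewrite inE.
have CuvP : (Cu :|: Cv)%SET \notin P'.
  apply/negP => /imsetP[w _ Ew].
  have wu : connect (adj E') w u.
    have uC : u \in (Cu :|: Cv)%SET by rewrite !inE connect0.
    by move: uC; rewrite Ew inE.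
  have wv : connect (adj E') w v.
    have vC : v \in (Cu :|: Cv)%SET by rewrite !inE connect0 orbT.
    by move: vC; rewrite Ew inE.
  by case/negP: uv; apply: connect_trans wv; rewrite adj_connect_sym.
have uvE : connect (adj E) u v by apply: connect1; rewrite /adj -euv.
have E'E : E' \subset E by exact: subD1set.
have connE w z : connect (adj E) w z =
    (connect (adj E') w z || ((w \in (Cu :|: Cv)%SET) && (z \in (Cu :|: Cv)%SET))).
  rewrite !inE; apply/idP/idP.
    case/(connect_D1 euv) => [->//|[wuv uvz]]; apply/orP; right.
    rewrite ![connect _ _ w]adj_connect_sym.
    by case: wuv => ->; case: uvz => ->; rewrite ?orbT.
  have toE a b := @connect_sub_graph E' E a b E'E.
  have uE a : connect (adj E') u a || connect (adj E') v a -> connect (adj E) u a.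
    by move=> /orP[/toE //|/toE]; exact: connect_trans.
  case/orP => [/toE //|/andP[/uE uw /uE uz]].
  by apply: connect_trans uz; rewrite adj_connect_sym.
have PE : (comp_of E @: finset.setT)%SET = ((Cu :|: Cv) |: (P' :\ Cu :\ Cv))%SET.
  have old w : w \notin (Cu :|: Cv)%SET -> comp_of E w = comp_of E' w.
    move=> wuv; apply/setP => z; rewrite inE connE (negbTE wuv) andFb orbF.
    by rewrite [RHS]inE.
  have new w : w \in (Cu :|: Cv)%SET -> comp_of E w = (Cu :|: Cv)%SET.
    move=> wuv; apply/setP => z; rewrite inE connE wuv andTb orb_idl // => wz.
    move: wuv; rewrite !inE => /orP[] H; apply/orP; [left|right];
    exact: connect_trans H wz.
  have out w : (comp_of E' w == Cu) || (comp_of E' w == Cv) = (w \in (Cu :|: Cv)%SET).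
    by rewrite !comp_ofP !inE ![connect _ w _]adj_connect_sym.
  apply/setP => C; rewrite !inE; apply/imsetP/idP.
    move=> [w _ ->]; have [wuv|wuv] := boolP (w \in (Cu :|: Cv)%SET).
      by rewrite new // eqxx.
    by rewrite old // inP' andbT; move: wuv; rewrite -out negb_or => /andP[-> ->]; rewrite orbT.
  case/orP => [/eqP ->|/and3P[nv nu /imsetP[w _ EC]]].
    by exists u; rewrite // new // !inE connect0.
  by exists w => //; rewrite old // -out -EC (negbTE nv) (negbTE nu).
rewrite /ncomp PE cardsU1.
have -> : (Cu :|: Cv)%SET \notin (P' :\ Cu :\ Cv)%SET.
  by rewrite !inE !negb_and CuvP !orbT.
rewrite add1n -/P' (cardsD1 Cu P') inP' (cardsD1 Cv (P' :\ Cu)) !inE inP' andbT.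
by rewrite eq_sym comp_ofP uv.
Qed.

(** Every vertex on no edge is a component of its own, and there is at least one further component,
    which contains an edge. *)
Lemma ncomp_ge E : E != finset.set0 -> (forall e, e \in E -> e != finset.set0) ->
  (#|V| < ncomp E + #|finset.cover E|)%N.
Proof.
move=> /set0Pn[e eE] nz; have /set0Pn[u ue] := nz e eE.
have uS : u \in finset.cover E by apply/finset.bigcupP; exists e.
have single w : w \notin finset.cover E -> comp_of E w = [set w]%SET.
  move=> wS; apply/setP => z; rewrite !inE; apply/idP/eqP => [|-> //].
  case/connectP => [[|y s] /=]; first by move=> _ ->.
  move=> /andP[wy _] _; case/negP: wS; apply/finset.bigcupP; exists [set w; y]%SET => //.
  by rewrite !inE eqxx.
pose Q := (comp_of E u |: [set [set w]%SET | w in ~: finset.cover E])%SET.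
have QP : Q \subset (comp_of E @: finset.setT)%SET.
  apply/fintype.subsetP => C; rewrite !inE => /orP[/eqP ->|/imsetP[w + ->]].
    by apply: imset_f; rewrite inE.
  by rewrite inE => /single <-; apply: imset_f; rewrite inE.
have := subset_leq_card QP; rewrite -/(ncomp E) cardsU1 card_imset; last exact: set1_inj.
have -> : comp_of E u \notin [set [set w]%SET | w in ~: finset.cover E]%SET.
  apply/negP => /imsetP[w]; rewrite inE => wS Ew; case/negP: wS.
  have : u \in comp_of E u by rewrite inE connect0.
  by rewrite Ew inE => /eqP <-.
by rewrite cardsCs finset.setCK; have := max_card (mem (finset.cover E)); lia.
Qed.

(* The leafy graphs are the forests. *)
Definition leafy E := forall E', E' \subset E -> E' != finset.set0 ->
  exists2 e, e \in E' & exists2 v, v \in e & forall f, f \in E' -> f != e -> v \notin f.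

(** The edge at a leaf is a bridge: removing it raises the number of components by one, and what is
    left is still leafy. *)
Lemma leafy_ncomp E : (forall e, e \in E -> #|e| = 2%N) -> leafy E ->
  (ncomp E + #|E| = #|V|)%N.
Proof.
have [n] := ubnP #|E|; elim: n E => // n IH E En E2 leaf.
have [->|E0] := eqVneq E finset.set0; first by rewrite ncomp0 cards0 addn0.
have [e eE [v ve vE]] := leaf E (fintype.subxx E) E0.
have D1 : E :\ e \subset E by exact: subD1set.
have [u uv euv] : exists2 u, u != v & e = [set u; v]%SET.
  have /eqP/cards2P[a [b [ab eab]]] := E2 e eE.
  move: ve; rewrite eab !inE => /orP[]/eqP ->; [exists b|exists a] => //.
    by rewrite eq_sym.
  by rewrite finset.setUC.
have nc : ~~ connect (adj (E :\ e)) u v.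
  rewrite adj_connect_sym; apply/negP => /connectP[[|w s] /=].
    by move=> _ E'; rewrite E' eqxx in uv.
  move=> /andP[+ _] _; rewrite /adj !inE => /andP[ne vwE].
  by have := vE _ vwE ne; rewrite !inE eqxx.
have Ecard : #|E| = #|E :\ e|.+1 by rewrite (cardsD1 e E) eE.
rewrite Ecard addnS -addSn (ncomp_bridge eE euv nc); apply: IH.
- by rewrite Ecard in En.
- by move=> f /(fintype.subsetP D1); exact: E2.
- by move=> E' E'D; apply: leaf; exact: fintype.subset_trans D1.
Qed.

End Components.

(** * Euler's formula for plane drawings *)

Section Euler.
Variables (R : realType) (V : finType).
Local Notation pt := (R * R)%type.
Implicit Types (K : set pt) (G E : {set {set V}}) (p : V -> pt) (c : {set V} -> R -> pt).

Local Notation full p c E := (drawing p c finset.setT E).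

Definition face_reps K (s : seq pt) := [/\ uniq s, forall x, x \in s -> ~ K x,
  forall x y, x \in s -> y \in s -> joined K x y -> x = y
  & forall y, ~ K y -> exists2 x, x \in s & joined K x y].

Lemma points_nonsep (s : seq pt) x y : x \notin s -> y \notin s -> joined [set` s] x y.
Proof.
elim: s => [_ _|z s IH].
  by apply: joined_sub (joined0 x y) => w.
rewrite !inE !negb_or => /andP[xz xs] /andP[yz ys].
have [zs|zs] := boolP (z \in s).
  by apply: joined_sub (IH xs ys) => w /=; rewrite inE => /orP[/eqP ->|].
apply: (@joined_sub _ _ ([set` s] `|` [set z])).
  by move=> w /=; rewrite inE => /orP[/eqP ->|ws]; [right|left].
apply: alexander => //.
- by apply: finite_compact; exact: finite_seq.
- exact: compact_set1.
- by move=> w w' ws wz; move: ws; rewrite wz /= (negbTE zs).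
- exact: IH.
- apply: (@joined_around _ _ z 0); rewrite ?normr_gt0 ?subr_eq0 //.
  by move=> w ->; rewrite subrr normr0.
Qed.

Section Fixed.
Variables (G : {set {set V}}) (p : V -> pt) (c : {set V} -> R -> pt).
Hypothesis Gpc : plane_graph G p c.

Lemma full_empty_interior w r : 0 < r -> exists2 y, `|y - w| < r & ~ full p c G y.
Proof.
move=> r0.
have [y yw yE] : exists2 y, `|y - w| < r & forall e, e \in enum G -> ~ trace (c e) y.
  have : {subset enum G <= G} by move=> e; rewrite mem_enum.
  elim: (enum G) => [_|e es IH sub]; first by exists w; rewrite ?subrr ?normr0.
  have [|y yw yE] := IH; first by move=> f fes; apply: sub; rewrite inE fes orbT.
  pose A := [set z | exists2 f, f \in es & trace (c f) z].
  have cA : compact A.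
    have -> : A = \bigcup_(f in [set` es]) trace (c f).
      by apply/seteqP; split=> z [f fes fz]; exists f.
    rewrite bigcup_seq big_seq_cond; apply: bigsetU_compact => f /andP[fes _].
    by apply: (compact_trace Gpc); apply: sub; rewrite inE fes orbT.
  have Ay : ~ A y by move=> [f /yE].
  have [d d0 Ad] := compact_far cA Ay.
  have eG : e \in G by apply: sub; exact: mem_head.
  have m0 : 0 < Num.min d (r - `|y - w|) by rewrite lt_min d0 subr_gt0.
  have [z + ez] := trace_empty_interior y (edge_curve Gpc eG) m0.
  rewrite lt_min => /andP[zd zr]; exists z.
    by have := ler_distD y z w; lra.
  move=> f; rewrite inE => /orP[/eqP -> //|fes] fz; apply: Ad; exists z; first by exists f.
  by rewrite distrC.
pose A := \bigcup_(e in [set` G]) trace (c e).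
have cA : compact A.
  have := @drawing_compact _ _ _ _ _ Gpc finset.set0 G (fintype.subxx G).
  by rewrite /drawing (_ : p @` _ = set0) ?set0U //; apply/seteqP; split=> // z [v /=]; rewrite inE.
have Ay : ~ A y by move=> [e /= eG]; apply: yE; rewrite mem_enum.
have [d d0 Ad] := compact_far cA Ay.
pose m := Num.min d (r - `|y - w|).
have m0 : 0 < m by rewrite lt_min d0 subr_gt0.
have [md mr] : m <= d /\ m <= r - `|y - w| by split; rewrite ge_min lexx // orbT.
(* Infinitely many points close to [y] and off all edges; the finitely many vertices cannot occupy
   all of them. *)
pose q k : pt := (y.1 + m / (k.+2)%:R, y.2).
have qk k : `|q k - y| < m.
  rewrite norm_ptE /= subrr normr0 addrC addKr max_l //.
  rewrite ger0_norm ?divr_ge0 ?ler0n ?(ltW m0)//.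
  by rewrite ltr_pdivrMr ?ltr0n// ltr_pMr// ltr1n.
have qinj : injective q.
  move=> k l [] /addrI /(mulfI (lt0r_neq0 m0)) /invr_inj /eqP.
  by rewrite eqr_nat => /eqP[].
have [k kp] : exists k : nat, q k \notin codom p.
  apply: contrapT => none.
  have sub : {subset [seq q k | k <- iota 0 #|V|.+1] <= codom p}.
    move=> z /mapP[k _ ->]; apply: contrapT => /negP kp; apply: none.
    by exists k.
  have := uniq_leq_size _ sub; rewrite map_inj_uniq // iota_uniq => /(_ isT).
  by rewrite size_map size_codom size_iota ltnn.
exists (q k).
  have := ler_distD y (q k) w; have := qk k; lra.
move=> [[v _ E]|Aq].
  by case/negP: kp; rewrite -E codom_f.
apply: Ad; exists (q k) => //; rewrite distrC.
exact: lt_le_trans (qk k) md.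
Qed.

Section OneEdge.
Variable e : {set V}.
Hypothesis eG : e \in G.
Let G' := G :\ e.
Let mid := c e (1 / 2).
Let G'G : G' \subset G. Proof. exact: subD1set. Qed.
Let eG' : e \notin G'. Proof. by rewrite !inE eqxx. Qed.
Let GE : full p c G = full p c G' `|` trace (c e).
Proof. by rewrite -drawingU1 finset.setD1K. Qed.
Let cG' := @drawing_compact _ _ _ _ _ Gpc finset.setT _ G'G.

Lemma interior_joined w : trace (c e) w -> ~ full p c G' w -> joined (full p c G') mid w.
Proof.
move=> [t /=]; rewrite in_itv /= => /andP[t0 t1] <- Gt.
have [cc ci] := edge_curve Gpc eG.
have cinj a b : c e a = c e b -> 0 <= a <= 1 -> 0 <= b <= 1 -> a = b.
  by move=> E a01 b01; apply: ci; rewrite ?inE ?in_itv.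
have {}t0 : 0 < t.
  rewrite lt_neqAle t0 andbT; apply/eqP => E; apply: Gt; rewrite -E.
  by have [v _ ->] := edge_end0 Gpc eG; exact: full_vertex.
have {}t1 : t < 1.
  rewrite lt_neqAle t1 andbT; apply/eqP => E; apply: Gt; rewrite E.
  by have [v _ ->] := edge_end1 Gpc eG; exact: full_vertex.
have half (a b : R) : 0 < a -> a <= b -> b < 1 -> joined (full p c G') (c e a) (c e b).
  move=> a0 ab b1; apply: (joined_chained cG' (A := subarc (c e) a b)).
  - by apply: compact_subarc => //; lra.
  - move=> z [u /=]; rewrite in_itv /= => /andP[? ?] <- Gu.
    have eu : trace (c e) (c e u) by exists u; rewrite //= in_itv /=; apply/andP; split; lra.
    by case: (full_edge Gpc G'G eG eG' Gu eu) => /cinj H; exfalso; lra.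
  - by apply: subarc_chained => //; lra.
by have [th|th] := leP t (1 / 2); [apply: joined_sym|]; apply: half; lra.
Qed.

(** The inner points of [e] all lie in one face of the smaller drawing, that of [mid], so the other
    faces never meet [e]. *)
Lemma other_face x y : ~ joined (full p c G') x mid -> joined (full p c G') x y ->
  joined (full p c G) x y.
Proof.
have noton z : ~ joined (full p c G') x mid -> joined (full p c G') x z -> ~ trace (c e) z.
  move=> xm xz ez; have [_ Gz] := joined_out xz; apply: xm.
  by apply: joined_trans xz _; apply: joined_sym; exact: interior_joined.
move=> xm; elim=> [G'x|u v xu xu' uv].
  apply: joined_refl; rewrite GE => -[//|]; apply: noton => //; exact: joined_refl.
apply: joined_step xu' _ => w; rewrite GE => -[/uv //|ew bw].
apply: (noton w) => //; apply: (joined_step xu) => z Gz zb.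
by apply: (uv z Gz); apply: box_sub zb => //; exact: box_l.
Qed.

Lemma mid_out : ~ full p c G' mid.
Proof.
move=> Gm; have eu : trace (c e) mid by exact: edge_mid.
have [_ ci] := edge_curve Gpc eG.
have cinj a b : c e a = c e b -> 0 <= a <= 1 -> 0 <= b <= 1 -> a = b.
  by move=> E a01 b01; apply: ci; rewrite ?inE ?in_itv.
by case: (full_edge Gpc G'G eG eG' Gm eu) => /cinj H; exfalso; lra.
Qed.

(** Adding [e] affects only the face that contains its midpoint, whose representative [z0] gives way
    to [new]. *)
Lemma reps_add_edge s z0 (new : seq pt) : face_reps (full p c G') s ->
  z0 \in s -> joined (full p c G') z0 mid -> uniq new ->
  (forall x, x \in new -> joined (full p c G') mid x /\ ~ full p c G x) ->
  (forall x y, x \in new -> y \in new -> joined (full p c G) x y -> x = y) ->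
  (forall y, joined (full p c G') mid y -> ~ full p c G y ->
     exists2 x, x \in new & joined (full p c G) x y) ->
  face_reps (full p c G) (new ++ rem z0 s).
Proof.
move=> [us sG sJ sE] z0s z0m unew newP newJ newE.
have remP x : x \in rem z0 s -> x \in s /\ ~ joined (full p c G') x mid.
  rewrite mem_rem_uniq // !inE => /andP[xz xs]; split=> // xm.
  by case/eqP: xz; apply: (sJ) => //; apply: joined_trans xm (joined_sym z0m).
have sub : full p c G' `<=` full p c G by rewrite GE => w; left.
have xm x : x \in s -> ~ joined (full p c G') x mid -> ~ full p c G x.
  move=> xs xm; have G'x := sG x xs.
  by have [] := joined_out (other_face xm (joined_refl G'x)).
split.
- rewrite cat_uniq unew rem_uniq // andbT /=; apply/hasPn => x /remP[xs nm].
  by apply/negP => /newP [/joined_sym].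
- by move=> x; rewrite mem_cat => /orP[/newP[]//|/remP[]]; exact: xm.
- move=> x y; rewrite !mem_cat => /orP[xn|/remP[xs xm']] /orP[yn|/remP[ys ym]] xy.
  + exact: newJ.
  + case: ym; have [mx _] := newP x xn.
    apply: joined_sym; apply: joined_trans mx _; exact: joined_sub sub xy.
  + case: xm'; have [my _] := newP y yn.
    apply: joined_trans (joined_sub sub xy) _; exact: joined_sym.
  + by apply: sJ => //; exact: joined_sub sub xy.
move=> y Gy; have [x xs xy] := sE y (contra_not (@sub y) Gy).
have [xm'|xm'] := pselect (joined (full p c G') x mid).
  have [|x' x'n x'y] := newE y _ Gy; first by apply: joined_trans (joined_sym xm') xy.
  by exists x' => //; rewrite mem_cat x'n.
exists x; last exact: other_face.
rewrite mem_cat mem_rem_uniq // !inE xs andbT; apply/orP; right.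
by apply: contra_notN xm' => /eqP ->.
Qed.

Lemma reps_bridge u v s : e = [set u; v]%SET -> ~~ connect (adj G') u v ->
  face_reps (full p c G') s ->
  exists2 s', face_reps (full p c G) s' & size s' = size s.
Proof.
move=> euv uv fs; have [us sG sJ sE] := fs.
have [z0 z0s z0m] := sE mid mid_out.
have [r r0 Gr] := compact_far cG' mid_out.
have [x xr Gx] := full_empty_interior mid r0.
have mx : joined (full p c G') mid x.
  apply: (@joined_ball _ _ mid r); rewrite ?subrr ?normr0 //.
  by move=> w Gw wm; apply: Gr; exists w => //; rewrite distrC.
exists ([:: x] ++ rem z0 s); last first.
  by rewrite /= size_rem //; case: (s) z0s.
apply: reps_add_edge => //.
- by move=> y; rewrite inE => /eqP ->.
- by move=> y z; rewrite !inE => /eqP -> /eqP ->.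
move=> y my Gy; exists x; first by rewrite inE.
apply: (bridge_edge Gpc eG euv uv); first exact: joined_trans (joined_sym mx) my.
  by apply: contra_not Gx => ex; rewrite GE; right.
by apply: contra_not Gy => ex; rewrite GE; right.
Qed.

Lemma reps_cycle u v s : e = [set u; v]%SET -> connect (adj G') u v ->
  face_reps (full p c G') s ->
  exists2 s', face_reps (full p c G) s' & size s' = (size s).+1.
Proof.
move=> euv uv fs; have [us sG sJ sE] := fs.
have [z0 z0s z0m] := sE mid mid_out.
have [x [y [mx my Gx Gy xy]]] := cycle_edge Gpc eG euv uv.
exists ([:: x; y] ++ rem z0 s); last first.
  by rewrite /= size_rem //; case: (s) z0s.
apply: reps_add_edge => //.
- rewrite /= inE andbT; apply/eqP => E; apply: xy; rewrite E; exact: joined_refl.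
- by move=> w; rewrite !inE => /orP[]/eqP ->.
- move=> w w'; rewrite !inE => /orP[]/eqP -> /orP[]/eqP -> //.
  by move=> /joined_sym.
move=> w mw Gw.
have [] := face_split3 Gpc eG Gx Gy Gw (joined_trans (joined_sym mx) my)
  (joined_trans (joined_sym my) mw); first by [].
  by exists y; rewrite // !inE eqxx orbT.
by exists x; rewrite // !inE eqxx.
Qed.

End OneEdge.
End Fixed.

(** Induction on the edges: a bridge merges two components and splits no face, while an edge that
    closes a cycle splits one face into two. Without edges, the finitely many vertices leave a
    single face. *)
Theorem euler_formula G p c : plane_graph G p c ->
  exists2 s, face_reps (full p c G) s & (size s + #|V| = #|G| + ncomp G + 1)%N.
Proof.
have [n] := ubnP #|G|; elim: n G => // n IH G Gn Gpc.
have [G0|/set0Pn[e eG]] := eqVneq G finset.set0.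
  have E : full p c G = [set` codom p].
    rewrite G0; apply/seteqP; split=> w.
      by move=> [[v _ <-]|[e /=]]; [exact: codom_f|rewrite inE].
    by move=> /codomP[v ->]; exact: full_vertex.
  have [y yG] := compact_avoid (drawing_compact Gpc (S := finset.setT) (fintype.subxx G)).
  exists [:: y]; last by rewrite G0 ncomp0 cards0 /= addn1 add1n.
  split=> //.
  - by move=> x; rewrite inE => /eqP ->.
  - by move=> x z; rewrite !inE => /eqP -> /eqP ->.
  move=> z zG; exists y; first by rewrite inE.
  by rewrite E in yG zG *; apply: points_nonsep; exact/negP.
have G'G : G :\ e \subset G by exact: subD1set.
have Gcard : #|G| = #|G :\ e|.+1 by rewrite (cardsD1 e G) eG.
have [s fs szs] := IH (G :\ e) ltac:(by rewrite Gcard in Gn) (plane_sub G'G Gpc).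
have [u [v [euv uv _ _]]] := edge_ends Gpc eG.
have [uvc|uvc] := boolP (connect (adj (G :\ e)) u v).
  have [s' fs' ss'] := reps_cycle Gpc eG euv uvc fs.
  by exists s' => //; rewrite (ncomp_cycle euv uvc) ss' Gcard addSn szs !addSn.
have [s' fs' ss'] := reps_bridge Gpc eG euv uvc fs.
by exists s' => //; rewrite ss' Gcard szs -(ncomp_bridge eG euv uvc) addSnnS.
Qed.

(** In a forest, components and edges together are as many as the vertices, so Euler's formula
    leaves one face. *)
Lemma leafy_nonsep G p c x y : plane_graph G p c -> leafy G ->
  ~ full p c G x -> ~ full p c G y -> joined (full p c G) x y.
Proof.
move=> Gpc leaf Gx Gy; have [sG _] := Gpc.
have [s [us sG' sJ sE] sz] := euler_formula Gpc.
have s1 : size s = 1%N by have := leafy_ncomp sG leaf; lia.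
case: s s1 us sG' sJ sE {sz} => [|z [|]] //= _ _ _ _ sE.
have [x' + xx'] := sE x Gx; have [y' + yy'] := sE y Gy.
rewrite !inE => /eqP yz /eqP xz; subst x' y'.
exact: joined_trans (joined_sym xx') yy'.
Qed.

End Euler.

(** * Edges and vertices on the boundary of a face *)

Section Counting.
Variables (R : realType) (V : finType).
Local Notation pt := (R * R)%type.

Local Notation full p c E := (drawing p c finset.setT E).

Section Fixed.
Variables (G : {set {set V}}) (p : V -> pt) (c : {set V} -> R -> pt).
Hypothesis Gpc : plane_graph G p c.

Definition touched_edges x : {set {set V}} :=
  [set e in G | `[< touches_edge G p c x e >]]%SET.

Definition touched_vertices x : {set V} :=
  [set v | `[< touches (full p c G) x (p v) >]]%SET.

Lemma touched_edgesP x e : reflect (e \in G /\ touches_edge G p c x e) (e \in touched_edges x).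
Proof. by rewrite inE; apply: (iffP andP) => -[? ?]; split=> //; exact/asboolP. Qed.

Lemma touched_verticesP x v :
  reflect (touches (full p c G) x (p v)) (v \in touched_vertices x).
Proof. by rewrite inE; exact: asboolP. Qed.

Lemma touched_edge_sub x e : e \in touched_edges x -> e \subset touched_vertices x.
Proof.
move=> /touched_edgesP[eG xe]; apply/fintype.subsetP => v ve; apply/touched_verticesP.
exact: (touches_edge_vertex Gpc eG ve).
Qed.

Lemma mid_off (E : {set {set V}}) e : E \subset G -> e \in G -> e \notin E -> ~ full p c E (c e (1 / 2)).
Proof.
move=> /fintype.subsetP EG eG eE Em.
have em := edge_mid c eG.
have nv : ~ exists v, c e (1 / 2) = p v.
  by apply: (edge_inner Gpc eG); apply/andP; split; lra.
case: (fullP Em) => [//|[f fE fm]]; have ef : e != f by apply: contraNneq eE => ->.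
by have [v [_ _ mv]] := edges_meet Gpc eG (EG f fE) ef em fm; apply: nv; exists v.
Qed.

(** A forest does not separate, so a face that touches only a forest fills the complement of its
    drawing, and it would contain the midpoint of any untouched edge. *)
Lemma touched_leafy x : ~ full p c G x -> leafy (touched_edges x) -> touched_edges x = G.
Proof.
move=> Gx leaf; set E := touched_edges x in leaf *.
have EG : E \subset G by apply/fintype.subsetP => e /touched_edgesP[].
apply/eqP; rewrite finset.eqEsubset EG /=; apply/fintype.subsetP => e eG; apply/negPn/negP => eE.
have mE := mid_off EG eG eE.
have Ex : ~ full p c E x by apply: contra_not Gx; apply: drawing_sub.
have xm := leafy_nonsep (plane_sub EG Gpc) leaf Ex mE.
have nE f : f \in G -> f \notin E -> ~ touches_edge G p c x f.
  by move=> fG fE xf; case/negP: fE; apply/touched_edgesP.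
have nT v : v \notin finset.setT -> ~ touches (full p c G) x (p v) by rewrite inE.
have [_] := joined_out (face_boundary Gpc EG Gx nE nT xm).
by apply; exact: (full_trace p eG (edge_mid c eG)).
Qed.

Lemma edge_other e f : e \in G -> f \in G -> e != f -> exists2 v, v \in e & v \notin f.
Proof.
move=> eG fG ef; have [a [b [eab ab _ _]]] := edge_ends Gpc eG.
have ae : a \in e by rewrite eab !inE eqxx.
have be : b \in e by rewrite eab !inE eqxx orbT.
have [af|af] := boolP (a \in f); last by exists a.
exists b => //; apply: contraNN ab => bf; apply/eqP.
exact: (edge_common Gpc eG fG ef).
Qed.

Lemma leafy_small (E : {set {set V}}) : E \subset G -> (#|E| <= 2)%N -> leafy E.
Proof.
move=> EG E2 E' E'E /set0Pn[e eE']; exists e => //.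
have E'2 : (#|E'| <= 2)%N := leq_trans (subset_leq_card E'E) E2.
have E'G f : f \in E' -> f \in G by move=> /(fintype.subsetP E'E)/(fintype.subsetP EG).
have [[f fE' fe]|none] := pselect (exists2 f, f \in E' & f != e); last first.
  have [a [b [eab _ _ _]]] := edge_ends Gpc (E'G e eE').
  exists a; first by rewrite eab !inE eqxx.
  by move=> f fE' fe; case: none; exists f.
have [v ve vf] : exists2 v, v \in e & v \notin f.
  by apply: edge_other; [exact: E'G|exact: E'G|rewrite eq_sym].
exists v => // g gE' ge.
have -> // : g = f.
have ef2 : #|[set e; f]%SET| = 2%N by rewrite cards2 eq_sym fe.
have sub : [set e; f]%SET \subset E'.
  by apply/fintype.subsetP => h; rewrite !inE => /orP[]/eqP ->.
have : g \in [set e; f]%SET.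
  by have /eqP -> : [set e; f]%SET == E' by rewrite eqEcard sub ef2.
by rewrite !inE (negbTE ge) => /eqP.
Qed.

Lemma touched_ge3 x : (3 <= #|G|)%N -> ~ full p c G x -> (3 <= #|touched_edges x|)%N.
Proof.
move=> G3 Gx; rewrite leqNgt; apply/negP => t2.
have EG : touched_edges x \subset G by apply/fintype.subsetP => e /touched_edgesP[].
have := touched_leafy Gx (leafy_small EG t2) => E.
by move: t2; rewrite E ltnNge G3.
Qed.

(** Three faces near the midpoint of [e] come from one face of the drawing without [e], which [e]
    cuts into at most two. *)
Lemma touches_le2 s e : face_reps (full p c G) s -> e \in G ->
  (count (fun x => `[< touches_edge G p c x e >]) s <= 2)%N.
Proof.
move=> [us sG sJ sE] eG; rewrite leqNgt -size_filter; apply/negP.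
set t := seq.filter _ s; have ut : uniq t by exact: filter_uniq.
have tP x : x \in t -> x \in s /\ touches_edge G p c x e.
  by rewrite mem_filter => /andP[/asboolP].
case: t ut tP => [|x [|y [|z t]]] //= /and4P[+ + _ _] tP _.
rewrite !inE !negb_or => /and3P[/eqP xy /eqP xz _] /andP[/eqP yz _].
have [xs tx] := tP x ltac:(by rewrite !inE eqxx).
have [ys ty] := tP y ltac:(by rewrite !inE eqxx orbT).
have [zs tz] := tP z ltac:(by rewrite !inE eqxx !orbT).
have G'G : G :\ e \subset G by exact: subD1set.
have [r r0 Gr] := compact_far (@drawing_compact _ _ _ _ _ Gpc finset.setT _ G'G)
  (mid_out Gpc eG).
have [x' x'r xx'] := tx r r0; have [y' y'r yy'] := ty r r0; have [z' z'r zz'] := tz r r0.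
have near u v : `|u - c e (1 / 2)| < r -> `|v - c e (1 / 2)| < r ->
    joined (full p c (G :\ e)) u v.
  apply: joined_ball => w Gw wm; apply: Gr; exists w => //; by rewrite distrC.
have [_ Gx'] := joined_out xx'; have [_ Gy'] := joined_out yy'.
have [_ Gz'] := joined_out zz'.
have [] := face_split3 Gpc eG Gx' Gy' Gz' (near _ _ x'r y'r) (near _ _ y'r z'r) => H.
- by apply: xy; apply: sJ => //; apply: joined_trans xx' _; apply: joined_trans H (joined_sym yy').
- by apply: yz; apply: sJ => //; apply: joined_trans yy' _; apply: joined_trans H (joined_sym zz').
- by apply: xz; apply: sJ => //; apply: joined_trans xx' _; apply: joined_trans H (joined_sym zz').
Qed.

Lemma sum_touched s : (\sum_(x <- s) #|touched_edges x| =
  \sum_(e in G) count (fun x => `[< touches_edge G p c x e >]) s)%N.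
Proof.
transitivity (\sum_(x <- s) \sum_(e in G) `[< touches_edge G p c x e >] : nat)%N.
  apply: eq_bigr => x _; rewrite -sum1_card big_mkcond [RHS]big_mkcond.
  by apply: eq_bigr => e _; rewrite inE; case: (e \in G); case: asbool.
rewrite exchange_big; apply: eq_bigr => e _.
by elim: s => [|x s IH]; rewrite ?big_nil // big_cons IH.
Qed.

Lemma sum_touched_le s : face_reps (full p c G) s ->
  (\sum_(x <- s) #|touched_edges x| <= 2 * #|G|)%N.
Proof.
move=> fs; rewrite sum_touched mulnC -sum_nat_const; apply: leq_sum => e eG.
exact: touches_le2.
Qed.

Lemma face_count_le s : face_reps (full p c G) s -> (3 <= #|G|)%N ->
  (3 * size s <= 2 * #|G|)%N.
Proof.
move=> fs G3; apply: leq_trans (sum_touched_le fs); have [_ sG _ _] := fs.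
rewrite -(count_predT s) -sum1_count big_distrr /= big_seq [X in (_ <= X)%N]big_seq.
by apply: leq_sum => x /sG; exact: touched_ge3.
Qed.

Lemma edge_nonempty e : e \in G -> e != finset.set0.
Proof. by move=> eG; have [sG _] := Gpc; rewrite -card_gt0 sG. Qed.

(** Euler's formula with three edges on every face and two faces on every edge. Counting covered
    vertices only makes the bound usable for the subgraph inside a vertex set, see [inside_lt]. *)
Lemma planar_edge_bound : (3 <= #|G|)%N -> (#|G| + 6 <= 3 * #|finset.cover G|)%N.
Proof.
move=> G3; have [s fs sz] := euler_formula Gpc.
have G0 : G != finset.set0 by rewrite -card_gt0; apply: leq_trans G3.
have := ncomp_ge G0 edge_nonempty; have := face_count_le fs G3; lia.
Qed.

(** If no edge at [v] were touched, delete [v] and these edges: from near [v] the face could then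
    reach the midpoint of [e], without passing through [p v] since a point does not separate. Its
    first contact with the full drawing would be with an edge at [v]. *)
Lemma vertex_touch_edge x v e : e \in G -> v \in e -> touches (full p c G) x (p v) ->
  exists2 f, f \in touched_edges x & v \in f.
Proof.
move=> eG ve tx; apply: contrapT => none.
pose D := [set f in G | v \notin f]%SET.
have DG : D \subset G by apply/fintype.subsetP => f; rewrite inE => /andP[].
pose K1 := drawing p c (~: [set v]%SET) D.
have cK1 : compact K1 by exact: (drawing_compact Gpc).
have eD : e \notin D by rewrite inE ve andbF.
have K1v : ~ K1 (p v).
  move=> [[z /= zv /(p_inj Gpc) E]|[f /=]]; first by move: zv; rewrite E !inE eqxx.
  by rewrite inE => /andP[fG vf] /(vertex_on Gpc v fG); rewrite (negbTE vf).
have sub1 : K1 `<=` full p c G by apply: drawing_sub => //; exact: finset.subsetT.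
have [r r0 K1r] := compact_far cK1 K1v.
have [y yv xy] := tx r r0.
have [_ Gy] := joined_out xy.
have K1mid : ~ K1 (c e (1 / 2)).
  by move=> H; apply: (mid_off DG eG eD); apply: drawing_sub H => //; exact: finset.subsetT.
have half : joined K1 (p v) (c e (1 / 2)).
  have [cc _] := edge_curve Gpc eG.
  have off t : 0 <= t <= 1 -> K1 (c e t) -> exists2 z, c e t = p z & z \in e /\ z != v.
    move=> t01 Kt; have et : trace (c e) (c e t) by exists t; rewrite //= in_itv.
    have [z -> [ze zS]] := drawing_edge Gpc DG eG eD Kt et.
    exists z => //; split=> //; case: zS => [|[f]]; first by rewrite !inE.
    by rewrite inE => /andP[_ vf] zf; apply: contraNneq vf => <-.
  have inner t : 0 < t < 1 -> ~ exists z, c e t = p z := edge_inner Gpc eG.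
  have [_ ci] := edge_curve Gpc eG.
  have cinj a b : c e a = c e b -> 0 <= a <= 1 -> 0 <= b <= 1 -> a = b.
    by move=> E a01 b01; apply: ci; rewrite ?inE ?in_itv.
  case: (edge_endP Gpc eG ve) => Ev; rewrite Ev.
    apply: (joined_chained cK1 (A := subarc (c e) 0 (1 / 2))).
    - by apply: compact_subarc => //; lra.
    - move=> w [t /=]; rewrite in_itv /= => /andP[t0 t1] <- Kt.
      have [z Ez [ze zv]] := off t ltac:(apply/andP; split; lra) Kt.
      have [t0'|t0'] := ltP 0 t; first by exfalso; apply: (inner t); [apply/andP; split; lra|exists z].
      have Et : t = 0 by lra.
      by case/eqP: zv; apply: (p_inj Gpc); rewrite -Ez Et Ev.
    - by apply: subarc_chained => //; lra.
  apply: joined_sym; apply: (joined_chained cK1 (A := subarc (c e) (1 / 2) 1)).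
  - by apply: compact_subarc => //; lra.
  - move=> w [t /=]; rewrite in_itv /= => /andP[t0 t1] <- Kt.
    have [z Ez [ze zv]] := off t ltac:(apply/andP; split; lra) Kt.
    have [t1'|t1'] := ltP t 1; first by exfalso; apply: (inner t); [apply/andP; split; lra|exists z].
    have Et : t = 1 by lra.
    by case/eqP: zv; apply: (p_inj Gpc); rewrite -Ez Et Ev.
  - by apply: subarc_chained => //; lra.
have ymid : joined K1 y (c e (1 / 2)).
  apply: joined_trans half; apply: (@joined_ball _ _ (p v) r) => //; rewrite ?subrr ?normr0 //.
  by move=> w Kw wv; apply: K1r; exists w => //; rewrite distrC.
pose K2 := K1 `|` [set p v].
have sub2 : K2 `<=` full p c G.
  by move=> w [/sub1 //|->]; exact: full_vertex.
have yK2 : joined K2 y (c e (1 / 2)).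
  apply: alexander => //; first exact: compact_set1.
    by move=> w w' Kw wv; move: Kw; rewrite wv => /K1v.
  have nv : ~ exists v, c e (1 / 2) = p v.
    by apply: (edge_inner Gpc eG); apply/andP; split; lra.
  apply: (@joined_around _ _ (p v) 0).
  - by move=> w ->; rewrite subrr normr0.
  - rewrite normr_gt0 subr_eq0; apply/eqP => E; apply: Gy; rewrite E; exact: full_vertex.
  - by rewrite normr_gt0 subr_eq0; apply/eqP => E; apply: nv; exists v.
have EU : K2 `|` full p c G = full p c G by apply/setUidPr.
have := first_hit (drawing_compact Gpc (S := finset.setT) (fintype.subxx G)) yK2 Gy.
rewrite EU => -[ym|[w [Gw K2w tw]]].
  by have [_] := joined_out ym; apply; exact: (full_trace p eG (edge_mid c eG)).
have nv : ~ exists z, w = p z.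
  move=> [z wz]; apply: K2w; rewrite wz; have [->|zv] := eqVneq z v; first by right.
  by left; left; exists z; rewrite //= !inE.
case: (fullP Gw) => // -[f fG fw].
have vf : v \in f.
  by apply/negPn/negP => vf; apply: K2w; left; right; exists f; rewrite //= inE fG.
apply: none; exists f => //; apply/touched_edgesP; split=> //.
apply: (touches_class xy); exact: (touch_edge Gpc fG fw nv tw (edge_mid c fG)).
Qed.

(** The complement of the drawing is dense and has finitely many faces. *)
Lemma some_face_touches s w : face_reps (full p c G) s -> exists2 z, z \in s & touches (full p c G) z w.
Proof.
move=> [us sG sJ sE]; apply: contrapT => none.
have [e e0 He] : exists2 e, 0 < e & forall z, z \in s -> forall y, `|y - w| < e ->
    ~ joined (full p c G) z y.
  have : forall z, z \in s -> ~ touches (full p c G) z w by move=> z zs tz; apply: none; exists z.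
  elim: s {us sG sJ sE none} => [_|z s IH nt]; first by exists 1.
  have [|e e0 He] := IH; first by move=> y ys; apply: nt; rewrite inE ys orbT.
  have /existsNP[e' /not_implyP[e'0 H]] := nt z (mem_head _ _).
  exists (Num.min e e'); first by rewrite lt_min e0.
  move=> z'; rewrite inE => /orP[/eqP ->|zs] y; rewrite lt_min => /andP[ye ye'] zy.
    by apply: H; exists y.
  exact: (He z' zs y ye zy).
have [y yw Gy] := full_empty_interior Gpc w e0.
by have [z zs zy] := sE y Gy; exact: (He z zs y yw zy).
Qed.

End Fixed.

Lemma touches_sub (K K' : set pt) (x w : pt) : K `<=` K' -> touches K' x w -> touches K x w.
Proof. by move=> KK' tx e /tx [y yw xy]; exists y => //; exact: joined_sub KK' xy. Qed.

(** The complete graph on four vertices is not outerplanar. Its drawing has at least 4 faces, each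
    of which touches at least 3 of its 6 edges, and each edge is touched by at most 2 faces; so
    every face touches exactly 3 edges. These form a triangle and reach only three of the four
    vertices. *)
Lemma face_clique_lt4 (G : {set {set V}}) p c x (Q : {set V}) : plane_graph G p c ->
  (forall u v, u \in Q -> v \in Q -> u != v -> [set u; v]%SET \in G) ->
  Q \subset touched_vertices G p c x -> #|Q| != 4%N.
Proof.
move=> Gpc clique Qt; apply/eqP => Q4.
pose D := [set e in G | e \subset Q]%SET.
have DG : D \subset G by apply/fintype.subsetP => f; rewrite inE => /andP[].
have Dpc := plane_sub DG Gpc.
have [sG _] := Gpc.
have D6 : #|D| = 6%N.
  have <- : #|[set e : {set V} | e \subset Q & #|e| == 2%N]%SET| = 6%N.
    by rewrite cards_draws Q4.
  apply: eq_card => e; rewrite !inE andbC; apply: andb_id2l => eQ; apply/idP/idP.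
    by move=> /sG ->.
  move=> /cards2P[a [b [ab E]]]; move: eQ; rewrite E => /fintype.subsetP eQ.
  by apply: clique => //; apply: eQ; rewrite !inE eqxx ?orbT.
have tx v : v \in Q -> touches (full p c D) x (p v).
  move=> /(fintype.subsetP Qt)/touched_verticesP; apply: touches_sub.
  exact: drawing_sub.
have [s fs sz] := euler_formula Dpc; have [us sD sJ sE] := fs.
have D0 : D != finset.set0 by rewrite -card_gt0 D6.
have DQ : (#|finset.cover D| <= 4)%N.
  rewrite -Q4; apply: subset_leq_card; apply/finset.bigcupsP => e; by rewrite inE => /andP[].
have s4 : (4 <= size s)%N.
  by have := ncomp_ge D0 (edge_nonempty Dpc); rewrite D6 in sz; lia.
have Q0 : exists v, v \in Q by apply/set0Pn; rewrite -card_gt0 Q4.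
have [v0 v0Q] := Q0.
have Dx : ~ full p c D x.
  by have [y _ xy] := tx v0 v0Q 1 ltr01; have [] := joined_out xy.
have [z zs zx] := sE x Dx.
have {}tx v : v \in Q -> touches (full p c D) z (p v).
  by move=> /tx; apply: touches_class.
have t3 y : y \in s -> (3 <= #|touched_edges D p c y|)%N.
  by move=> /sD; apply: (touched_ge3 Dpc); rewrite D6.
have z3 : #|touched_edges D p c z| = 3%N.
  have := sum_touched_le Dpc fs; rewrite D6 (perm_big _ (perm_to_rem zs)) big_cons /=.
  have : (3 * size (rem z s) <= \sum_(y <- rem z s) #|touched_edges D p c y|)%N.
    rewrite -(count_predT (rem z s)) -sum1_count big_distrr /=.
    rewrite big_seq [X in (_ <= X)%N]big_seq.
    by apply: leq_sum => y /mem_rem/t3.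
  rewrite size_rem //; have := t3 z zs.
  move: (\sum_(y <- rem z s) _)%N #|touched_edges D p c z| => S T.
  by move: s4; move: (size s); clear => n; case: n => [|n] /=; lia.
set E := touched_edges D p c z in z3.
have ED : E \subset D by apply/fintype.subsetP => e /touched_edgesP[].
have EG : E \subset G := fintype.subset_trans ED DG.
have nleaf : ~ leafy E.
  by move=> /(touched_leafy Dpc (sD z zs)) ED'; move: z3; rewrite /E ED' D6.
(* A set of edges that is not leafy has a nonempty part in which every vertex met lies on two edges;
   with at most 3 edges this is a triangle. *)
have [E' [E'E /set0Pn[e eE'] nol]] : exists E' : {set {set V}}, [/\ E' \subset E, E' != finset.set0 &
    forall e v, e \in E' -> v \in e -> exists2 f, f \in E' & f != e /\ v \in f].
  apply: contrapT => none; apply: nleaf => E' E'E E'0; apply: contrapT => nol.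
  apply: none; exists E'; split=> // e v eE' ve; apply: contrapT => nof.
  apply: nol; exists e => //; exists v => // f fE' fe; apply/negP => vf.
  by apply: nof; exists f.
have E'G f : f \in E' -> f \in G by move=> /(fintype.subsetP E'E)/(fintype.subsetP EG).
have eG := E'G e eE'.
have [a [b [eab ab _ _]]] := edge_ends Gpc eG.
have ae : a \in e by rewrite eab !inE eqxx.
have be : b \in e by rewrite eab !inE eqxx orbT.
have [f fE' [fe af]] := nol e a eE' ae.
have [g gE' [ge bg]] := nol e b eE' be.
have fG := E'G f fE'; have gG := E'G g gE'.
have ef : e != f by rewrite eq_sym.
have eg : e != g by rewrite eq_sym.
have bf : b \notin f.
  apply/negP => bf; case/eqP: ab; exact: (edge_common Gpc eG fG ef).
have fg : f != g by apply: contraNneq bf => ->.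
have efg3 : #|[set e; f; g]%SET| = 3%N.
  by rewrite finset.setUC cardsU1 cards2 !inE (negbTE ge) ef eq_sym (negbTE fg).
have E3 : E' = [set e; f; g]%SET /\ E = [set e; f; g]%SET.
  have sub : [set e; f; g]%SET \subset E'.
    by apply/fintype.subsetP => h; rewrite !inE => /orP[/orP[]|]/eqP ->.
  have EE' : E' = E.
    apply/eqP; rewrite eqEcard E'E z3 -efg3; exact: subset_leq_card.
  by split; [|rewrite -EE']; apply/eqP; rewrite eq_sym eqEcard sub efg3 EE' z3.
have [y yf ya] : exists2 y, y \in f & y != a.
  have [a' [b' [E1 ab' _ _]]] := edge_ends Gpc fG.
  have [aa|aa] := eqVneq a' a; last by exists a'; rewrite // E1 !inE eqxx.
  by exists b'; [rewrite E1 !inE eqxx orbT|rewrite eq_sym -aa].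
have yb : y != b by apply: contraNneq bf => <-.
have yg : y \in g.
  have [h + [hf yh]] := nol f y fE' yf.
  case: E3 => -> _; rewrite !inE (negbTE hf) orbF => /orP[]/eqP hE; last by rewrite -hE.
  by move: yh; rewrite hE eab !inE (negbTE ya) (negbTE yb).
have fE : f = [set a; y]%SET by apply: (edge2 Gpc fG) => //; rewrite eq_sym.
have gE : g = [set b; y]%SET by apply: (edge2 Gpc gG) => //; rewrite eq_sym.
have : Q \subset [set a; b; y]%SET.
  apply/fintype.subsetP => v vQ.
  have [h hD vh] : exists2 h, h \in D & v \in h.
    have [w wQ wv] : exists2 w, w \in Q & w != v.
      apply: contrapT => none; have : Q \subset [set v]%SET.
        by apply/fintype.subsetP => w wQ; rewrite inE; apply/negPn/negP => wv; apply: none; exists w.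
      by move/subset_leq_card; rewrite Q4 cards1.
    exists [set w; v]%SET; last by rewrite !inE eqxx orbT.
    rewrite inE clique //=; apply/fintype.subsetP => z'; by rewrite !inE => /orP[]/eqP ->.
  have [h' h'E vh'] := vertex_touch_edge Dpc hD vh (tx v vQ).
  move: vh'; case: E3 => _ EE; move: h'E; rewrite -/E EE !inE.
  by move=> /orP[/orP[]|]/eqP ->; rewrite ?eab ?fE ?gE !inE => /orP[]->; rewrite ?orbT.
move/subset_leq_card; rewrite Q4.
have : (#|[set a; b; y]%SET| <= 3)%N.
  by rewrite finset.setUC cardsU1 cards2; case: (_ \notin _); case: (_ != _).
by move=> h3 h4; have := leq_trans h4 h3.
Qed.

End Counting.

(** * Maximal planar graphs *)

Section Maximal.
Variables (R : realType) (V : finType).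
Local Notation pt := (R * R)%type.
Variables (G : {set {set V}}) (p : V -> pt) (c : {set V} -> R -> pt).
Hypotheses (Gmax : maximal_planar R G) (Gpc : plane_graph G p c).

Local Notation full E := (drawing p c finset.setT E).

Lemma touched_clique x u v : u \in touched_vertices G p c x ->
  v \in touched_vertices G p c x -> u != v -> [set u; v]%SET \in G.
Proof.
move=> /touched_verticesP xu /touched_verticesP xv uv; apply/negPn/negP => uvG.
have [g gP] := touched_addable Gpc xu xv uv uvG.
have [_ _ Gm] := Gmax; apply: (Gm [set u; v]%SET) => //; first by rewrite cards2 uv.
by exists p, (fun f => if f == [set u; v]%SET then g else c f).
Qed.

Lemma touched_vertices_le3 x : (#|touched_vertices G p c x| <= 3)%N.
Proof.
rewrite leqNgt; apply/negP => T4; set T := touched_vertices G p c x in T4.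
have : (0 < #|[set Q : {set V} | Q \subset T & #|Q| == 4]%SET|)%N.
  by rewrite cards_draws bin_gt0.
rewrite card_gt0 => /set0Pn[Q]; rewrite inE => /andP[QT /eqP Q4].
have clique u v : u \in Q -> v \in Q -> u != v -> [set u; v]%SET \in G.
  by move=> uQ vQ; apply: (@touched_clique x); exact: (fintype.subsetP QT).
by have := face_clique_lt4 Gpc clique QT; rewrite Q4.
Qed.

(** If the component [S] of [u] missed [v], some face on the side of [p v] would touch the drawing
    of [S]. The vertices it touches form a clique, hence all lie in [S], so its boundary is drawn by
    [S] alone and it contains [p v], which is absurd. *)
Lemma maximal_connected u v : connect (adj G) u v.
Proof.
apply/negPn/negP => nuv.
pose S := comp_of G u.
have vS : v \notin S by rewrite inE.
pose E1 := [set f in G | f \subset S]%SET.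
have E1G : E1 \subset G by apply/fintype.subsetP => f; rewrite inE => /andP[].
have SG f w : f \in G -> w \in f -> w \in S -> f \subset S.
  move=> fG wf; rewrite inE => uw; apply/fintype.subsetP => z zf; rewrite inE.
  have [->//|wz] := eqVneq z w.
  apply: (connect_trans uw); apply: connect1; rewrite /adj -(edge2 Gpc fG wf zf) //.
  by rewrite eq_sym.
pose K1 := drawing p c S E1.
have cK1 : compact K1 by exact: (drawing_compact Gpc).
have sub1 : K1 `<=` full G by apply: drawing_sub => //; exact: finset.subsetT.
have [s fs _] := euler_formula Gpc; have [us sG sJ sE] := fs.
have K1v : ~ K1 (p v).
  move=> [[z zS /(p_inj Gpc) E]|[f /=]]; first by move: vS; rewrite -E => /negP; apply; exact: zS.
  rewrite inE => /andP[fG fS] /(vertex_on Gpc v fG) vf.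
  by have := fintype.subsetP fS v vf; rewrite (negbTE vS).
have K1u : K1 (p u) by left; exists u => //=; rewrite inE connect0.
(* The empty set separates nothing, so the way from [p v] to [p u] hits [K1] first at some [w]. *)
have [|[w [K1w _ tw]]] := first_hit cK1 (joined0 (p v) (p u)) K1v.
  by rewrite set0U => vu; have [_] := joined_out vu; apply.
rewrite set0U in tw.
pose K2 := drawing p c (~: S) (G :\: E1).
have E2G : G :\: E1 \subset G by exact: subsetDl.
have K12 : ~ K2 w.
  have E2P f : f \in G :\: E1 -> f \in G /\ ~~ (f \subset S).
    by rewrite !inE => /andP[]; case: (f \in G).
  move=> K2w; case: K1w => [[z zS zw]|[f /=]].
    rewrite -zw in K2w; case: K2w => [[z' z'S /(p_inj Gpc) E]|[f /= /E2P[fG fS]]].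
      by move: z'S; rewrite /= inE E => /negP; exact.
    by move=> /(vertex_on Gpc z fG) zf; case/negP: fS; exact: SG zf zS.
  rewrite inE => /andP[fG fS] fw; case: K2w => [[z zS zw]|[f' /= /E2P[f'G f'S]] f'w].
    have zf : z \in f by apply/(vertex_on Gpc z fG); rewrite zw.
    by move: zS; rewrite /= inE (fintype.subsetP fS z zf).
  have ff' : f != f' by apply: contraNneq f'S => <-.
  have [z [zf zf' _]] := edges_meet Gpc fG f'G ff' fw f'w.
  by case/negP: f'S; apply: (SG f' z f'G zf'); exact: (fintype.subsetP fS).
have cK2 : compact K2 by exact: (drawing_compact Gpc).
have [r r0 K2r] := compact_far cK2 K12.
have fullE y : full G y -> K1 y \/ K2 y.
  move=> [[z _ <-]|[f /= fG fy]].
    have [zS|zS] := boolP (z \in S); first by left; left; exists z.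
    by right; left; exists z => //=; rewrite inE.
  have [fS|fS] := boolP (f \subset S); first by left; right; exists f; rewrite //= inE fG.
  by right; right; exists f; rewrite //= !inE fG (negbTE fS).
(* Near [w] the drawing of [G] is [K1] alone, so one of the finitely many faces of [G] approaches
   [w] within the component of [p v]. *)
have [|z nz] := @near_class_exists R K1 (full G) w (p v) r s r0 _ tw.
  move=> y yw vy; have [_ K1y] := joined_out vy.
  apply: sE => /fullE [//|K2y]; apply: K2r; exists y => //; by rewrite distrC.
have tz : touches (full G) z w := near_class_touches nz.
have vz : joined K1 (p v) z.
  have [y [_ vy zy]] := nz 1 ltr01.
  by apply: joined_trans vy _; apply: joined_sym; exact: joined_sub zy.
have Gz : ~ full G z by have [y [_ _ zy]] := nz 1 ltr01; have [] := joined_out zy.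
have [a aS ta] : exists2 a, a \in S & touches (full G) z (p a).
  case: K1w => [[a aS aw]|[f /=]]; first by exists a => //; rewrite aw.
  rewrite inE => /andP[fG fS] fw.
  have [[a wa]|nv] := pselect (exists a, w = p a).
    exists a; last by rewrite -wa.
    by apply: (fintype.subsetP fS); apply/(vertex_on Gpc a fG); rewrite -wa.
  have [a af c0] := edge_end0 Gpc fG; exists a; first exact: (fintype.subsetP fS).
  by apply: (touch_edge Gpc fG fw nv tz); exact/(vertex_on Gpc a fG).
have inS b : touches (full G) z (p b) -> b \in S.
  move=> tb; have [<-//|ab] := eqVneq a b.
  have abG : [set a; b]%SET \in G.
    by apply: (@touched_clique z) => //; exact/touched_verticesP.
  by apply: (fintype.subsetP (SG _ a abG _ aS)); rewrite !inE eqxx ?orbT.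
have zv : joined (full G) z (p v).
  apply: (face_boundary Gpc E1G Gz (S := S)) (joined_sym vz).
    move=> f fG fE1 zf; case/negP: fE1; rewrite inE fG /=.
    by apply/fintype.subsetP => b bf; apply: inS; exact: (touches_edge_vertex Gpc fG bf zf).
  by move=> b bS /inS; rewrite (negbTE bS).
by have [_] := joined_out zv; apply; exact: full_vertex.
Qed.

(** Were [e] a bridge, a face touching it would touch no third vertex, since this vertex would be
    adjacent to both ends; its boundary would be [e] alone, and an arc separates nothing. So [e]
    lies on a cycle, and [cycle_edge] provides two faces next to it. *)
Lemma touches_ge2 s e : face_reps (full G) s -> e \in G ->
  (2 <= count (fun x => `[< touches_edge G p c x e >]) s)%N.
Proof.
move=> fs eG; have [us sG sJ sE] := fs; have [V3 _ _] := Gmax.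
have G'G : G :\ e \subset G by exact: subD1set.
have eG' : e \notin G :\ e by rewrite !inE eqxx.
have GE : full G = full (G :\ e) `|` trace (c e) by rewrite -drawingU1 finset.setD1K.
have [u [v [euv uv _ _]]] := edge_ends Gpc eG.
have third (w : V) : w \notin e -> [set u; w]%SET \in G -> [set v; w]%SET \in G ->
    connect (adj (G :\ e)) u v.
  move=> we uw vw; apply: (@connect_trans _ _ w); apply: connect1; rewrite /adj !inE.
    by rewrite uw andbT; apply: contraNneq we => <-; rewrite !inE eqxx orbT.
  by rewrite finset.setUC vw andbT; apply: contraNneq we => <-; rewrite !inE eqxx orbT.
have uvc : connect (adj (G :\ e)) u v.
  apply/negPn/negP => nuv.
  have [z zs tz] := some_face_touches Gpc (c e (1 / 2)) fs.
  have ze : touches_edge G p c z e by [].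
  have Gz := sG z zs.
  have tV a : touches (full G) z (p a) -> a \in e.
    move=> ta; apply/negPn/negP => ae; case/negP: nuv; apply: (third a) => //.
      apply: (@touched_clique z); try exact/touched_verticesP.
        by apply/touched_verticesP; apply: (touches_edge_vertex Gpc eG _ ze); rewrite euv !inE eqxx.
      by apply: contraNneq ae => <-; rewrite euv !inE eqxx.
    apply: (@touched_clique z); try exact/touched_verticesP.
      by apply/touched_verticesP; apply: (touches_edge_vertex Gpc eG _ ze); rewrite euv !inE eqxx orbT.
    by apply: contraNneq ae => <-; rewrite euv !inE eqxx orbT.
  have [w we] : exists w, w \notin e.
    apply: contrapT => none; have : (#|V| <= #|e|)%N.
      apply: subset_leq_card; apply/fintype.subsetP => w _; apply/negPn/negP => we.
      by apply: none; exists w.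
    have [sG' _] := Gpc; rewrite (sG' e eG); by move=> H; have := leq_trans V3 H.
  have e1G : [set e]%SET \subset G by apply/fintype.subsetP => f; rewrite inE => /eqP ->.
  have eD : drawing p c e [set e]%SET `<=` trace (c e).
    move=> y [[a ae <-]|[f /=]]; first exact/(vertex_on Gpc a eG).
    by rewrite inE => /eqP ->.
  have zw : joined (full G) z (p w).
    apply: (face_boundary Gpc e1G Gz (S := e)).
    - move=> f fG; rewrite inE => fe zf; case/negP: fe; rewrite eqEcard.
      have [sG' _] := Gpc; rewrite (sG' e eG) (sG' f fG) leqnn andbT.
      by apply/fintype.subsetP => b bf; apply: tV; exact: (touches_edge_vertex Gpc fG bf zf).
    - by move=> b be /tV; rewrite (negbTE be).
    apply: joined_sub eD _; apply: (trace_nonsep (edge_curve Gpc eG)).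
      by apply: contra_not Gz; exact: full_trace.
    by move/(vertex_on Gpc w eG); rewrite (negbTE we).
  by have [_] := joined_out zw; apply; exact: full_vertex.
have [x [y [mx my Gx Gy xy]]] := cycle_edge Gpc eG euv uvc.
have te z : joined (full (G :\ e)) (c e (1 / 2)) z -> ~ full G z -> touches_edge G p c z e.
  move=> mz Gz.
  have [|[w [ew G'w tw]]] := first_hit (compact_trace Gpc eG) (joined_sym mz)
     (contra_not (@full_trace _ _ p _ _ _ eG z) Gz).
    rewrite -GE => zm; have [_] := joined_out zm.
    by case; exact: (full_trace p eG (edge_mid c eG)).
  rewrite -GE in tw; apply: (touch_edge Gpc eG ew _ tw (edge_mid c eG)).
  by move=> [a wa]; apply: G'w; rewrite wa; exact: full_vertex.
have [x' x's xx'] := sE x Gx; have [y' y's yy'] := sE y Gy.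
have x'y' : x' != y'.
  apply/eqP => E; apply: xy; apply: joined_trans (joined_sym xx') _; rewrite E; exact: yy'.
have tx' : touches_edge G p c x' e by apply: touches_class xx' (te x mx Gx).
have ty' : touches_edge G p c y' e by apply: touches_class yy' (te y my Gy).
rewrite -size_filter.
have sub : {subset [:: x'; y'] <= seq.filter (fun x => `[< touches_edge G p c x e >]) s}.
  move=> z; rewrite !inE mem_filter => /orP[]/eqP ->; rewrite ?x's ?y's andbT; exact/asboolP.
by apply: (@uniq_leq_size _ [:: x'; y']) sub; rewrite /= inE x'y'.
Qed.

Lemma touched_edges_le3 x : (#|touched_edges G p c x| <= 3)%N.
Proof.
set T := touched_vertices G p c x.
have sub : touched_edges G p c x \subset [set e : {set V} | e \subset T & #|e| == 2]%SET.
  apply/fintype.subsetP => e ex; rewrite inE (touched_edge_sub Gpc ex) /=.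
  by have [sG _] := Gpc; have /touched_edgesP[/sG ->] := ex.
apply: leq_trans (subset_leq_card sub) _; rewrite cards_draws.
have : (#|T| <= 3)%N := touched_vertices_le3 x.
by case: #|T| => [|[|[|[|]]]].
Qed.

Lemma maximal_ncomp : ncomp G = 1%N.
Proof.
have [V3 _ _] := Gmax.
have [v0 _] : exists v0 : V, v0 \in finset.setT.
  by apply/set0Pn; rewrite -card_gt0 cardsT; apply: leq_trans V3.
rewrite /ncomp (_ : (_ @: _)%SET = [set finset.setT]%SET) ?cards1//.
apply/setP => C; rewrite inE; apply/imsetP/eqP => [[v _ ->]|->].
  by apply/setP => w; rewrite !inE maximal_connected.
by exists v0; rewrite ?inE //; apply/setP => w; rewrite !inE maximal_connected.
Qed.

(** With at most two edges [G] would be a forest with a single face, although each of its edges is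
    touched by two faces. *)
Lemma maximal_ge3 : (3 <= #|G|)%N.
Proof.
have [V3 _ _] := Gmax; have [s fs sz] := euler_formula Gpc.
rewrite maximal_ncomp in sz; have [//|E3] := leqP 3 #|G|.
have s1 : size s = 1%N.
  have leaf := leafy_small Gpc (fintype.subxx G) E3.
  by have := leafy_ncomp (proj1 Gpc) leaf; rewrite maximal_ncomp; lia.
have /set0Pn[e eG] : G != finset.set0 by rewrite -card_gt0; lia.
have := touches_ge2 fs eG; have := count_size (fun x => `[< touches_edge G p c x e >]) s.
by rewrite s1; case: count => [|[|]].
Qed.

Lemma maximal_face_count s : face_reps (full G) s -> (2 * #|G| <= 3 * size s)%N.
Proof.
move=> fs; have [_ sG _ _] := fs.
apply: (@leq_trans (\sum_(x <- s) #|touched_edges G p c x|)).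
  by rewrite sum_touched mulnC -sum_nat_const; apply: leq_sum => e eG; exact: touches_ge2.
rewrite -(count_predT s) -sum1_count big_distrr /=.
by apply: leq_sum => x _; exact: touched_edges_le3.
Qed.

Lemma maximal_edge_count : (#|G| + 6 = 3 * #|V|)%N.
Proof.
have [s fs sz] := euler_formula Gpc; rewrite maximal_ncomp in sz.
have := maximal_face_count fs; have := face_count_le Gpc fs maximal_ge3.
by lia.
Qed.

(** At least three edges but at most three vertices are touched, so there are exactly three vertices
    and all edges between them are touched. *)
Lemma maximal_face x : ~ full G x -> [/\ #|touched_vertices G p c x| = 3%N,
  forall u v, u \in touched_vertices G p c x -> v \in touched_vertices G p c x ->
    u != v -> [set u; v]%SET \in G
  & forall e, (e \in touched_edges G p c x) = (e \in G) && (e \subset touched_vertices G p c x)].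
Proof.
move=> Gx; set T := touched_vertices G p c x; set E := touched_edges G p c x.
pose P := [set e : {set V} | e \subset T & #|e| == 2]%SET.
have EP : E \subset P.
  apply/fintype.subsetP => e ex; rewrite inE (touched_edge_sub Gpc ex) /=.
  by have [sG _] := Gpc; have /touched_edgesP[/sG ->] := ex.
have E3 : (3 <= #|E|)%N := touched_ge3 Gpc maximal_ge3 Gx.
have T3 : #|T| = 3%N.
  have := leq_trans E3 (subset_leq_card EP); rewrite cards_draws.
  have : (#|T| <= 3)%N := touched_vertices_le3 x.
  by case: #|T| => [|[|[|[|]]]].
have PE : E = P by apply/eqP; rewrite eqEcard EP cards_draws T3.
split=> //; first by move=> u v; exact: touched_clique.
move=> e; rewrite PE inE andbC; apply/andP/andP => [[e2 eT]|[eG eT]]; split=> //.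
  move/cards2P: e2 => [a [b [ab eab]]]; rewrite eab.
  by apply: (@touched_clique x) => //; apply: (fintype.subsetP eT); rewrite eab !inE eqxx ?orbT.
by have [sG _] := Gpc; rewrite sG.
Qed.

End Maximal.

(** * Lower bound *)

Section TwoHubs.
Variables (R : realType) (V : finType).
Local Notation pt := (R * R)%type.
Variables (G H : {set {set V}}) (p : V -> pt) (c : {set V} -> R -> pt) (a b : V).
Hypothesis GH : labeled_plane_saturated_subgraph G H p c.
Hypothesis leaf : leafy [set e in G | (a \notin e) && (b \notin e)]%SET.
Hypothesis hubs : forall v, v != a -> v != b -> [set v; a]%SET \in G /\ [set v; b]%SET \in G.

Local Notation full E := (drawing p c finset.setT E).

(* Away from the hubs the graph is a forest, which cannot bound a face. *)
Lemma face_touches_hub z : ~ full H z ->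
  touches (full H) z (p a) \/ touches (full H) z (p b).
Proof.
move=> Hz; apply: contrapT => /not_orP[na nb].
have [Hpc HG _] := GH.
pose L := [set e in H | (a \notin e) && (b \notin e)]%SET.
have LH : L \subset H by apply/fintype.subsetP => e; rewrite inE => /andP[].
have leafL : leafy L.
  move=> E EL; apply: leaf; apply: fintype.subset_trans EL _.
  by apply/fintype.subsetP => e; rewrite !inE => /andP[/(fintype.subsetP HG) -> ->].
have Lpc := plane_sub LH Hpc.
pose S := (~: [set a; b])%SET.
have subS : drawing p c S L `<=` full L by apply: drawing_sub => //; exact: finset.subsetT.
have nS v : v \notin S -> ~ touches (full H) z (p v).
  by rewrite finset.in_setC negbK !inE => /orP[]/eqP ->.
have nE f : f \in H -> f \notin L -> ~ touches_edge H p c z f.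
  move=> fH fL zf; move: fL; rewrite inE fH /= negb_and !negbK => /orP[]vf.
    by apply: na; exact: (touches_edge_vertex Hpc fH vf).
  by apply: nb; exact: (touches_edge_vertex Hpc fH vf).
have Sa : ~ drawing p c S L (p a).
  move=> [[v /= vS /(p_inj Hpc) va]|[e /= eL]]; first by move: vS; rewrite va !inE eqxx.
  move=> /(vertex_on Hpc a (fintype.subsetP LH e eL)) ae.
  by move: eL; rewrite inE ae andbF.
have [r r0 Sr] := compact_far (drawing_compact Hpc (S := S) LH) Sa.
have [y ya Ly] := full_empty_interior Lpc (p a) r0.
have Lz : ~ full L z by apply: contra_not Hz; apply: drawing_sub.
have Sza : joined (drawing p c S L) z (p a).
  apply: joined_trans (joined_sub subS (leafy_nonsep Lpc leafL Lz Ly)) _.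
  apply: (@joined_ball _ _ (p a) r) => //; last by rewrite subrr normr0.
  by move=> w Sw wa; apply: Sr; exists w => //; rewrite distrC.
have [_] := joined_out (face_boundary Hpc LH Hz nE nS Sza).
by apply; exact: full_vertex.
Qed.

(** Some face touches [v], and this face also touches a hub; if both hub edges of [v] were missing,
    the one to this hub could be added. *)
Lemma hub_edge v : v != a -> v != b -> [set v; a]%SET \in H \/ [set v; b]%SET \in H.
Proof.
move=> va vb; have [Hpc HG Hsat] := GH; have [vaG vbG] := hubs va vb.
have [s fs _] := euler_formula Hpc; have [_ sH _ _] := fs.
have [z zs tv] := some_face_touches Hpc (p v) fs.
apply: contrapT => /not_orP[/negP vaH /negP vbH].
case: (face_touches_hub (sH z zs)) => t.
  by apply: (Hsat [set v; a]%SET); rewrite ?inE ?vaG ?vaH //; exact: (touched_addable Hpc tv t va vaH).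
by apply: (Hsat [set v; b]%SET); rewrite ?inE ?vbG ?vbH //; exact: (touched_addable Hpc tv t vb vbH).
Qed.

Lemma hubs_card : (#|V| <= #|H| + 2)%N.
Proof.
pose U := (~: [set a; b])%SET.
pose f v := if [set v; a]%SET \in H then [set v; a]%SET else [set v; b]%SET.
have UP v : v \in U -> v != a /\ v != b by rewrite !inE negb_or => /andP[].
have fU : {in U &, injective f}.
  move=> v w /UP[va vb] /UP[wa wb] E.
  have : v \in f w by rewrite -E /f; case: ifP; rewrite !inE eqxx.
  by rewrite /f; case: ifP; rewrite !inE ?(negbTE va) ?(negbTE vb) orbF => _ /eqP.
have fH : f @: U \subset H.
  apply/fintype.subsetP => e /imsetP[v /UP[va vb] ->]; rewrite /f.
  by case: ifP => // vaH; case: (hub_edge va vb); rewrite ?vaH.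
have := subset_leq_card fH; rewrite card_in_imset // => UH.
rewrite -(cardsC [set a; b]%SET) addnC; apply: leq_add UH _.
by rewrite cards2; case: eqP.
Qed.

End TwoHubs.

(** * A straight-line drawing of the hub graph and its number of edges *)

Section HubGraph.
Variable R : realType.
Local Notation pt := (R * R)%type.

(* The join of an edge (the hubs 0 and 1) and a path (2, 3, ..., n - 1). *)
Definition hub_adj (i j : nat) := ((i < j) && ((i <= 1) || (j == i.+1)))%N.

(** The path goes up the axis between the two hubs, above the segment that joins them. *)
Definition hub_pos (i : nat) : pt :=
  match i with 0 => (-1, 0) | 1 => (1, 0) | k.+2 => (0, k.+1%:R) end.

Definition hub_segment (i j : nat) (t : R) : pt :=
  ((1 - t) * (hub_pos i).1 + t * (hub_pos j).1,
   (1 - t) * (hub_pos i).2 + t * (hub_pos j).2).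

Lemma hub_segment0 i j : hub_segment i j 0 = hub_pos i.
Proof. by rewrite /hub_segment subr0 !mul0r !mul1r !addr0 -surjective_pairing. Qed.

Lemma hub_segment1 i j : hub_segment i j 1 = hub_pos j.
Proof. by rewrite /hub_segment subrr !mul0r !mul1r !add0r -surjective_pairing. Qed.

Lemma hub_pos_inj : injective hub_pos.
Proof.
by move=> [|[|i]] [|[|j]] //= []; try (by move=> *; exfalso; lra);
  move=> /eqP; rewrite eqr_nat => /eqP[->].
Qed.

Lemma hub_adjP i j : hub_adj i j ->
  [\/ i = 0 /\ j = 1, exists2 k, i = 0 & j = k.+2, exists2 k, i = 1 & j = k.+2
    | exists2 k, i = k.+2 & j = k.+3]%N.
Proof.
move: i j => [|[|i]] [|[|j]] //=; rewrite /hub_adj //=.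
- by move=> _; constructor 1.
- by move=> _; constructor 2; exists j.
- by move=> _; constructor 3; exists j.
- by move=> /andP[_ /eqP[->]]; constructor 4; exists i.
Qed.

Let ge0 m : (0 : R) <= m%:R. Proof. exact: ler0n. Qed.

Let S1 m : (m.+1%:R : R) = m%:R + 1. Proof. by rewrite -addn1 natrD. Qed.

Let nat_gap m n (s : R) : 0 <= s <= 1 -> m%:R = n%:R + s :> R ->
  s = 0 /\ m = n \/ s = 1 /\ m = n.+1.
Proof.
move=> /andP[s0 s1] E.
have nm : (n <= m)%N by rewrite -(ler_nat R) E lerDl.
have mn : (m <= n.+1)%N by rewrite -(ler_nat R) E S1 lerD2l.
have [E'|nm'] := eqVneq m n; first by left; split=> //; move: E; rewrite E'; lra.
have E' : m = n.+1 by lia.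
by right; split=> //; move: E; rewrite E' S1; lra.
Qed.

Let nat_eq m n : m.+1%:R = n.+1%:R :> R -> m = n.
Proof. by move=> /eqP; rewrite eqr_nat => /eqP[]. Qed.

Let mul_nat0 (s : R) n : s * n.+1%:R = 0 -> s = 0.
Proof. by move/eqP; rewrite mulf_eq0 pnatr_eq0 orbF => /eqP. Qed.

Lemma hub_segment_vertex i j k t : hub_adj i j -> 0 <= t <= 1 ->
  hub_segment i j t = hub_pos k -> k = i \/ k = j.
Proof.
move=> /hub_adjP H tI; have /andP[t0 t1] := tI.
case: H => [[-> ->]|[m -> ->]|[m -> ->]|[m -> ->]];
  case: k => [|[|k]]; rewrite /hub_segment /= => -[E1 E2];
  try (by left); try (by right).
- by exfalso; have := ge0 k; rewrite S1 in E2; lra.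
- by exfalso; lra.
- right; have Et : t = 1 by lra.
  by congr _.+2; apply: nat_eq; move: E2; rewrite Et !S1 => E2; lra.
- by exfalso; lra.
- right; have Et : t = 1 by lra.
  by congr _.+2; apply: nat_eq; move: E2; rewrite Et !S1 => E2; lra.
- by exfalso; lra.
- by exfalso; lra.
- have [|[_ [->]]|[_ [->]]] := @nat_gap k.+1 m.+1 t tI; [|by left|by right].
  by move: E2; rewrite (S1 m.+1); lra.
Qed.

Lemma hub_segment_cross i j k l t s : hub_adj i j -> hub_adj k l ->
  0 <= t <= 1 -> 0 <= s <= 1 -> hub_segment i j t = hub_segment k l s ->
  i = k /\ j = l \/
  exists v, [/\ hub_segment i j t = hub_pos v, v = i \/ v = j & v = k \/ v = l].
Proof.
wlog ik : i j k l t s / (i <= k)%N.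
  move=> W ij kl tI sI E; have [ik|/ltnW ki] := leqP i k; first exact: (W _ _ _ _ t s).
  have [[-> ->]|[v [Ev vk vi]]] := W k l i j s t ki kl ij sI tI (esym E); first by left.
  by right; exists v; split; rewrite ?E.
move=> ij kl tI sI; have /andP[t0 t1] := tI; have /andP[s0 s1] := sI.
have at0 v : t = 0 -> v = i -> v = k \/ v = l ->
    exists v, [/\ hub_segment i j t = hub_pos v, v = i \/ v = j & v = k \/ v = l].
  by move=> -> vi vkl; exists v; split=> //; [rewrite vi hub_segment0|left].
have at1 v : t = 1 -> v = j -> v = k \/ v = l ->
    exists v, [/\ hub_segment i j t = hub_pos v, v = i \/ v = j & v = k \/ v = l].
  by move=> -> vj vkl; exists v; split=> //; [rewrite vj hub_segment1|right].
case/hub_adjP: ij ik at0 at1 => [[-> ->]|[m -> ->]|[m -> ->]|[m -> ->]];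
  case/hub_adjP: kl => [[-> ->]|[n -> ->]|[n -> ->]|[n -> ->]] //= ik at0 at1 [E1 E2].
- by left.
- right; have Es : s = 0 by apply: (@mul_nat0 _ n); lra.
  by apply: (at0 0); [lra| |left].
- right; have Es : s = 0 by apply: (@mul_nat0 _ n); lra.
  by apply: (at1 1); [lra| |left].
- by exfalso; rewrite !S1 in E2; have := ge0 n; lra.
- right; have Et : t = 0 by apply: (@mul_nat0 _ m); lra.
  by apply: (at0 0); [lra| |left].
- have [t_0|t_0] := eqVneq t 0; first by right; apply: (at0 0); [lra| |left].
  left; split=> //; congr _.+2; apply: nat_eq; apply: (mulfI t_0).
  have Es : s = t by lra.
  by move: E2; rewrite Es => E2; lra.
- right; apply: (at1 m.+2) => //; first lra.
  have Et : t = 1 by lra.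
  have Es : s = 1 by lra.
  move: E2; rewrite Et Es => E2; right.
  by congr _.+2; apply: nat_eq; move: E2; rewrite !S1 => E2; lra.
- right; apply: (at1 m.+2) => //; first lra.
  have Et : t = 1 by lra.
  move: E2; rewrite Et (S1 n.+1) => E2.
  by have [|[_ [->]]|[_ [->]]] := @nat_gap m.+1 n.+1 s sI; [lra|left|right].
- have [t_0|t_0] := eqVneq t 0; first by right; apply: (at0 1); [lra| |left].
  left; split=> //; congr _.+2; apply: nat_eq; apply: (mulfI t_0).
  have Es : s = t by lra.
  by move: E2; rewrite Es => E2; lra.
- right; apply: (at1 m.+2) => //; first lra.
  have Et : t = 1 by lra.
  move: E2; rewrite Et (S1 n.+1) => E2.
  by have [|[_ [->]]|[_ [->]]] := @nat_gap m.+1 n.+1 s sI; [lra|left|right].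
- have mn : (m.+1%:R : R) <= n.+1%:R by rewrite ler_nat.
  move: E2; rewrite (S1 m.+1) (S1 n.+1) => E2.
  have [||[_ [->]]|[ts [nm]]] := @nat_gap n.+1 m.+1 (t - s); [lra|lra|by left|].
  by subst n; right; apply: (at1 m.+3) => //; [lra|left].
Qed.

Section Drawing.
Variable n : nat.
Hypothesis n3 : (3 <= n)%N.

Definition hub_graph : {set {set 'I_n}} :=
  [set e | [exists i : 'I_n, exists j : 'I_n, hub_adj i j && (e == [set i; j]%SET)]]%SET.

Lemma hub_graphP e :
  reflect (exists i j : 'I_n, hub_adj i j /\ e = [set i; j]%SET) (e \in hub_graph).
Proof.
rewrite inE; apply: (iffP existsP) => [[i /existsP[j /andP[ij /eqP ->]]]|[i [j [ij ->]]]].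
  by exists i, j.
by exists i; apply/existsP; exists j; rewrite ij eqxx.
Qed.

Lemma hub_adj_neq (i j : 'I_n) : hub_adj i j -> i != j.
Proof. by move=> /andP[ij _]; rewrite -val_eqE neq_ltn ij. Qed.

Lemma hub_planar : planar R hub_graph.
Proof.
have ends e : exists ij : 'I_n * 'I_n, e \in hub_graph -> hub_adj ij.1 ij.2 /\ e = [set ij.1; ij.2]%SET.
  have [/hub_graphP[i [j ijP]]|eG] := boolP (e \in hub_graph); first by exists (i, j).
  by exists (Ordinal n3, Ordinal n3).
have [d dP] := choice ends.
exists (fun i : 'I_n => hub_pos i), (fun (e : {set 'I_n}) t => hub_segment (d e).1 (d e).2 t).
split=> [e /hub_graphP[i [j [/hub_adj_neq ij ->]]]|]; first by rewrite cards2 ij.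
split=> [i j /hub_pos_inj/val_inj //|e eG|e v eG|e f eG fG ef w].
- have [ij eE] := dP e eG; move: ij eE; case: (d e) => [i j] /= ij eE.
  have pij : hub_pos i <> hub_pos j.
    by move/hub_pos_inj/val_inj => E; have := hub_adj_neq ij; rewrite E eqxx.
  split; first split.
  + apply: continuous_subspaceT => t.
    have lin (a b : R) : (fun s : R => (1 - s) * a + s * b) @ t --> (1 - t) * a + t * b.
      apply: cvgD; apply: cvgM; first apply: cvgB;
        by [exact: cvg_cst|exact: cvg_id].
    exact: cvg_pair (lin _ _) (lin _ _).
  + move=> t s _ _ [E1 E2]; apply: contrapT => ts; apply: pij.
    have ts0 : t - s != 0 by rewrite subr_eq0; exact/eqP.
    rewrite [LHS]surjective_pairing [RHS]surjective_pairing.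
    by congr (_, _); apply: (mulfI ts0); lra.
  + rewrite hub_segment0 hub_segment1 eE; apply/seteqP; split=> w /=.
      by move=> [] ->; [exists i|exists j]; rewrite //= !inE eqxx ?orbT.
    by move=> [v /=]; rewrite !inE => /orP[]/eqP -> <-; [left|right].
- have [ij eE] := dP e eG => -[t /=]; rewrite in_itv /= => tI.
  move=> /(hub_segment_vertex ij tI) vij; rewrite eE !inE.
  by case: vij => /val_inj ->; rewrite eqxx ?orbT.
- have [ij eE] := dP e eG; have [kl fE] := dP f fG.
  move=> [[t /=]]; rewrite in_itv /= => tI <- [s /=]; rewrite in_itv /= => sI E.
  have [[/val_inj E1 /val_inj E2]|[v [Ev vij vkl]]] := hub_segment_cross ij kl tI sI (esym E).
    by case/eqP: ef; rewrite eE fE E1 E2.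
  rewrite Ev eE fE; case: vij => vE; rewrite vE; [exists (d e).1|exists (d e).2] => //=;
    by rewrite !inE eqxx ?orbT /=; case: vkl; rewrite vE => /val_inj ->; rewrite eqxx ?orbT.
Qed.

Lemma sum_minn3 : (3 * n <= \sum_(j < n) minn j 3 + 6)%N.
Proof.
rewrite -(subnK n3) addn3.
elim: (n - 3)%N => [|m IH]; first by rewrite !big_ord_recr big_ord0.
rewrite big_ord_recr /= (minn_idPr _) //; move: IH.
by move: (\sum_(j < _) _)%N => S; clear; lia.
Qed.

(** The smaller neighbours of [j] are 0, 1 and [j - 1], as far as these are distinct and below [j];
    the bounds add up to [3 * n - 6]. *)
Lemma hub_indegree (j : 'I_n) : (minn j 3 <= #|[pred i : 'I_n | hub_adj i j]|)%N.
Proof.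
pose o k (kn : (k < n)%N) := Ordinal kn.
have jn := ltn_ord j; case: j jn => -[|[|[|j]]] jn' jn /=; first by rewrite min0n.
- have n0 : (0 < n)%N by lia.
  apply: (@leq_trans #|[set o 0 n0]|%SET); first by rewrite cards1.
  by apply: subset_leq_card; apply/fintype.subsetP => i; rewrite !inE => /eqP ->.
- have n0 : (0 < n)%N by lia.
  have n1 : (1 < n)%N by lia.
  apply: (@leq_trans #|[set o 0 n0; o 1 n1]|%SET); first by rewrite cards2.
  by apply: subset_leq_card; apply/fintype.subsetP => i; rewrite !inE => /orP[]/eqP ->.
- have n0 : (0 < n)%N by lia.
  have n1 : (1 < n)%N by lia.
  have n2 : (j.+2 < n)%N by lia.
  apply: (@leq_trans #|[set o 0 n0; o 1 n1; o j.+2 n2]|%SET).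
    by rewrite finset.setUC cardsU1 cards2 !inE /= geq_minr.
  apply: subset_leq_card; apply/fintype.subsetP => i; rewrite !inE.
  by move=> /orP[/orP[]|] /eqP ->; rewrite /hub_adj /= ?ltnSn ?eqxx ?orbT.
Qed.

Lemma hub_card : (3 * n <= #|hub_graph| + 6)%N.
Proof.
pose P := [set ji : 'I_n * 'I_n | hub_adj ji.2 ji.1]%SET.
pose f (ji : 'I_n * 'I_n) := [set ji.2; ji.1]%SET.
have finj : {in P &, injective f}.
  move=> [j i] [l k]; rewrite !inE /= => /andP[ij _] /andP[kl _] /setP E.
  have Ei := E i; have Ej := E j; have El := E l; have Ek := E k.
  move: Ei Ej El Ek; rewrite !inE !eqxx ?orbT /= -!val_eqE /=.
  move=> /esym/orP Hi /esym/orP Hj /orP Hl /orP Hk.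
  by congr (_, _); apply: val_inj => /=; move: ij kl Hi Hj Hl Hk; clear; lia.
have fP : f @: P \subset hub_graph.
  apply/fintype.subsetP => e /imsetP[[j i]]; rewrite inE /= => ij ->.
  by apply/hub_graphP; exists i, j.
have PG := subset_leq_card fP; rewrite card_in_imset // in PG.
apply: leq_trans sum_minn3 _; rewrite leq_add2r; apply: leq_trans PG.
rewrite -sum1_card (eq_bigl (fun ji : 'I_n * 'I_n => true && hub_adj ji.2 ji.1)); last first.
  by move=> ji; rewrite inE.
rewrite -(pair_big_dep xpredT (fun j i : 'I_n => hub_adj i j) (fun _ _ => 1%N)) /=.
by apply: leq_sum => j _; rewrite sum1_card; exact: hub_indegree.
Qed.

(** The number of edges already reaches the maximum [3 * n - 6] of a planar graph. *)
Lemma hub_maximal : maximal_planar R hub_graph.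
Proof.
split; [by rewrite card_ord|exact: hub_planar|move=> e e2 eG [p [c Gpc]]].
have := planar_edge_bound Gpc; rewrite cardsU1 eG.
have : (#|finset.cover (e |: hub_graph)| <= n)%N by rewrite -[X in (_ <= X)%N]card_ord max_card.
by have := hub_card; lia.
Qed.

Lemma hub_leafy (a b : 'I_n) : val a = 0%N -> val b = 1%N ->
  leafy [set e in hub_graph | (a \notin e) && (b \notin e)]%SET.
Proof.
move=> a0 b1 E EL /set0Pn[e0 e0E].
have EP e : e \in E -> exists i j : 'I_n, e = [set i; j]%SET /\ val j = (val i).+1.
  move=> /(fintype.subsetP EL); rewrite inE => /andP[/hub_graphP[i [j [+ ->]]]].
  rewrite !inE !negb_or -!val_eqE /= a0 b1 => ij H; exists i, j; split=> //.
  by move: ij H; rewrite /hub_adj; lia.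
(* Away from the hubs only edges of the path remain; the upper end of the topmost edge in [E] is a
   leaf. *)
case: (arg_maxnP (fun e : {set 'I_n} => \max_(v in e) (val v))%N e0E) => e eE emax.
have [i [j [eij ij]]] := EP e eE.
exists e => //; exists j; first by rewrite eij !inE eqxx orbT.
move=> f fE fe; apply/negP => jf; have [k [l [fkl kl]]] := EP f fE.
have le_max (v : 'I_n) (g : {set 'I_n}) : v \in g -> (v <= \max_(w in g) val w)%N.
  by move=> vg; rewrite (bigD1 v) //= leq_max leqnn.
have maxe : (\max_(w in e) val w <= j)%N.
  by apply/bigmax_leqP => w; rewrite eij !inE => /orP[]/eqP -> //; rewrite ij.
have := leq_trans (leq_trans (le_max l f _) (emax f fE)) maxe.
rewrite fkl !inE eqxx orbT => /(_ isT) lj.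
move: jf; rewrite fkl !inE => /orP[]/eqP E'.
  by move: lj; rewrite kl E' ltnn.
have ki : k = i by apply: val_inj; move: kl; rewrite -E' ij => -[].
by case/eqP: fe; rewrite fkl eij E' ki.
Qed.

(** The bounds [n - 2] and [3 * n - 6] have ratio exactly 1/3, so no error term arises on this
    side. *)
Lemma lpsr_hub : 1 / 3 <= lpsr R hub_graph :> R.
Proof.
have [H [p [c [GH ->]]]] := lpsr_attained hub_planar.
have n0 : (0 < n)%N by lia.
have n1 : (1 < n)%N by lia.
have Hn : (n <= #|H| + 2)%N.
  rewrite -{1}(card_ord n); apply: (hubs_card GH (a := Ordinal n0) (b := Ordinal n1)).
    exact: hub_leafy.
  move=> v; rewrite -!val_eqE /= => v0 v1; split; rewrite finset.setUC; apply/hub_graphP.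
    by exists (Ordinal n0), v; split=> //; rewrite /hub_adj /=; lia.
  by exists (Ordinal n1), v; split=> //; rewrite /hub_adj /=; lia.
have Gn : (#|hub_graph| + 6 <= 3 * n)%N.
  have [p' [c' Gpc]] := hub_planar; have G3 := maximal_ge3 hub_maximal Gpc.
  apply: leq_trans (planar_edge_bound Gpc G3) _.
  by rewrite leq_mul2l /= -[X in (_ <= X)%N]card_ord max_card.
have G0 : (0 < #|hub_graph|)%N by have := hub_card; lia.
have GH3 : (#|hub_graph| <= 3 * #|H|)%N by lia.
rewrite ler_pdivlMr ?ltr0n // mulrAC ler_pdivrMr ?ltr0n // mul1r mulrC -natrM ler_nat.
by [].
Qed.

End Drawing.

Lemma max_lpsr_ge n : (3 <= n)%N -> 1 / 3 <= max_lpsr R n :> R.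
Proof. by move=> n3; exact: le_trans (lpsr_hub n3) (lpsr_le_max (hub_maximal n3)). Qed.

End HubGraph.

(** * Upper bound *)

Section Sparse.
Variables (R : realType) (V : finType).
Variables (G : {set {set V}}) (p : V -> R * R) (c : {set V} -> R -> R * R).
Hypothesis Gpc : plane_graph G p c.

Definition inside (E : {set {set V}}) (S : {set V}) := [set e in E | e \subset S]%SET.
Definition nbr (E : {set {set V}}) v := [set u | [set v; u]%SET \in E]%SET.
Definition common (E : {set {set V}}) (e : {set V}) :=
  [set v | [forall x in e, [set v; x]%SET \in E]]%SET.

Lemma insideP (E : {set {set V}}) (S e : {set V}) : reflect (e \in E /\ e \subset S) (e \in inside E S).
Proof. by rewrite inE; exact: andP. Qed.

Lemma inside_lt (S : {set V}) : S != finset.set0 -> (#|inside G S| < 3 * #|S|)%N.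
Proof.
rewrite -card_gt0 => S0; have [E3|E3] := leqP 3 #|inside G S|; last by lia.
have sub : inside G S \subset G by apply/fintype.subsetP => e /insideP[].
have := planar_edge_bound (plane_sub sub Gpc) E3.
have : (#|finset.cover (inside G S)| <= #|S|)%N.
  by apply: subset_leq_card; apply/finset.bigcupsP => e /insideP[].
by lia.
Qed.

Lemma inside_le (S : {set V}) : (#|inside G S| <= 3 * #|S|)%N.
Proof.
have [->|S0] := eqVneq S finset.set0; last exact: ltnW (inside_lt S0).
rewrite cards0 muln0 leqn0 cards_eq0; apply/eqP/setP => e; rewrite [RHS]inE; apply/negbTE/negP.
move=> /insideP[eG]; rewrite finset.subset0 => /eqP e0.
by have [sG _] := Gpc; have := sG e eG; rewrite e0 cards0.
Qed.

Lemma nbr_neq u v : u \in nbr G v -> u != v.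
Proof.
rewrite inE => /(proj1 Gpc); apply: contra_eq_neq => ->.
by rewrite finset.setUid cards1.
Qed.

Lemma degree_sum (S : {set V}) : (\sum_(v in S) #|nbr G v :&: S| <= 2 * #|inside G S|)%N.
Proof.
have deg v : v \in S -> (#|nbr G v :&: S| <= \sum_(e in inside G S) (v \in e))%N.
  move=> vS; have inj : {in nbr G v :&: S &, injective (fun u => [set v; u]%SET)}.
    move=> u w; rewrite !inE => /andP[uv _] /andP[wv _] /setP/(_ u).
    have := nbr_neq (v := v) (u := u); rewrite inE => /(_ uv) /negbTE uv'.
    by rewrite !inE eqxx uv' /= => /esym/eqP.
  rewrite -(card_in_imset inj) -sum1_card [X in (X <= _)%N]big_mkcond [X in (_ <= X)%N]big_mkcond /=.
  apply: leq_sum => e _; case: ifP => // /imsetP[u]; rewrite !inE => /andP[uv uS] ->.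
  by rewrite uv finset.subUset !finset.sub1set vS uS !inE eqxx.
apply: (@leq_trans (\sum_(v in S) \sum_(e in inside G S) (v \in e))%N); first exact: leq_sum.
rewrite exchange_big /= mulnC -sum_nat_const.
apply: leq_sum => e /insideP[eG _]; have [sG _] := Gpc; rewrite -(sG e eG) -sum1_card.
by rewrite [X in (X <= _)%N]big_mkcond [X in (_ <= X)%N]big_mkcond; apply: leq_sum => v _; case: ifP; case: ifP.
Qed.

Lemma low_degree (S : {set V}) : S != finset.set0 -> exists2 v, v \in S & (#|nbr G v :&: S| <= 5)%N.
Proof.
move=> S0; apply: contrapT => none.
have : (6 * #|S| <= \sum_(v in S) #|nbr G v :&: S|)%N.
  rewrite mulnC -sum_nat_const; apply: leq_sum => v vS; rewrite leqNgt; apply/negP => lt.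
  by apply: none; exists v.
by have := degree_sum S; have := inside_lt S0; lia.
Qed.

(** Colour everything except a vertex with at most 5 neighbours in [S], and give it a colour that is
    left. *)
Lemma six_coloring : exists col : V -> 'I_6, forall u v, [set u; v]%SET \in G -> col u != col v.
Proof.
suff H (S : {set V}) : exists col : V -> 'I_6, forall u v, u \in S -> v \in S ->
    [set u; v]%SET \in G -> col u != col v.
  by have [col colP] := H finset.setT; exists col => u v; apply: colP; rewrite inE.
have [k] := ubnP #|S|; elim: k S => // k IH S Sk.
have [->|S0] := eqVneq S finset.set0; first by exists (fun _ => ord0) => u v; rewrite inE.
have [v vS v5] := low_degree S0.
have [|col colP] := IH (S :\ v); first by move: Sk; rewrite (cardsD1 v S) vS.
have [x xP] : exists x, x \notin col @: (nbr G v :&: S).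
  apply: contrapT => none; have : (6 <= #|col @: (nbr G v :&: S)|)%N.
    rewrite -[X in (X <= _)%N](card_ord 6); apply: subset_leq_card; apply/fintype.subsetP => x _.
    by apply/negPn/negP => xP; apply: none; exists x.
  by move/leq_trans/(_ (leq_imset_card _ _)); rewrite leqNgt ltnS v5.
have new u : u \in S -> [set v; u]%SET \in G -> col u != x.
  by move=> uS vu; apply: contraNneq xP => <-; apply: imset_f; rewrite !inE vu.
exists (fun u => if u == v then x else col u) => u w uS wS uw.
have [uv|uv] := eqVneq u v; have [wv|wv] := eqVneq w v.
- by move: uw; rewrite uv wv => vv; have := @nbr_neq v v; rewrite inE vv eqxx => /(_ isT).
- by rewrite eq_sym; apply: new; rewrite -?uv.
- by apply: new; rewrite // finset.setUC -wv.
- by apply: colP => //; rewrite !inE ?uv ?wv.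
Qed.

(** Both ends of such an edge have degree above [#|V| / q]. The degrees add up to at most
    [6 * #|V|], so there are at most [6 * q] such vertices, and they span at most three times as
    many edges. *)
Lemma heavy_edges_le q : (#|[set e in G | (#|V| < q * #|common G e|)%N]%SET| <= 18 * q)%N.
Proof.
pose D := [set v | (#|V| < q * #|nbr G v|)%N]%SET.
apply: (@leq_trans #|inside G D|).
  apply: subset_leq_card; apply/fintype.subsetP => e; rewrite !inE => /andP[-> h] /=.
  apply/fintype.subsetP => v ve; rewrite inE; apply: leq_trans h _.
  rewrite leq_mul2l; apply/orP; right; apply: subset_leq_card.
  by apply/fintype.subsetP => u; rewrite !inE finset.setUC => /forall_inP; exact.
have [V0|V0] := posnP #|V|.
  have -> : inside G D = finset.set0.
    apply/setP => e; rewrite [RHS]inE; apply/negbTE/negP => /insideP[eG _].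
    have [sG _] := Gpc; have := sG e eG; have := max_card e; rewrite V0.
    by case: #|e|.
  by rewrite cards0.
have D6 : (#|D| * #|V| <= 6 * q * #|V|)%N.
  rewrite -sum_nat_const; apply: (@leq_trans (\sum_(v in D) q * #|nbr G v|)%N).
    by apply: leq_sum => v; rewrite inE => /ltnW.
  apply: (@leq_trans (q * \sum_(v in finset.setT) #|nbr G v :&: finset.setT|)%N).
    rewrite big_distrr /= [X in (X <= _)%N]big_mkcond [X in (_ <= X)%N]big_mkcond /=.
    by apply: leq_sum => v _; rewrite finset.in_setT finset.setIT; case: ifP.
  rewrite mulnAC mulnC leq_mul2r; apply/orP; right.
  apply: leq_trans (degree_sum _) _; have := inside_le finset.setT; rewrite cardsT.
  by move: #|_| #|V| => i n; clear; lia.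
have := inside_le D; rewrite leq_pmul2r // in D6; lia.
Qed.

End Sparse.

(** * Saturated extensions and the collapse of colour classes into faces *)

Section Saturate.
Variables (R : realType) (V : finType).

(** Edges are added as long as possible. The curves already drawn are kept, so that the triangles
    still bound the same faces afterwards. *)
Lemma saturate (G H0 : {set {set V}}) p (c : {set V} -> R -> R * R) :
  H0 \subset G -> plane_graph H0 p c ->
  exists (H : {set {set V}}) c', [/\ H0 \subset H, labeled_plane_saturated_subgraph G H p c'
    & forall e, e \in H0 -> c' e = c e].
Proof.
have [k] := ubnP #|G :\: H0|; elim: k H0 c => // k IH H0 c Hk HG Hpc.
have [[e [eGH [g gP]]]|none] := pselect (exists e, e \in G :\: H0 /\ addable H0 p c e); last first.
  by exists H0, c; split=> //; split=> // e eGH eadd; apply: none; exists e.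
have [eG eH] : e \in G /\ e \notin H0 by move: eGH; rewrite inE => /andP[].
have [||H [c' [HH GH c'P]]] := IH _ _ _ _ gP.
- rewrite -ltnS; apply: leq_trans Hk; rewrite ltnS; apply: proper_card; apply/properP.
  split; first by apply: finset.setDS; exact: finset.subsetUr.
  by exists e; rewrite // !inE eqxx.
- by rewrite finset.subUset finset.sub1set eG.
exists H, c'; split=> //; first exact: fintype.subset_trans (finset.subsetUr _ _) HH.
move=> f fH; rewrite c'P ?inE ?fH ?orbT //; case: eqP => // fe.
by move: eH; rewrite -fe fH.
Qed.

End Saturate.

Section Collapse.
Variables (R : realType) (V : finType) (I : finType).
Local Notation pt := (R * R)%type.
Variables (G : {set {set V}}) (p : V -> pt) (c : {set V} -> R -> pt).
Hypothesis Gpc : plane_graph G p c.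
Variables (x : I -> pt) (col : V -> I).
Hypothesis Gx : forall i, ~ drawing p c finset.setT G (x i).
Hypothesis xJ : forall i j, joined (drawing p c finset.setT G) (x i) (x j) -> i = j.
Hypothesis colP : forall u v, [set u; v]%SET \in G -> col u != col v.

Local Notation full E := (drawing p c finset.setT E).

Let T i := touched_vertices G p c (x i).
Let U := [set v | [exists i, v \in T i]]%SET.
Let E0 := [set e | [exists i, e \in touched_edges G p c (x i)]]%SET.

Let E0P (e : {set V}) : e \in E0 -> e \in G /\ exists i, e \subset T i.
Proof.
rewrite inE => /existsP[i ei]; have /touched_edgesP[eG _] := ei.
by split=> //; exists i; exact: touched_edge_sub.
Qed.

Let TU i : T i \subset U.
Proof. by apply/fintype.subsetP => v vT; rewrite inE; apply/existsP; exists i. Qed.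

Lemma placement : exists p' : V -> pt, [/\ injective p', forall v, v \in U -> p' v = p v
  & forall v, v \notin U -> joined (full G) (x (col v)) (p' v)].
Proof.
suff /choice[r rP] : forall i, exists r, 0 < r /\ forall w, full G w -> `|w - x i| < r -> False.
  (* Offsets smaller than the clearance of the face point, and distinct within a colour class
     because the ranks are distinct. *)
  pose d v : R := r (col v) * (enum_rank v)%:R / #|V|.+1%:R.
  pose q v : pt := ((x (col v)).1 + d v, (x (col v)).2).
  have qx v : joined (full G) (x (col v)) (q v).
    have [r0 Hr] := rP (col v); apply: (joined_ball Hr); first by rewrite subrr normr0.
    rewrite norm_pt_lt /q /= addrAC !subrr add0r normr0 r0 andbT.
    rewrite /d ger0_norm ?divr_ge0 ?mulr_ge0 ?ler0n ?ltW // -mulrA gtr_pMr //.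
    by rewrite ltr_pdivrMr ?ltr0n // mul1r ltr_nat ltnS ltnW.
  exists (fun v => if v \in U then p v else q v); split=> [u v|v ->//|v /negbTE -> //].
  have pq a b : p a <> q b.
    by move=> E; have [_] := joined_out (qx b); apply; rewrite -E; exact: full_vertex.
  case: ifP => _; case: ifP => _; [exact: (p_inj Gpc)|by move/pq|by move/esym/pq|move=> E].
  have cE : col u = col v.
    by apply: xJ; apply: joined_trans (qx u) _; rewrite E; apply: joined_sym.
  have := congr1 fst E; rewrite /= /d cE => /addrI.
  have [r0 _] := rP (col v).
  have n0 : (#|V|.+1%:R : R) != 0 by rewrite pnatr_eq0.
  move=> /(divIf n0)/(mulfI (lt0r_neq0 r0))/eqP; rewrite eqr_nat => /eqP/val_inj.
  exact: enum_rank_inj.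
move=> i; have [r r0 Hr] := compact_far (drawing_compact Gpc (S := finset.setT) (fintype.subxx G)) (@Gx i).
by exists r; split=> // w Gw wx; apply: Hr; exists w => //; rewrite distrC.
Qed.

Section Placed.
Variable p' : V -> pt.
Hypotheses (p'_inj : injective p') (p'U : forall v, v \in U -> p' v = p v)
  (p'x : forall v, v \notin U -> joined (full G) (x (col v)) (p' v)).

Let E0U (e : {set V}) v : e \in E0 -> v \in e -> v \in U.
Proof. by move=> /E0P[_ [i /fintype.subsetP ei]] /ei; exact/fintype.subsetP/TU. Qed.

Lemma placed_plane : plane_graph E0 p' c.
Proof.
have [sG [_ ends vx edg]] := Gpc.
have im (A : {set V}) : A \subset U -> p' @` [set` A] = p @` [set` A].
  move=> /fintype.subsetP AU; apply/seteqP; split=> w [v vA <-]; exists v => //.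
    by rewrite p'U //; exact: AU.
  by rewrite p'U //; exact: AU.
split=> [e /E0P[/sG]//|]; split=> // [e eE|e v eE|e f eE fE ef].
- have [eG _] := E0P eE; have [cc E] := ends e eG; split=> //; rewrite im //.
  by apply/fintype.subsetP => v; exact: E0U.
- have [eG _] := E0P eE; have [vU|vU] := boolP (v \in U); first by rewrite p'U //; exact: vx.
  by move=> H; have [_] := joined_out (p'x vU); case; exact: (full_trace p eG H).
- have [eG _] := E0P eE; have [fG _] := E0P fE.
  rewrite im; first exact: edg.
  by apply/fintype.subsetP => v; rewrite inE => /andP[/(E0U eE)].
Qed.

Variables (H : {set {set V}}) (c' : {set V} -> R -> pt).
Hypotheses (Hpc : plane_graph H p' c') (HG : H \subset G) (E0H : E0 \subset H)
  (c'E : forall e, e \in E0 -> c' e = c e).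

(* The curve of an edge leaving a collapsed vertex is trapped in the face
   around [x i], whose boundary it can only leave through a vertex of [T i]. *)
Lemma collapsed_edge v w : [set v; w]%SET \in H -> v \notin U -> w \in T (col v).
Proof.
move=> fH vU; apply/negPn/negP => wT; set f := [set v; w]%SET in fH.
have fG := fintype.subsetP HG f fH.
pose E := touched_edges G p c (x (col v)).
have EG : E \subset G by apply/fintype.subsetP => e /touched_edgesP[].
have EE0 e : e \in E -> e \in E0 by move=> eE; rewrite inE; apply/existsP; exists (col v).
have ET e : e \in E -> e \subset T (col v) by exact: touched_edge_sub.
have offT z : z \in f -> z \notin T (col v).
  move=> /set2P[] -> //; apply: contraNN vU; exact: (fintype.subsetP (TU _) v).
have vf : v \in f by rewrite !inE eqxx.
have wf : w \in f by rewrite !inE eqxx orbT.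
have off y : trace (c' f) y -> ~ drawing p c (T (col v)) E y.
  move=> fy [[z /= zT zy]|[e /= eE ey]].
    have zU := fintype.subsetP (TU (col v)) z zT.
    move: fy; rewrite -zy -(p'U zU) => /(vertex_on Hpc z fH) /offT; by rewrite zT.
  have eH := fintype.subsetP E0H e (EE0 e eE).
  have fe : f != e.
    apply: contraTneq (offT v vf) => fe; rewrite negbK.
    by apply: (fintype.subsetP (ET e eE)); rewrite -fe.
  have [|z [zf ze _]] := edges_meet Hpc fH eH fe fy; first by rewrite c'E //; exact: EE0.
  by have := offT z zf; rewrite (fintype.subsetP (ET e eE) z ze).
have vw : joined (drawing p c (T (col v)) E) (p' v) (p' w).
  apply: (joined_chained (drawing_compact Gpc (S := T (col v)) EG) (compact_trace Hpc fH) off).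
  exact: (edge_chained Hpc fH vf wf).
have sub : drawing p c (T (col v)) E `<=` full G by apply: drawing_sub => //; exact: finset.subsetT.
have xw : joined (full G) (x (col v)) (p' w).
  apply: (face_boundary Gpc EG (@Gx _) (S := T (col v))).
  - by move=> e eG eE xe; case/negP: eE; exact/touched_edgesP.
  - by move=> z zT xz; case/negP: zT; exact/touched_verticesP.
  - by apply: joined_trans vw; exact: joined_sub sub (p'x vU).
have wU : w \notin U.
  apply/negP => wU; have [_] := joined_out xw; apply; rewrite p'U //; exact: full_vertex.
(* Both ends were placed in the same face, so they share a colour and cannot be adjacent in [G]. *)
have E' : col v = col w by apply: xJ; apply: joined_trans xw (joined_sym (p'x wU)).
by have := colP fG; rewrite E' eqxx.
Qed.

End Placed.

Lemma collapse : exists (H : {set {set V}}) (p' : V -> pt) c',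
  labeled_plane_saturated_subgraph G H p' c' /\
  forall v w, [set v; w]%SET \in H ->
    (forall i, v \notin touched_vertices G p c (x i)) ->
    w \in touched_vertices G p c (x (col v)).
Proof.
have [p' [p'_inj p'U p'x]] := placement.
have E0G : E0 \subset G by apply/fintype.subsetP => e /E0P[].
have [H [c' [E0H GH c'E]]] := saturate E0G (placed_plane p'_inj p'U p'x).
have [Hpc HG _] := GH.
exists H, p', c'; split=> // v w vw vT; apply: (collapsed_edge p'U p'x Hpc HG E0H c'E vw).
by rewrite inE; apply/existsP => -[i]; apply/negP/vT.
Qed.

End Collapse.

Lemma card_bigcup_le (T I : finType) (P : pred I) (F : I -> {set T}) :
  (#|\bigcup_(i | P i) F i|%SET <= \sum_(i | P i) #|F i|)%N.
Proof.
elim/big_rec2: _ => [|i m A _ IH]; first by rewrite cards0.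
by apply: leq_trans (leq_card_setU _ _).1 _; rewrite leq_add2l.
Qed.

(** * Number of edges after the collapse *)

Section CountCollapsed.
Variables (R : realType) (V : finType).
Variables (G H : {set {set V}}) (p : V -> R * R) (c : {set V} -> R -> R * R).
Hypotheses (Gpc : plane_graph G p c) (HG : H \subset G).
Variables (T : 'I_6 -> {set V}) (col : V -> 'I_6) (q : nat).
Hypothesis T3 : forall i, #|T i| = 3%N.
Hypothesis Tclique : forall i u v, u \in T i -> v \in T i -> u != v -> [set u; v]%SET \in G.
Hypothesis light : forall i e, e \in inside G (T i) -> (q * #|common G e| <= #|V|)%N.
Hypothesis HT : forall v w, [set v; w]%SET \in H -> (forall i, v \notin T i) -> w \in T (col v).

Let inside3 i : (#|inside G (T i)| <= 3)%N.
Proof.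
apply: (@leq_trans #|[set e : {set V} | e \subset T i & #|e| == 2]%SET|).
  apply: subset_leq_card; apply/fintype.subsetP => e /insideP[eG eT]; rewrite inE eT /=.
  by have [sG _] := Gpc; rewrite sG.
by rewrite cards_draws T3.
Qed.

(* Two neighbours of [v] on a triangle make [v] a common neighbour of an edge of it. *)
Let triangle_degree v i :
  (#|nbr G v :&: T i| <= 1 + \sum_(e in inside G (T i)) (v \in common G e))%N.
Proof.
set W := nbr G v :&: T i.
have W3 : (#|W| <= 3)%N by rewrite -(T3 i); apply: subset_leq_card; exact: subsetIr.
apply: (@leq_trans (1 + #|[set e : {set V} | e \subset W & #|e| == 2]%SET|)).
  by rewrite cards_draws; move: #|W| W3 => [|[|[|[|]]]].
rewrite leq_add2l -sum1_card big_mkcond [X in (_ <= X)%N]big_mkcond /=.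
apply: leq_sum => e _; rewrite inE; case: ifP => // /andP[/fintype.subsetP eW /cards2P[a [b [ab eab]]]].
have aW : a \in W by apply: eW; rewrite eab !inE eqxx.
have bW : b \in W by apply: eW; rewrite eab !inE eqxx orbT.
move: aW bW; rewrite ![_ \in W]inE => /andP[va aT] /andP[vb bT].
have -> : e \in inside G (T i).
  apply/insideP; split; first by rewrite eab; exact: Tclique aT bT ab.
  by rewrite eab; apply/fintype.subsetP => z /set2P[] ->.
rewrite inE lt0b; apply/forall_inP => z; rewrite eab => /set2P[] ->.
  by move: va; rewrite inE.
by move: vb; rewrite inE.
Qed.

(** The six triangles have at most 18 vertices, which span at most [3 * 18 = 54] edges. Every other
    vertex contributes at most one edge, plus one for each edge of its triangle of which it is a
    common neighbour; each of the at most 18 triangle edges has at most [#|V| / q] common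
    neighbours. *)
Lemma collapsed_card : (q * #|H| <= q * (54 + #|V|) + 18 * #|V|)%N.
Proof.
pose U := (\bigcup_i T i)%SET.
have U18 : (#|U| <= 18)%N.
  apply: leq_trans (card_bigcup_le _ _) _; rewrite (eq_bigr (fun _ => 3%N)) //.
  by rewrite sum_nat_const card_ord.
pose star v := ((fun w => [set v; w]%SET) @: (nbr G v :&: T (col v)))%SET.
have sub : H \subset inside G U :|: (\bigcup_(v | v \notin U) star v)%SET.
  apply/fintype.subsetP => e eH; have eG := fintype.subsetP HG e eH; rewrite inE.
  apply/orP; have [eU|/fintype.subsetPn[v ve vU]] := boolP (e \subset U).
    by left; exact/insideP.
  right; apply/finset.bigcupP; exists v => //.
  have [w ew] : exists w, e = [set v; w]%SET.
    have [sG _] := Gpc; have /eqP/cards2P[a [b [ab eab]]] := sG e eG.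
    move: ve; rewrite eab => /set2P[] ->; first by exists b.
    by exists a; rewrite finset.setUC.
  rewrite ew; apply: imset_f; rewrite !inE -ew eG /=; apply: HT; first by rewrite -ew.
  by move=> i; apply: contraNN vU => vi; apply/finset.bigcupP; exists i.
have H1 : (#|H| <= 54 + \sum_(v | v \notin U) #|nbr G v :&: T (col v)|)%N.
  apply: leq_trans (subset_leq_card sub) _; apply: leq_trans (leq_card_setU _ _).1 _.
  apply: leq_add; first by apply: leq_trans (inside_le Gpc U) _; rewrite (leq_mul (n1 := 3) (n2 := 18)).
  apply: leq_trans (card_bigcup_le _ _) _; apply: leq_sum => v _; exact: leq_imset_card.
pose C := (\sum_i \sum_(e in inside G (T i)) #|common G e|)%N.
have H2 : (\sum_(v | v \notin U) #|nbr G v :&: T (col v)| <= #|V| + C)%N.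
  apply: (@leq_trans (\sum_v (1 + \sum_i \sum_(e in inside G (T i)) (v \in common G e)))%N).
    rewrite big_mkcond; apply: leq_sum => v _; case: ifP => // _.
    apply: leq_trans (triangle_degree v (col v)) _; rewrite leq_add2l.
    by rewrite [X in (_ <= X)%N](bigD1 (col v)) //= leq_addr.
  rewrite big_split /= sum1_card leq_add2l exchange_big /=; apply: leq_sum => i _.
  rewrite exchange_big /=; apply: leq_sum => e _; rewrite -sum1_card [X in (_ <= X)%N]big_mkcond /=.
  by apply: leq_sum => v _; case: ifP.
have H3 : (q * C <= 18 * #|V|)%N.
  rewrite big_distrr /=; apply: (@leq_trans (\sum_(i : 'I_6) 3 * #|V|)%N); last first.
    by rewrite sum_nat_const card_ord mulnA.
  apply: leq_sum => i _; rewrite big_distrr /=.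
  apply: (@leq_trans (\sum_(e in inside G (T i)) #|V|)%N); first by apply: leq_sum => e; exact: light.
  by rewrite sum_nat_const leq_mul2r inside3 orbT.
have : (q * #|H| <= q * (54 + (#|V| + C)))%N.
  by rewrite leq_mul2l; apply/orP; right; apply: leq_trans H1 _; rewrite leq_add2l.
by move=> /leq_trans; apply; rewrite !mulnDr addnA leq_add2l.
Qed.

End CountCollapsed.

(** * Choice of the faces and passage to the limit *)

Section Limit.
Variable R : realType.

(** Each of the at most [18 * q] heavy edges spoils at most two faces. There are at least
    [2 * #|V| - 4 >= 36 * q + 6] faces, so six remain. *)
Lemma light_faces (V : finType) (G : {set {set V}}) p (c : {set V} -> R -> R * R) q :
  maximal_planar R G -> plane_graph G p c -> (18 * q + 5 <= #|V|)%N ->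
  exists x : 'I_6 -> R * R,
    [/\ forall i, ~ drawing p c finset.setT G (x i),
        forall i j, joined (drawing p c finset.setT G) (x i) (x j) -> i = j
      & forall i e, e \in touched_edges G p c (x i) -> (q * #|common G e| <= #|V|)%N].
Proof.
move=> Gmax Gpc qV; have [s fs _] := euler_formula Gpc; have [us sG sJ _] := fs.
pose heavy := [set e in G | (#|V| < q * #|common G e|)%N]%SET.
pose bad (x : R * R) := [exists e in heavy, e \in touched_edges G p c x].
have badq : (count bad s <= 36 * q)%N.
  apply: (@leq_trans (\sum_(e in heavy) 2)%N); last first.
    by rewrite sum_nat_const; have := heavy_edges_le Gpc q; rewrite -/heavy; lia.
  apply: (@leq_trans (\sum_(e in heavy) count (fun x => `[< touches_edge G p c x e >]) s)%N).
    under eq_bigr do rewrite -sum1_count big_mkcond.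
    rewrite exchange_big -sum1_count big_mkcond; apply: leq_sum => x _; case: ifP => //.
    move=> /exists_inP[e eh xe]; rewrite (bigD1 e) //=.
    by have /touched_edgesP[_ /asboolP ->] := xe.
  by apply: leq_sum => e; rewrite inE => /andP[eG _]; exact: (touches_le2 Gpc).
pose s' := [seq x <- s | ~~ bad x].
have s6 : (6 <= size s')%N.
  rewrite size_filter; have := count_predC bad s; have := maximal_face_count Gmax Gpc fs.
  have := maximal_edge_count Gmax Gpc; rewrite (@eq_count _ (predC bad) (fun x => ~~ bad x)) //.
  by lia.
have s'P (i : 'I_6) : nth 0 s' i \in s' by apply: mem_nth; exact: leq_trans s6.
have s's x : x \in s' -> x \in s /\ ~~ bad x by rewrite mem_filter => /andP[].
exists (fun i : 'I_6 => nth 0 s' i); split=> [i|i j ij|i e ei].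
- by apply: sG; have [] := s's _ (s'P i).
- apply/val_inj/eqP; rewrite -(@nth_uniq _ (0 : R * R) s') ?filter_uniq //; try exact: (leq_trans (ltn_ord _) s6).
  by apply/eqP; apply: sJ ij; [have [] := s's _ (s'P i)|have [] := s's _ (s'P j)].
- have [_ /existsPn nb] := s's _ (s'P i).
  have /touched_edgesP[eG _] := ei.
  by have := nb e; rewrite ei andbT inE eG -leqNgt.
Qed.

Lemma collapsed_lpsr (V : finType) (G : {set {set V}}) q :
  maximal_planar R G -> (18 * q + 5 <= #|V|)%N ->
  exists2 m, (q * m <= q * (54 + #|V|) + 18 * #|V|)%N & lpsr R G <= m%:R / (3 * #|V| - 6)%:R.
Proof.
move=> Gmax qV; have [_ [p [c Gpc]] _] := Gmax.
have [x [Gx xJ light]] := light_faces Gmax Gpc qV.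
have [col colP] := six_coloring Gpc.
have [H [p' [c' [GH Hx]]]] := collapse Gpc Gx xJ colP.
have [_ HG _] := GH.
exists #|H|; last first.
  by have := lpsr_le GH; rewrite -(maximal_edge_count Gmax Gpc) addnK.
apply: (collapsed_card Gpc HG (T := fun i => touched_vertices G p c (x i)) _ _ _ Hx) => i.
- by have [] := maximal_face Gmax Gpc (Gx i).
- by have [] := maximal_face Gmax Gpc (Gx i).
- move=> e /insideP[eG eT]; apply: (light i).
  by have [_ _ ->] := maximal_face Gmax Gpc (Gx i); rewrite eG.
Qed.

Lemma max_lpsr_le (e : R) : 0 < e ->
  exists N, forall n, (N <= n)%N -> max_lpsr R n <= 1 / 3 + e.
Proof.
move=> e0; have archi (a : R) : exists2 k, (0 < k)%N & a <= e * k%:R.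
  exists (Num.truncn (a / e)).+1 => //.
  by rewrite mulrC -ler_pdivrMr // ltW // truncnS_gt.
(* With this [q], the term [18 * n / q] is at most [e * n]. The other constant is the 54 of
   [collapsed_card] plus [2 + 6 * e], because 3n - 6 times 1/3 + e is n - 2 + 3en - 6e. *)
have [q q0 qe] := archi 18; have [N N0 NP] := archi (56 + 6 * e).
exists (maxn N (18 * q + 5)) => n; rewrite geq_max => /andP[Nn qn].
have [|G [Gmax ->]] := @max_lpsr_attained R n; first by lia.
have [|m mq] := @collapsed_lpsr _ G q Gmax; first by rewrite card_ord.
rewrite card_ord in mq *; move=> /le_trans; apply.
have n3 : (6 < 3 * n)%N by lia.
have d0 : 0 < (3 * n - 6)%:R :> R by rewrite ltr0n subn_gt0.
have dE : (3 * n - 6)%:R = 3 * n%:R - 6 :> R by rewrite natrB 1?ltnW // natrM.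
rewrite ler_pdivrMr // dE.
have {}q0 : 0 < q%:R :> R by rewrite ltr0n.
have {}mq : q%:R * m%:R <= q%:R * (54 + n%:R) + 18 * n%:R :> R.
  by rewrite -natrD -!natrM -natrD ler_nat.
have {}NP : 56 + 6 * e <= e * n%:R by apply: le_trans NP _; rewrite ler_pM2l // ler_nat.
have n0 : 0 <= n%:R :> R by exact: ler0n.
rewrite -(ler_pM2l q0); apply: le_trans mq _.
have h1 : 18 * n%:R <= e * q%:R * n%:R by exact: ler_wpM2r.
have h2 : q%:R * (56 + 6 * e) <= q%:R * (e * n%:R) by rewrite ler_pM2l.
by lra.
Qed.

End Limit.

Theorem corollary3 (R : realType) :
  max_lpsr R n @[n --> \oo] --> (1 / 3 : R).
Proof.
apply/cvgrPdist_le => e e0; have [N NP] := max_lpsr_le e0.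
exists (maxn N 3) => // n /=; rewrite geq_max => /andP[Nn n3].
rewrite distrC ger0_norm ?subr_ge0; last exact: max_lpsr_ge.
by rewrite lerBlDl NP.
Qed.
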